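(* Let $\Delta\subset\mathbb{R}^n$ be a compact $n$-dimensional Delzant polytope, written as $\Delta=\{x\in\mathbb{R}^n:\ \ell_i(x)\ge 0,\ i=1,\dots,d\}$, where $d$ is the number of facets and $\ell_i(x)=c_i-\langle u_i,x\rangle$ is the lattice distance to the $i$-th facet. For $x,y\in\Delta$ and $N\in\mathbb{Z}_{+}$ put $$E_N(x,y)=\prod_{i=1}^d \ell_i(y)^{N\ell_i(x)}e^{-N\ell_i(y)}\quad(\text{i.e. } E_N=\exp(N\varphi(x,y)),\ \varphi(x,y)=\textstyle\sum_{i}\ell_i(x)\log\ell_i(y)-\ell_i(y)),$$ with the convention $0^0=1$, let $c_N(x)=\int_\Delta E_N(x,y)\,dy$ ($dy$ Lebesgue measure) and $K_N(x,y)=c_N(x)^{-1}E_N(x,y)$. Then there exist differential operators $P_i(x,D):C^\infty(\Delta)\to C^\infty(\Delta)$, $i=0,1,2,\dots$, with $P_i$ of order $2i$ and $P_0=I$, such that for every $f\in C^\infty(\Delta)$ $$\int_\Delta K_N(x,y)f(y)\,dy\ \sim\ \sum_{i=0}^\infty \big(P_i(x,D)f\big)(x)\,N^{-i}\qquad (N\to\infty),$$ i.e. for every $x\in\Delta$ and every $m\ge1$, $\int_\Delta K_N(x,y)f(y)\,dy-\sum_{i=0}^{m-1}(P_i(x,D)f)(x)N^{-i}=O(N^{-m})$.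
   Context: A Delzant polytope is a compact convex polytope $\Delta=\{x:\langle u_i,x\rangle\le c_i,\ i=1,\dots,d\}$ in $\mathbb{R}^n$ where each $u_i\in(\mathbb{Z}^n)^*$ is a primitive lattice vector, outward normal to the $i$-th facet, each $c_i$ is an integer, each vertex lies on exactly $n$ facets, and the normals $u_i$ of the facets through any vertex form a $\mathbb{Z}$-basis of the lattice. (Equivalently, $\Delta$ is the moment polytope of a compact non-singular toric manifold.) The function $\ell_i$ is called the lattice distance to the $i$-th facet. *)

(* Defs.v *)
From HB Require Import structures.
From mathcomp Require Import all_boot all_order all_algebra.
From mathcomp Require Import all_classical all_reals all_analysis.
Set Implicit Arguments. Unset Strict Implicit. Unset Printing Implicit Defensive.
Import Order.TTheory GRing.Theory Num.Theory.
Import numFieldNormedType.Exports.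
Local Open Scope classical_set_scope.
Local Open Scope ring_scope.

Section Delzant.
Variable R : realType.
Variables n d : nat.

Variable u : 'I_d -> 'rV[int]_n.
Variable c : 'I_d -> int.

Definition ell (i : 'I_d) (x : 'rV[R]_n) : R :=
  (c i)%:~R - \sum_(j < n) ((u i) 0 j)%:~R * x 0 j.

Definition polytope : set 'rV[R]_n := [set x | forall i, 0 <= ell i x].

Definition primitive (v : 'rV[int]_n) : Prop :=
  forall (k : int) (w : 'rV[int]_n), v = k *: w -> k = 1 \/ k = -1.

Definition is_vertex (x : 'rV[R]_n) : Prop :=
  polytope x /\
  forall (y z : 'rV[R]_n) (t : R), polytope y -> polytope z -> 0 < t < 1 ->
    x = t *: y + (1 - t) *: z -> y = z.

Definition facets_at (x : 'rV[R]_n) : {set 'I_d} := [set i | ell i x == 0].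

Definition delzant : Prop :=
  [/\
      forall i, primitive (u i),
      (* compact (bounded; closedness is automatic) *)
      exists M : R, forall x, polytope x -> forall j, `|x 0 j| <= M,
      (* n-dimensional: nonempty interior *)
      exists x, forall i, 0 < ell i x,
      (* the i-th inequality cuts out the i-th facet (facets are distinct):
         some point of Delta lies on facet i and on no other facet *)
      forall i, exists x, ell i x = 0 /\ forall j, j != i -> 0 < ell j x
    &
      forall v, is_vertex v ->
        [/\ #|facets_at v| = n,
            forall z : 'rV[int]_n, exists a : 'I_d -> int,
              z = \sum_(i in facets_at v) a i *: u i
          & forall a : 'I_d -> int,
              \sum_(i in facets_at v) a i *: u i = 0 ->
              forall i, i \in facets_at v -> a i = 0]].

(* E_N(x,y) = prod_i ell_i(y)^(N ell_i(x)) e^(-N ell_i(y)), with 0^0 = 1 *)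
Definition E_N (N : nat) (x y : 'rV[R]_n) : R :=
  \prod_(i < d) (ell i y `^ (N%:R * ell i x) * expR (- (N%:R * ell i y))).

(* Lebesgue integral over R^n, computed as an iterated integral of
   one-dimensional Lebesgue integrals (coordinate 0 outermost). *)
Fixpoint iint (m : nat) (F : (nat -> R) -> R) : R :=
  match m with
  | 0 => F (fun _ => 0)
  | m'.+1 => Rintegral (@lebesgue_measure R) setT
       (fun t => iint m' (fun v => F (fun k => if k is k'.+1 then v k' else t)))
  end.

Definition integral_Rn (f : 'rV[R]_n -> R) : R :=
  iint n (fun v => f (\row_(j < n) v (nat_of_ord j))).

Definition integral_Delta (f : 'rV[R]_n -> R) : R :=
  integral_Rn (fun y => \1_polytope y * f y).

Definition c_N (N : nat) (x : 'rV[R]_n) : R := integral_Delta (E_N N x).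

Definition K_N (N : nat) (x y : 'rV[R]_n) : R := (c_N N x)^-1 * E_N N x y.

Definition ei (j : 'I_n) : 'rV[R]_n := delta_mx 0 j.

Fixpoint dw (w : seq 'I_n) (f : 'rV[R]_n -> R) : 'rV[R]_n -> R :=
  match w with
  | [::] => f
  | j :: w' => fun x => derive (dw w' f) x (ei j)
  end.

Definition smooth (f : 'rV[R]_n -> R) : Prop :=
  forall (w : seq 'I_n) (x : 'rV[R]_n), differentiable (dw w f) x.

Definition diffop (k : nat) (a : seq 'I_n -> 'rV[R]_n -> R)
    (f : 'rV[R]_n -> R) (x : 'rV[R]_n) : R :=
  \sum_(l < k.+1) \sum_(t : l.-tuple 'I_n) a (tval t) x * dw (tval t) f x.

End Delzant.

(* Main.v *)
(** The function [phi(x, y) = \sum_i ell_i(x) ln ell_i(y) - ell_i(y)] satisfies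
    the exact identity [grad_y phi = - H(y) (y - x)] with
    [H = \sum_i u_i u_i^T / ell_i].  The Delzant condition makes [V = H^-1] a
    rational matrix that is regular on the whole polytope, and its columns
    [V_j] are tangent to the facets, so the divergence theorem gives, with no
    boundary term,
    [N \int E_N (y_j - x_j) h = \int E_N div (h V_j)].
    A function vanishing to order [k] on the diagonal [y = x] is a combination
    of the [y_j - x_j] with coefficients vanishing to order [k - 1], so each
    integration by parts gains a factor [1 / N] and loses two orders of
    vanishing.  Starting from [g(x, y) = g(x, x) + \sum_j (y_j - x_j) h_j(x, y)]
    and iterating, the moments of the probability density [K_N(x, .)] have full
    expansions in [1 / N] whose coefficients are rational in [x] with no pole on
    the polytope; the moments of order [2 m] are [O(N^-m)].  Taylor's formula at
    [x] then reduces a smooth [f] to these moments. *)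

Require Import Defs.
From HB Require Import structures.
From mathcomp Require Import all_boot all_order all_algebra.
From mathcomp Require Import all_classical all_reals all_analysis.
From mathcomp Require Import measurable_realfun ring lra.
Set Implicit Arguments. Unset Strict Implicit. Unset Printing Implicit Defensive.
Import Order.TTheory GRing.Theory Num.Theory.
Import numFieldNormedType.Exports.
Local Open Scope classical_set_scope.
Local Open Scope ring_scope.

(** If [x] is on or near a facet, the exponent [N ell_i(x)] is zero or small, so [E_N] need not
    vanish on the boundary and its gradient may blow up there. Integration by parts is therefore
    done on a truncated integrand, and tangency of the fields pays for the derivative of the cutoff
    when its width tends to 0. The Hessian [H] is singular on the boundary as well, so [V] is read
    off from a bordered linear system whose matrix is polynomial in [y]; its invertibility comes
    from the linear independence of the normals of all facets through a point. No localisation near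
    [x] and no Laplace-type estimate occurs: the Taylor remainder is dominated by polynomial
    moments, which the exact recursion controls. As the integral is a nest of one-dimensional ones,
    measurability, translation invariance and dominated convergence are proved for it by induction
    on the dimension. Finally, the coefficients of the operators have denominators that may vanish
    off the polytope, whereas [P_i f] must agree there with a function smooth on the whole space; a
    flat function supplies the extension. *)

Section IteratedIntegral.

(** * Measurability of nested integrals in a parameter *)

Variable R : realType.
Local Notation mu := (@lebesgue_measure R).
Local Notation mR := (measurableTypeR R).
Implicit Types (m : nat) (F G : (nat -> R) -> R) (B M : R).

Definition vcons (t : R) (v : nat -> R) : nat -> R :=
  fun k => if k is k'.+1 then v k' else t.

Lemma iintS m F : iint m.+1 F = Rintegral mu setT (fun t => iint m (fun v => F (vcons t
  v))).
Proof. by []. Qed.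

(* Joint measurability of [G] in the parameter and the first [m] coordinates. *)
Fixpoint jmeas m (d : measure_display) (X : measurableType d)
    (G : X -> (nat -> R) -> R) : Prop :=
  if m is m'.+1 then
    @jmeas m' _ (X * mR)%type (fun p v => G p.1 (vcons p.2 v))
  else measurable_fun setT (fun x : X => G x (fun=> 0)).

Lemma jmeas_reparam m d (X : measurableType d) d' (Y : measurableType d')
    (h : Y -> X) (G : X -> (nat -> R) -> R) :
  measurable_fun setT h -> jmeas m G -> jmeas m (fun y => G (h y)).
Proof.
elim: m d X d' Y h G => [|m IH] d X d' Y h G mh /= mG.
  exact: (measurableT_comp mG mh).
apply: (IH _ _ _ _ (fun p : Y * mR => (h p.1, p.2)) _ _ mG).
apply/measurable_fun_pairP; split; last exact: measurable_snd.
exact: (measurableT_comp mh measurable_fst).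
Qed.

Lemma jmeas_cst m d (X : measurableType d) (g : X -> R) :
  measurable_fun setT g -> jmeas m (fun x _ => g x).
Proof.
elim: m d X g => [|m IH] d X g mg //=.
by apply: (IH _ _ (fun p : X * mR => g p.1)); apply: measurableT_comp.
Qed.

Lemma jmeas_coord m d (X : measurableType d) k : (k < m)%N ->
  jmeas m (fun (_ : X) v => v k).
Proof.
elim: m d X k => [|m IH] d X [|k] //= km; last exact: IH.
by apply: (jmeas_cst m (g := fun p : X * mR => p.2)); exact: measurable_snd.
Qed.

Lemma jmeas_op2 (op : R -> R -> R) m d (X : measurableType d)
    (G H : X -> (nat -> R) -> R) :
  (forall d' (Y : measurableType d') (f g : Y -> R),
     measurable_fun setT f -> measurable_fun setT g ->
     measurable_fun setT (fun y => op (f y) (g y))) ->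
  jmeas m G -> jmeas m H -> jmeas m (fun x v => op (G x v) (H x v)).
Proof.
move=> mop; elim: m d X G H => [|m IH] d X G H /= mG mH; first exact: mop.
exact: (IH _ _ _ _ mG mH).
Qed.

Lemma jmeasD m d (X : measurableType d) (G H : X -> (nat -> R) -> R) :
  jmeas m G -> jmeas m H -> jmeas m (fun x v => G x v + H x v).
Proof. by apply: jmeas_op2 => *; apply: measurable_funD. Qed.

Lemma jmeasM m d (X : measurableType d) (G H : X -> (nat -> R) -> R) :
  jmeas m G -> jmeas m H -> jmeas m (fun x v => G x v * H x v).
Proof. by apply: jmeas_op2 => *; apply: measurable_funM. Qed.

Lemma jmeas_comp (h : R -> R) m d (X : measurableType d) (G : X -> (nat -> R) -> R) :
  measurable_fun [set: mR] (h : mR -> mR) -> jmeas m G -> jmeas m (fun x v => h (G x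
    v)).
Proof.
move=> mh mG; apply: (@jmeas_op2 (fun a _ => h a) _ _ _ G G) => // *.
exact: (@measurableT_comp _ _ _ _ _ _ h).
Qed.

Lemma jmeas_prod m d (X : measurableType d) (I : Type) (r : seq I) (P : pred I)
    (G : I -> X -> (nat -> R) -> R) :
  (forall i, P i -> jmeas m (G i)) -> jmeas m (fun x v => \prod_(i <- r | P i) G i x v).
Proof.
move=> mG; elim: r => [|i r IH].
  have -> : (fun x v => \prod_(i <- [::] | P i) G i x v) = (fun _ _ => 1).
    by apply/funext => x; apply/funext => v; rewrite big_nil.
  exact: jmeas_cst.
have -> : (fun x v => \prod_(j <- i :: r | P j) G j x v) =
    (fun x v => (if P i then G i x v else 1) * \prod_(j <- r | P j) G j x v).
  apply/funext => x; apply/funext => v; rewrite big_cons.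
  by case: ifP => // _; rewrite mul1r.
apply: jmeasM => //; case: (boolP (P i)) => Pi; [exact: mG | exact: jmeas_cst].
Qed.

(** The induction moves the outermost coordinate into the parameter space, which is why [jmeas]
    ranges over arbitrary measurable types. That coordinate is then integrated by Tonelli
    measurability of the positive and the negative part separately, so no integrability has to be
    known. *)
Lemma measurable_iint m d (X : measurableType d) (G : X -> (nat -> R) -> R) :
  jmeas m G -> measurable_fun setT (fun x => iint m (G x)).
Proof.
elim: m d X G => [|m IH] d X G //= mG.
have := IH _ _ _ mG => /= mI.
rewrite /Rintegral.
apply: (@measurableT_comp _ _ _ _ _ _ fine); first exact: fine_measurable.
pose f (p : X * mR) : \bar R := (iint m (fun v => G p.1 (vcons p.2 v)))%:E.
have mf : measurable_fun setT f by apply/measurable_EFinP.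
rewrite (_ : (fun x => _) =
  (fun x => (\int[mu]_y f^\+ (x, y))%E - (\int[mu]_y f^\- (x, y))%E)%E); last first.
  apply/funext => x; rewrite [LHS]integralE.
  by congr (_ - _)%E; apply: eq_integral => y _; rewrite !unlock.
apply: (@emeasurable_funB _ _ _ _ (fun x => (\int[mu]_y f^\+ (x, y))%E)
  (fun x => (\int[mu]_y f^\- (x, y))%E)).
- by apply: (@measurable_fun_fubini_tonelli_F _ _ X mR R mu (f^\+)%E) => //;
  exact: measurable_funepos.
- by apply: (@measurable_fun_fubini_tonelli_F _ _ X mR R mu (f^\-)%E) => //;
  exact: measurable_funeneg.
Qed.

End IteratedIntegral.

(** * One-dimensional facts: bounded support, translation, null sets, dominated convergence *)

Section OneDim.
Variable R : realType.
Local Notation mu := (@lebesgue_measure R).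
Local Notation mR := (measurableTypeR R).

Lemma Rintegral_indic_itv (a b : R) : a <= b ->
  Rintegral mu setT (\1_`[a, b]%classic : R -> R) = b - a.
Proof.
move=> ab; rewrite /Rintegral integral_indic//= setIT lebesgue_measure_itv /=. 
by rewrite lte_fin; case: ltP => //= ba; apply/eqP; rewrite eq_sym subr_eq0 eq_le ab ba.
Qed.

Lemma integrable_bsupp (g : R -> R) (B K : R) :
  measurable_fun setT (g : mR -> mR) -> (forall t, `|g t| <= K) ->
  (forall t, B < `|t| -> g t = 0) -> mu.-integrable setT (EFin \o g).
Proof.
move=> mg gK gB.
have := @integrable_indic_itv R (- B) B true false.
move=> /= /(integrableZl measurableT K); apply: le_integrable => //.
  exact/measurable_EFinP.
move=> t _; rewrite -[X in (_ <= `|X|)%E]/((K * \1_`[(- B)%R, B]%classic t)%:E)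
  /= lee_fin indicE.
have [tB|tB] := ltP B `|t|; first by rewrite gB // normr0.
rewrite mem_set; last by rewrite /= in_itv /= -ler_norml.
by rewrite mulr1 (le_trans (gK t)) // ler_norm.
Qed.

Lemma Rintegral_bsupp_le (g : R -> R) (B K : R) : 0 <= B ->
  measurable_fun setT (g : mR -> mR) -> (forall t, `|g t| <= K) ->
  (forall t, B < `|t| -> g t = 0) -> `|Rintegral mu setT g| <= K * (B *+ 2).
Proof.
move=> B0 mg gK gB; have ig := integrable_bsupp mg gK gB.
apply: le_trans (le_normr_Rintegral measurableT ig) _.
have ii := @integrable_indic_itv R (- B) B true false.
have -> : K * (B *+ 2) = Rintegral mu setT (fun t => K * \1_`[-B, B]%classic t).
  rewrite RintegralZl // Rintegral_indic_itv; first by rewrite opprK mulr2n.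
  by rewrite ge0_cp.
apply: le_Rintegral => //; first exact: integrable_norm.
  exact: (integrableZl measurableT K ii).
move=> t _ /=; rewrite indicE.
have [tB|tB] := ltP B `|t|.
  rewrite gB // normr0 mulr_ge0 // (le_trans _ (gK 0)) //.
by rewrite mem_set ?mulr1 //= in_itv /= -ler_norml.
Qed.

(** By uniqueness of Lebesgue measure it is enough that the image measure gives half-open intervals
    their length. *)
Lemma lebesgue_measure_shift (s : R) (A : set R) : measurable A ->
  pushforward mu ((fun t => t + s) : mR -> mR) A = mu A.
Proof.
have ms : measurable_fun setT ((fun t => t + s) : mR -> mR).
  by apply: measurable_funD => //; exact: measurable_cst.
move=> mA; apply/esym.
pose nu : {measure set mR -> \bar R} := [the measure _ _ of pushforward mu ((fun t => t
  + s) : mR -> mR)].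
apply: (@lebesgue_measure_unique R (nu ms)) => //= _ [[a b]] _ <-.
rewrite /pushforward.
have -> : (fun t => t + s) @^-1` `]a, b] = `]a - s, b - s]%classic.
  apply/seteqP; split => t /=; rewrite !in_itv /= => /andP[h1 h2]; apply/andP; split;
    lra.
rewrite !lebesgue_measure_itv /= !lte_fin.
have -> : (a - s < b - s) = (a < b) by apply/idP/idP; lra.
case: ifP => // _; congr EFin; ring.
Qed.

Lemma ge0_integral_shift (h : mR -> \bar R) (s : R) :
  measurable_fun setT h -> (forall t, 0 <= h t)%E ->
  (\int[mu]_t h (t + s)%R = \int[mu]_t h t)%E.
Proof.
move=> mh h0; pose phi : mR -> mR := fun t => t + s.
have ms : measurable_fun setT phi.
  by apply: measurable_funD => //; exact: measurable_cst.
have -> : (\int[mu]_t h t = \int[pushforward mu phi]_t h t)%E.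
  by apply: eq_measure_integral => A mA _; exact/esym/lebesgue_measure_shift.
by rewrite ge0_integral_pushforward.
Qed.

Lemma Rintegral_shift (g : R -> R) (s : R) :
  measurable_fun setT (g : mR -> mR) ->
  Rintegral mu setT (fun t => g (t + s)) = Rintegral mu setT g.
Proof.
move=> mg; rewrite /Rintegral; congr fine.
have mEg : measurable_fun [set: mR] ((fun x : mR => (g x)%:E) : mR -> \bar R)
  by exact/measurable_EFinP.
rewrite [LHS]integralE [RHS]integralE; congr (_ - _)%E.
  rewrite -(@ge0_integral_shift (fun x : mR => (g x)%:E)^\+%E s) //;
    last exact: measurable_funepos.
  by apply: eq_integral => t _; rewrite !unlock.
rewrite -(@ge0_integral_shift (fun x : mR => (g x)%:E)^\-%E s) //;
  last exact: measurable_funeneg.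
by apply: eq_integral => t _; rewrite !unlock.
Qed.

Lemma Rintegral_eq_cofinite (f g : R -> R) (s : seq R) :
  measurable_fun setT (f : mR -> mR) -> measurable_fun setT (g : mR -> mR) ->
  (forall t, t \notin s -> f t = g t) -> Rintegral mu setT f = Rintegral mu setT g.
Proof.
move=> mf mg fg; congr fine; apply: ae_eq_integral => //; try exact/measurable_EFinP.
have cs : countable [set` s] by apply: finite_set_countable; exact: finite_seq.
exists [set` s]; split.
- exact: countable_measurable.
- exact: countable_lebesgue_measure0.
- move=> t /= /not_implyP[_ ne]; apply/negPn/negP => ts; apply: ne.
  by rewrite fg.
Qed.

Lemma Rintegral_dominated (f_ : nat -> R -> R) (f : R -> R) (B K : R) :
  (forall p, measurable_fun setT (f_ p : mR -> mR)) ->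
  measurable_fun setT (f : mR -> mR) ->
  (forall t, f_ ^~ t @ \oo --> f t) ->
  (forall p t, `|f_ p t| <= K) -> (forall p t, B < `|t| -> f_ p t = 0) ->
  Rintegral mu setT (f_ p) @[p --> \oo] --> Rintegral mu setT f.
Proof.
move=> mf_ mf cf fK fB.
have ii := @integrable_indic_itv R (- B) B true false.
have := integrableZl measurableT K ii => /= ik.
have [i1 _ i3] : [/\ mu.-integrable setT (EFin \o f),
  [sequence \int[mu]_x `|(f_ p x)%:E - (f x)%:E|]_p @ \oo --> 0%E &
  [sequence \int[mu]_x ((f_ p x)%:E)]_p @ \oo --> (\int[mu]_x (f x)%:E)%E]%E.
  apply: (dominated_convergence measurableT _ _ _ ik).
  - by move=> p; apply/measurable_EFinP; exact: mf_.
  - exact/measurable_EFinP.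
  - by apply: aeW => t _; apply/fine_cvgP; split; [apply: nearW|exact: cf].
  - apply: aeW => t p _; rewrite lee_fin indicE.
    have [tB|tB] := ltP B `|t|.
      by rewrite fB // normr0 mulr_ge0 // (le_trans _ (fK 0 0)) //.
    rewrite mem_set; last by rewrite /= in_itv /= -ler_norml.
    by rewrite mulr1 fK.
have /fine_cvgP[_ //] : ((\int[mu]_x (f_ p x)%:E) @[p --> \oo] --> (fine (\int[mu]_x (f
  x)%:E))%:E)%E.
by rewrite fineK //; exact: (integrable_fin_num measurableT i1).
Qed.

End OneDim.

(** * Calculus of the nested integral on bounded functions with bounded support *)

Section Nice.
Variable R : realType.
Local Notation mu := (@lebesgue_measure R).
Local Notation mR := (measurableTypeR R).
Implicit Types (m : nat) (F G : (nat -> R) -> R) (B M : R).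

(** The class on which [iint] behaves like an integral over a product space. Both constants are
    uniform, so fixing the first coordinate stays in the class with the same [B] and [M]; every
    induction on the dimension rests on this. *)
Record nice m B M F : Prop := Nice {
  nice_meas : jmeas m (fun _ : unit => F);
  nice_B : 0 <= B;
  nice_M : 0 <= M;
  nice_bound : forall v, `|F v| <= M;
  nice_supp : forall v k, (k < m)%N -> B < `|v k| -> F v = 0 }.

Lemma nice_weaken m B B' M M' F : B <= B' -> M <= M' -> nice m B M F -> nice m B' M' F.
Proof.
move=> BB MM [h1 h2 h3 h4 h5]; split => //; [exact: le_trans BB|exact: le_trans MM| |].
  by move=> v; apply: le_trans MM.
by move=> v k km Bv; apply: (h5 v k) => //; apply: le_lt_trans Bv.
Qed.

Lemma nice_meas_cons m B M F : nice m.+1 B M F ->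
  jmeas m (fun (t : mR) v => F (vcons t v)).
Proof.
move=> [h1 _ _ _ _].
apply: (@jmeas_reparam R m _ (unit * mR)%type _ mR (fun t => (tt, t))
  (fun p v => F (vcons p.2 v))) => //.
by apply/measurable_fun_pairP; split; [exact: measurable_cst|exact: measurable_id].
Qed.

Lemma nice_cons m B M F t : nice m.+1 B M F -> nice m B M (fun v => F (vcons t v)).
Proof.
move=> nF; have mF := nice_meas_cons nF; case: nF => [h1 h2 h3 h4 h5]; split => //.
  by apply: (@jmeas_reparam R m _ mR _ unit (fun=> t)) mF; exact: measurable_cst.
by move=> v k km Bv; apply: (h5 _ k.+1).
Qed.

Lemma nice_inner_meas m B M F : nice m.+1 B M F ->
  measurable_fun setT ((fun t => iint m (fun v => F (vcons t v))) : mR -> mR).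
Proof. by move=> nF; apply: measurable_iint; apply: nice_meas_cons nF. Qed.

Lemma iint0 m : iint m (fun=> 0 : R) = 0.
Proof.
elim: m => [//|m IH]; rewrite iintS; under eq_Rintegral do rewrite IH.
by rewrite Rintegral_cst // mul0r.
Qed.

Lemma nice_inner_supp m B M F t : nice m.+1 B M F -> B < `|t| ->
  iint m (fun v => F (vcons t v)) = 0.
Proof.
move=> [_ _ _ _ h5] Bt; rewrite -(iint0 m); congr iint.
by apply/funext => v; apply: (h5 _ 0%N).
Qed.

Lemma iint_bound m B M F : nice m B M F -> `|iint m F| <= M * (B *+ 2) ^+ m.
Proof.
elim: m F => [|m IH] F nF; first by rewrite expr0 mulr1; exact: nice_bound nF _.
rewrite iintS exprSr mulrA; apply: Rintegral_bsupp_le; first exact: nice_B nF.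
- exact: nice_inner_meas nF.
- by move=> t; apply: IH; apply: nice_cons.
- by move=> t; apply: nice_inner_supp nF.
Qed.

Lemma nice_inner_integrable m B M F : nice m.+1 B M F ->
  mu.-integrable setT (EFin \o (fun t => iint m (fun v => F (vcons t v)))).
Proof.
move=> nF; apply: (@integrable_bsupp R _ B (M * (B *+ 2) ^+ m)).
- exact: nice_inner_meas nF.
- by move=> t; apply: iint_bound; apply: nice_cons.
- by move=> t; apply: nice_inner_supp nF.
Qed.

Lemma eq_iint m F G : F =1 G -> iint m F = iint m G.
Proof. by move=> /funext ->. Qed.

Lemma iintD m B M B' M' F G : nice m B M F -> nice m B' M' G ->
  iint m (fun v => F v + G v) = iint m F + iint m G.
Proof.
elim: m F G => [//|m IH] F G nF nG.
rewrite !iintS -RintegralD //.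
- by apply: eq_Rintegral => t _; apply: (IH (fun v => F (vcons t v)) (fun v => G (vcons
  t v))); apply: nice_cons.
- exact: nice_inner_integrable nF.
- exact: nice_inner_integrable nG.
Qed.

Lemma iintZ m B M a F : nice m B M F -> iint m (fun v => a * F v) = a * iint m F.
Proof.
elim: m F => [//|m IH] F nF.
rewrite !iintS -RintegralZl //; last exact: nice_inner_integrable nF.
by apply: eq_Rintegral => t _; apply: (IH (fun v => F (vcons t v))); apply: nice_cons.
Qed.

Lemma iint_ge0 m F : (forall v, 0 <= F v) -> 0 <= iint m F.
Proof.
elim: m F => [|m IH] F F0; first exact: F0.
rewrite iintS; apply: Rintegral_ge0 => t _.
by apply: IH.
Qed.

Lemma iint_shift m B M F k s : (k < m)%N -> nice m B M F ->
  iint m (fun v => F (fun i => v i + (i == k)%:R * s)) = iint m F.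
Proof.
elim: m F k => [//|m IH] F [|k] km nF; rewrite !iintS.
  rewrite -[RHS](@Rintegral_shift R (fun t => iint m (fun v => F (vcons t v))) s);
    last exact: nice_inner_meas nF.
  apply: eq_Rintegral => t _; apply: eq_iint => v; congr F; apply/funext => -[|i] /=.
    by rewrite mul1r.
  by rewrite mul0r addr0.
apply: eq_Rintegral => t _.
rewrite -(IH (fun v => F (vcons t v)) k) //; last exact: nice_cons.
apply: eq_iint => v; congr F; apply/funext => -[|i] //=.
by rewrite mul0r addr0.
Qed.

(** Dominated convergence one coordinate at a time: the inner integrals converge by induction and
    are dominated by the bound of [iint_bound]. *)
Lemma iint_cvg m B M (F_ : nat -> (nat -> R) -> R) F :
  (forall p, nice m B M (F_ p)) -> nice m B M F ->
  (forall v, F_ ^~ v @ \oo --> F v) ->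
  iint m (F_ p) @[p --> \oo] --> iint m F.
Proof.
elim: m F_ F => [|m IH] F_ F nF_ nF cF; first exact: cF.
rewrite iintS; under eq_fun do rewrite iintS.
apply: (@Rintegral_dominated R (fun p t => iint m (fun v => F_ p (vcons t v)))
  _ B (M * (B *+ 2) ^+ m)).
- by move=> p; apply: nice_inner_meas.
- exact: nice_inner_meas nF.
- move=> t; apply: (IH (fun p v => F_ p (vcons t v))) => //.
    by move=> p; apply: nice_cons.
  exact: nice_cons.
- by move=> p t; apply: iint_bound; apply: nice_cons.
- by move=> p t; apply: nice_inner_supp.
Qed.

Lemma iint_ge_box m B M F (a b : nat -> R) c : nice m B M F -> (forall v, 0 <= F v) ->
  (forall k, (k < m)%N -> a k <= b k) ->
  (forall v, (forall k, (k < m)%N -> a k <= v k <= b k) -> c <= F v) ->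
  c * \prod_(k < m) (b k - a k) <= iint m F.
Proof.
elim: m F a b => [|m IH] F a b nF F0 ab cF; first by rewrite big_ord0 mulr1; apply: cF.
rewrite iintS big_ord_recl /= mulrCA mulrC.
have ab0 := ab 0%N isT.
rewrite -(Rintegral_indic_itv ab0) -RintegralZl //; last exact: integrable_indic_itv.
apply: le_Rintegral => //.
- exact: (integrableZl measurableT _ (integrable_indic_itv _ _ _ _)).
- exact: nice_inner_integrable nF.
move=> t _ /=.
case: (boolP (t \in _)) => tab /=; last by rewrite mulr0; apply: iint_ge0.
rewrite mulr1; apply: (IH _ (fun k => a k.+1) (fun k => b k.+1)) => //.
- exact: nice_cons.
- by move=> k km; apply: ab.
move=> v vab; apply: cF => -[|k] km; last exact: vab.
by move: tab; rewrite inE /= in_itv.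
Qed.

(* [h.1] and [h.2] are the normal and the offset of a hyperplane. *)
Lemma iint_eq_hyperplanes m B M B' M' F G (H : seq ((nat -> R) * R)) :
  nice m B M F -> nice m B' M' G ->
  (forall h, List.In h H -> exists2 k, (k < m)%N & h.1 k != 0) ->
  (forall v : nat -> R, (forall h, List.In h H -> \sum_(k < m) h.1 k * v k + h.2 != 0)
    -> F v = G v) ->
  iint m F = iint m G.
Proof.
elim: m F G H => [|m IH] F G H nF nG H0 FG.
  apply: FG => h hH; by have [] := H0 _ hH.
rewrite !iintS.
(* Fixing the first coordinate to [t] cuts a [good] hyperplane in a hyperplane of one dimension
   less. Any other hyperplane is a condition on [t] alone, and avoiding the finite list [s] makes
   that condition hold. *)
pose good (h : (nat -> R) * R) := [exists k : 'I_m, h.1 k.+1 != 0].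
pose s := [seq - h.2 / h.1 0%N | h <- H].
apply: (@Rintegral_eq_cofinite R _ _ s).
- exact: nice_inner_meas nF.
- exact: nice_inner_meas nG.
move=> t ts.
apply: (IH _ _ [seq ((fun k => h.1 k.+1), h.2 + h.1 0%N * t) | h <- H & good h]).
- exact: nice_cons nF.
- exact: nice_cons nG.
- move=> h' /List.in_map_iff [h [<- /List.filter_In[_ /existsP[k hk]]]].
  by exists k => //; exact: ltn_ord.
move=> v hv; apply: FG => h hH.
rewrite big_ord_recl /=.
case: (boolP (good h)) => gh.
  have : \sum_(k < m) h.1 k.+1 * v k + (h.2 + h.1 0%N * t) != 0.
    apply: (hv ((fun k => h.1 k.+1), h.2 + h.1 0%N * t)).
    by apply/List.in_map_iff; exists h; split => //; exact/List.filter_In.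
  by rewrite addrA addrC addrA.
have h0 k : (k < m)%N -> h.1 k.+1 = 0.
  move=> km; apply/eqP; move: gh; rewrite negb_exists => /forallP /(_ (Ordinal km)).
  by rewrite negbK.
rewrite big1 ?addr0; last by move=> k _; rewrite h0 // mul0r.
have h00 : h.1 0%N != 0.
  by have [[|k] km] := H0 _ hH => //; rewrite h0 // eqxx.
apply: contra ts; rewrite addr_eq0 => /eqP E.
have -> : t = - h.2 / h.1 0%N by rewrite -E mulrAC mulfV // mul1r.
rewrite /s; elim: (H) hH => //= a l IHl [->|/IHl]; rewrite in_cons ?eqxx // => ->;
  by rewrite orbT.
Qed.

End Nice.

(** * Joint measurability from separate continuity *)

Section Caratheodory.
Variable R : realType.
Local Notation mR := (measurableTypeR R).

Lemma cvg_harmonic_floor (t : R) :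
  (Num.floor (t * p.+1%:R))%:~R / p.+1%:R @[p --> \oo] --> t.
Proof.
apply/cvgrPdist_le => e e0; near=> p.
have p0 : (0 : R) < p.+1%:R by rewrite ltr0n.
have -> : t - (Num.floor (t * p.+1%:R))%:~R / p.+1%:R =
   (t * p.+1%:R - (Num.floor (t * p.+1%:R))%:~R) / p.+1%:R.
  by rewrite mulrBl mulfK ?gt_eqF.
have /andP[f1 f2] := floor_itv (t * p.+1%:R).
rewrite normrM normfV (ger0_norm (ltW p0)) ger0_norm ?subr_ge0 //.
rewrite ler_pdivrMr //.
apply: (@le_trans _ _ 1); first by rewrite lerBlDl ltW // -intrD1.
rewrite -ler_pdivrMl // mulr1.
have : e^-1 <= (Num.bound e^-1)%:R by rewrite ltW // archi_boundP // invr_ge0 ltW.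
move=> /le_trans; apply; rewrite ler_nat; apply: leqW; near: p; exact: nbhs_infty_ge.
Unshelve. all: by end_near. Qed.

(** The second variable is rounded down to a multiple of [1/(p+1)]: the rounded functions are
    measurable, being measurable in [x] on each of countably many strips, and they converge
    pointwise by continuity. *)
Lemma measurable_caratheodory d (X : measurableType d) (H : X -> R -> R) :
  (forall t, measurable_fun setT (fun x => H x t)) ->
  (forall x, continuous (H x)) ->
  measurable_fun setT (fun p : X * mR => H p.1 p.2).
Proof.
move=> mH cH.
pose q (p : nat) (t : R) : int := Num.floor (t * p.+1%:R).
apply: (@measurable_fun_cvg _ _ _ setT (fun p (z : X * mR) => H z.1 ((q p z.2)%:~R /
  p.+1%:R))); last first.
  move=> z _; apply: (@cvg_comp _ _ _ (fun p => (q p z.2)%:~R / p.+1%:R) (H z.1)).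
    exact: cvg_harmonic_floor.
  exact: cH.
move=> p.
(* The strips are naturally indexed by integers; [choice.pickle] turns the index into a natural
   number for the countable union, at the price of some empty strips. *)
pose E (k : nat) : set (X * mR) := setT `*` [set t | choice.pickle (q p t) = k].
have mE k : measurable (E k).
  apply: measurableX => //.
  have [[z zk]|nz] := pselect (exists z : int, choice.pickle z = k); last first.
    rewrite (_ : [set t | _] = set0) //; apply/seteqP; split => t //= h.
    by apply: nz; exists (q p t).
  rewrite (_ : [set t | _] = `[(z%:~R / p.+1%:R : R),
    ((z + 1)%:~R / p.+1%:R)[%classic); first exact: measurable_itv.
  have p0 : (0 : R) < p.+1%:R by rewrite ltr0n.
  apply/seteqP; split => t /=; rewrite in_itv /= ler_pdivrMr // ltr_pdivlMr //.
    by rewrite -zk => /(pcan_inj choice.pickleK) <-; exact: floor_itv.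
  by move=> h; rewrite -zk; congr choice.pickle; exact: floor_def.
have -> : [set: X * mR] = \bigcup_k E k.
  by apply/seteqP; split => z //= _; exists (choice.pickle (q p z.2)).
apply/measurable_fun_bigcup => // k.
have [[t0 h0]|nt] := pselect (exists t, choice.pickle (q p t) = k).
  apply: (eq_measurable_fun (fun z : X * mR => H z.1 ((q p t0)%:~R / p.+1%:R))).
    by move=> z; rewrite inE => -[_ /= hz]; congr (H _ (_%:~R / _));
      apply: (pcan_inj choice.pickleK); rewrite h0 hz.
  by apply: measurable_funTS; apply: (measurableT_comp (mH _)); exact: measurable_fst.
rewrite (_ : E k = set0); first exact: measurable_fun_set0.
by apply/seteqP; split => z //= -[_ hz]; apply: nt; exists z.2.
Qed.

(** Each induction step hands one coordinate over to the parameter by the previous result, and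
    continuity in one coordinate at a time suffices for that. It serves the arbitrary smooth [f],
    which is not built from elementary operations. *)
Lemma jmeas_sepcont m d (X : measurableType d) (G : X -> (nat -> R) -> R) :
  (forall v, measurable_fun setT (fun x => G x v)) ->
  (forall x v k, continuous (fun t => G x (fun i => if i == k then t else v i))) ->
  jmeas m G.
Proof.
elim: m d X G => [|m IH] d X G mG cG /=; first exact: mG.
apply: IH => [v|[x s] v k] /=.
  apply: (measurable_caratheodory (H := fun x t => G x (vcons t v))) => [t|x];
    first exact: mG.
  rewrite (_ : (fun t => _) = (fun t => G x (fun i => if i == 0%N then t else vcons 0 v
    i))).
    exact: cG.
  by apply/funext => t; congr (G x _); apply/funext => -[|i].
rewrite (_ : (fun t => _) = (fun t => G x (fun i => if i == k.+1 then t else vcons s v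
  i))).
  exact: cG.
by apply/funext => t; congr (G x _); apply/funext => -[|i].
Qed.

Lemma jmeas_continuous_row n d (X : measurableType d) (f : 'rV[R]_n -> R) :
  continuous f -> jmeas n (fun _ : X => fun v => f (\row_(j < n) v (nat_of_ord j))).
Proof.
move=> cf; apply: jmeas_sepcont => [v|x v k]; first exact: measurable_cst.
have [kn|kn] := ltnP k n; last first.
  rewrite (_ : (fun t => _) = cst (f (\row_(j < n) v (nat_of_ord j)))).
    exact: cst_continuous.
  apply/funext => t; congr f; apply/rowP => j; rewrite !mxE.
  by rewrite (ltn_eqF (leq_trans (ltn_ord j) kn)).
pose w : 'rV[R]_n := \row_(j < n) (if nat_of_ord j == k then 0 else v (nat_of_ord j)).
have -> : (fun t => f (\row_(j < n) (if nat_of_ord j == k then t else v (nat_of_ord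
  j)))) =
   f \o (fun t : R => w + t *: delta_mx 0 (Ordinal kn)).
  apply/funext => t /=; congr f; apply/rowP => j; rewrite !mxE /=.
  have -> : (j == Ordinal kn) = (nat_of_ord j == k) by [].
  by case: eqP; rewrite ?mulr1 ?add0r ?mulr0 ?addr0.
move=> t; apply: continuous_comp; last exact: cf.
apply: continuousD; first exact: cst_continuous.
exact: scalel_continuous.
Qed.

End Caratheodory.

(** * Polynomial functions *)

Section Polynomials.
Variables (R : realType) (n : nat).
Implicit Types p q : 'rV[R]_n -> R.

(** Polynomials are given by how they are generated, so that bounds, measurability, derivatives and
    division on the diagonal all go by structural induction, and determinants and adjugates are
    covered by closure under sums and products. *)
Inductive polyfun : ('rV[R]_n -> R) -> Prop :=
| polyfunC a : polyfun (fun=> a)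
| polyfunX j : polyfun (fun y => y 0 j)
| polyfunD p q : polyfun p -> polyfun q -> polyfun (fun y => p y + q y)
| polyfunM p q : polyfun p -> polyfun q -> polyfun (fun y => p y * q y).

Lemma polyfun_sum (I : Type) (r : seq I) (P : pred I) (F : I -> 'rV[R]_n -> R) :
  (forall i, P i -> polyfun (F i)) -> polyfun (fun y => \sum_(i <- r | P i) F i y).
Proof.
move=> pF; elim: r => [|i r IH].
  by rewrite (_ : (fun y => _) = (fun=> 0)); [exact: polyfunC|apply/funext => y;
    rewrite big_nil].
rewrite (_ : (fun y => _) = (fun y => (if P i then F i y else 0) + \sum_(j <- r | P j)
  F j y)); last first.
  by apply/funext => y; rewrite big_cons; case: ifP => // _; rewrite add0r.
apply: polyfunD => //; case: (boolP (P i)) => Pi; [exact: pF|exact: polyfunC].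
Qed.

Lemma polyfun_prod (I : Type) (r : seq I) (P : pred I) (F : I -> 'rV[R]_n -> R) :
  (forall i, P i -> polyfun (F i)) -> polyfun (fun y => \prod_(i <- r | P i) F i y).
Proof.
move=> pF; elim: r => [|i r IH].
  by rewrite (_ : (fun y => _) = (fun=> 1)); [exact: polyfunC|apply/funext => y;
    rewrite big_nil].
rewrite (_ : (fun y => _) = (fun y => (if P i then F i y else 1) * \prod_(j <- r | P j)
  F j y)); last first.
  by apply/funext => y; rewrite big_cons; case: ifP => // _; rewrite mul1r.
apply: polyfunM => //; case: (boolP (P i)) => Pi; [exact: pF|exact: polyfunC].
Qed.

Lemma polyfun_det k (A : 'rV[R]_n -> 'M[R]_k) :
  (forall i j, polyfun (fun y => A y i j)) -> polyfun (fun y => \det (A y)).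
Proof.
move=> pA; apply: polyfun_sum => s _; apply: polyfunM; first exact: polyfunC.
by apply: polyfun_prod => i _; exact: pA.
Qed.

Lemma polyfun_adj k (A : 'rV[R]_n -> 'M[R]_k) i j :
  (forall i j, polyfun (fun y => A y i j)) -> polyfun (fun y => \adj (A y) i j).
Proof.
move=> pA; rewrite (_ : (fun y => _) = (fun y => (-1) ^+ (j + i) * \det (row' j (col' i
  (A y))))).
  apply: polyfunM; first exact: polyfunC.
  apply: polyfun_det => a b.
  by rewrite (_ : (fun y => _) = (fun y => A y (lift j a) (lift i b)));
    [exact: pA|apply/funext => y; rewrite !mxE].
by apply/funext => y; rewrite mxE.
Qed.

End Polynomials.

(** * Vertices, independence of the normals, and the inverse Hessian *)

Section PolytopeAlgebra.
Variables (R : realType) (n d : nat) (u : 'I_d -> 'rV[int]_n) (c : 'I_d -> int).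
Local Notation Delta := (polytope (R:=R) u c).
Local Notation ell := (ell (R:=R) u c).
Implicit Types (x y z w : 'rV[R]_n).

Definition normal_dot i w : R := \sum_(j < n) (u i 0 j)%:~R * w 0 j.

Lemma ell_shift i y w t : ell i (y + t *: w) = ell i y - t * normal_dot i w.
Proof.
rewrite /ell /Defs.ell /normal_dot mulr_sumr -addrA -opprD -big_split /=; congr (_ - _).
by apply: eq_bigr => j _; rewrite !mxE; ring.
Qed.

Lemma ellB i x y : ell i x - ell i y = normal_dot i (y - x).
Proof.
have := ell_shift i x (y - x) 1; rewrite scale1r addrC subrK mul1r => ->; ring.
Qed.

Lemma ell_conv i y z t : ell i (t *: y + (1 - t) *: z) = t * ell i y + (1 - t)
  * ell i z.
Proof.
have -> : t *: y + (1 - t) *: z = z + t *: (y - z).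
  by rewrite scalerBl scale1r scalerBr addrCA.
by rewrite ell_shift -ellB; ring.
Qed.

Lemma polyfun_ell i : polyfun (ell i).
Proof.
rewrite /ell /Defs.ell (_ : (fun x => _) = (fun x => (c i)%:~R + (-1) * \sum_(j < n)
  (u i 0 j)%:~R * x 0 j)).
  apply: polyfunD; first exact: polyfunC.
  apply: polyfunM; first exact: polyfunC.
  by apply: polyfun_sum => j _; apply: polyfunM; [exact: polyfunC|exact: polyfunX].
by apply/funext => x; rewrite mulN1r.
Qed.

Lemma polytope_unbounded_dir z w M : Delta z -> (forall i, normal_dot i w <= 0) ->
  (forall x, Delta x -> forall j, `|x 0 j| <= M) -> w = 0.
Proof.
move=> Dz nw bM; apply/rowP => j; rewrite mxE; apply/eqP/negPn/negP => wj.
have w0 : 0 < `|w 0 j| by rewrite normr_gt0.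
(* With this length the [j]-th coordinate of [z + s *: w] has absolute value at least [M + 1]. *)
pose s := (M + 1 + `|z 0 j|) / `|w 0 j|.
have M0 : 0 <= M := le_trans (normr_ge0 _) (bM z Dz j).
have s0 : 0 <= s.
  by rewrite divr_ge0 // ?addr_ge0.
have Dx : Delta (z + s *: w).
  move=> i; rewrite ell_shift subr_ge0; apply: le_trans (Dz i).
  by rewrite mulr_ge0_le0.
have := bM _ Dx j; rewrite !mxE.
have := lerB_normD (s * w 0 j) (z 0 j).
rewrite normrM (ger0_norm s0) divfK ?gt_eqF // [s * _ + _]addrC => h1 h2.
have := le_trans h1 h2; rewrite addrK gerDl; lra.
Qed.

(** Among the points of the polytope lying on all facets through [y], one with the most active
    facets is a vertex. If it were inside a proper segment, the active facets would contain the
    direction of the segment, and moving along it up to the next facet would make one more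
    active. *)
Lemma sub_vertex y : delzant R u c -> Delta y ->
  exists v, is_vertex (R:=R) u c v /\ facets_at u c y \subset facets_at u c v.
Proof.
case=> _ [M bM] _ _ _ Dy.
pose P k := `[< exists z, [/\ Delta z, facets_at u c y \subset facets_at u c z &
  #|facets_at u c z| = k] >].
have exP : exists k, P k by exists #|facets_at u c y|; apply/asboolP; exists y.
have bP k : P k -> (k <= d)%N.
  by move=> /asboolP[z [_ _ <-]]; rewrite -[X in (_ <= X)%N]card_ord max_card.
case: (ex_maxnP exP bP) => k /asboolP[z [Dz sz <-]] kmax.
exists z; split => //; split => // p q t Dp Dq /andP[t0 t1] zE.
apply/eqP/negPn/negP => pq.
pose w := p - q.
have w0 : w != 0 by rewrite subr_eq0.
have azero i : i \in facets_at u c z -> normal_dot i w = 0.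
  rewrite inE zE ell_conv => /eqP E.
  have h1 : 0 <= t * ell i p by rewrite mulr_ge0 ?(ltW t0) //; exact: Dp.
  have h2 : 0 <= (1 - t) * ell i q by apply: mulr_ge0; [lra|exact: Dq].
  have /eqP : t * ell i p = 0 by lra.
  have /eqP : (1 - t) * ell i q = 0 by lra.
  rewrite !mulf_eq0 (gt_eqF t0) subr_eq0 (gt_eqF t1) /= => /eqP h3 /eqP h4.
  by rewrite -ellB h3 h4 subr0.
(* Otherwise [w] would be a recession direction of a bounded polytope. *)
have [i0 ai0] : exists i, 0 < normal_dot i w.
  apply: contrapT => /forallNP h; move/eqP: w0; apply.
  apply: (polytope_unbounded_dir Dz _ bM) => i; rewrite leNgt; apply/negP; exact: h.
(* The time at which the ray from [z] along [w] meets facet [i]; stopping at the smallest such time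
   keeps [z'] in the polytope. *)
pose F i := ell i z / normal_dot i w.
have := @arg_minP _ _ _ i0 (fun i => 0 < normal_dot i w) F ai0.
case: arg_minP => // i ai imin _.
pose z' := z + F i *: w.
have Fi0 : 0 <= F i by rewrite divr_ge0 ?(ltW ai) //; exact: Dz.
have Dz' : Delta z'.
  move=> i'; rewrite ell_shift subr_ge0.
  have [ai'|ai'] := ltP 0 (normal_dot i' w).
    by rewrite -ler_pdivlMr //; exact: imin.
  by apply: le_trans (Dz i'); rewrite mulr_ge0_le0.
have ss : facets_at u c z \subset facets_at u c z'.
  apply/fintype.subsetP => i' i'z; rewrite inE ell_shift azero // mulr0 subr0.
  by move: i'z; rewrite inE.
have nz : normal_dot i w != 0 by rewrite gt_eqF.
have iz' : i \in facets_at u c z' by rewrite inE ell_shift /F divfK // subrr eqxx.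
have inz : i \notin facets_at u c z by apply: contraL ai => /azero ->; rewrite ltxx.
have := kmax #|facets_at u c z'|.
have -> : P #|facets_at u c z'| by apply/asboolP; exists z'; split => //;
  exact: (fintype.subset_trans sz ss).
move=> /(_ isT); rewrite leqNgt => /negP; apply.
apply: proper_card; apply/properP; split => //; by exists i.
Qed.

(** The facets through [y] all pass through some vertex. There the integral combinations that give
    the unit vectors show that the matrix of normals has full column rank over the reals, and as
    there are exactly [n] normals its rows are independent too. *)
Lemma facets_independent y (m : 'I_d -> R) : delzant R u c -> Delta y ->
  (forall i, ell i y != 0 -> m i = 0) ->
  (forall j, \sum_i m i * (u i 0 j)%:~R = 0) -> forall i, m i = 0.
Proof.
move=> hD Dy m0 mU.
have [v [vv sv]] := sub_vertex hD Dy.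
case: hD => _ _ _ _ /(_ v vv) [cI spanI _].
set I := facets_at u c v in sv cI spanI.
pose A : 'M[R]_(#|I|, n) := \matrix_(k, j) (u (enum_val k) 0 j)%:~R.
have fA : row_full A.
  apply/row_fullP.
  have [a aE] := choice (fun j : 'I_n => spanI (delta_mx 0 j)).
  exists (\matrix_(j, k) (a j (enum_val k))%:~R); apply/matrixP => j l.
  rewrite !mxE; under eq_bigr do rewrite !mxE -intrM.
  rewrite -(big_enum_val (fun i => (a j i * u i 0 l)%:~R)) /=.
  have := congr1 (fun z : 'rV[int]_n => z 0 l) (aE j).
  rewrite mxE summxE => /(congr1 (fun z : int => z%:~R : R)).
  rewrite rmorph_sum /= => h.
  rewrite (eq_bigr (fun i => ((a j i *: u i) 0 l)%:~R)); last by move=> i _;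
    rewrite mxE.
  by rewrite -h eq_sym; case: eqP.
have rA : row_free A by rewrite /row_free (eqP fA) cI.
have mI i : i \notin I -> m i = 0.
  move=> iI; apply: m0; apply: contra iI => /eqP E.
  by apply: (fintype.subsetP sv); rewrite inE E.
pose mv : 'rV[R]_#|I| := \row_k m (enum_val k).
have /eqP : mv *m A == 0.
  apply/eqP/rowP => j; rewrite !mxE; under eq_bigr do rewrite !mxE.
  rewrite -(big_enum_val (fun i => m i * (u i 0 j)%:~R)) /= -[RHS](mU j).
  by rewrite [RHS](bigID (mem I)) /= [X in _ + X]big1 ?addr0 // => i /mI ->;
    rewrite mul0r.
move/eqP; rewrite mulmx_free_eq0 // => /eqP mv0 i.
case: (boolP (i \in I)) => iI; last exact: mI.
have := congr1 (fun z : 'rV[R]_#|I| => z 0 (enum_rank_in iI i)) mv0.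
by rewrite !mxE enum_rankK_in.
Qed.

Definition normals : 'M[R]_(d, n) := \matrix_(i, j) (u i 0 j)%:~R.

(* The saddle-point system [U^T M = 1], [U V = diag(ell) M]: its solution [V]
   is the inverse of the Hessian [\sum_i u_i u_i^T / ell_i], and it stays
   solvable on the boundary of the polytope. *)
Definition saddle y : 'M[R]_(n + d) :=
  block_mx 0 normals^T normals (- diag_mx (\row_i ell i y)).

(** A left kernel vector [(v, m)] satisfies [m U = 0] and [v U^T = m diag(ell)], hence the sum of
    [ell_i m_i^2] is zero. So [m] lives on the facets through [y] and vanishes by independence of
    their normals; then [v] is orthogonal to every normal and vanishes by boundedness. *)
Lemma saddle_unit y : delzant R u c -> Delta y -> saddle y \in unitmx.
Proof.
move=> hD Dy; rewrite -row_free_unit; apply: inj_row_free => w.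
rewrite -[w]hsubmxK; set v := lsubmx w; set m := rsubmx w.
rewrite mul_row_block mulmx0 add0r mulmxN -[X in _ = X -> _]row_mx0 => /eq_row_mx[mU].
move/eqP; rewrite subr_eq0 => /eqP vU.
have E : \sum_i ell i y * (m 0 i) ^+ 2 = 0.
  have <- : (m *m diag_mx (\row_i ell i y) *m m^T) 0 0 = \sum_i ell i y * (m 0 i) ^+ 2.
    by rewrite mul_mx_diag mxE; apply: eq_bigr => i _; rewrite !mxE; ring.
  by rewrite -vU -mulmxA -trmx_mul mU trmx0 mulmx0 mxE.
have E0 i : ell i y * (m 0 i) ^+ 2 = 0.
  have /eqP := E; rewrite psumr_eq0; last by move=> k _; rewrite mulr_ge0 ?sqr_ge0 //;
    exact: Dy.
  by move=> /allP /(_ i); rewrite mem_index_enum => /(_ isT) /eqP.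
have mL i : ell i y != 0 -> m 0 i = 0.
  by move=> li; have /eqP := E0 i; rewrite mulf_eq0 (negbTE li) /= sqrf_eq0 => /eqP.
have m0 : m = 0.
  apply/rowP => i; rewrite [RHS]mxE; apply: (facets_independent (m := fun i => m 0 i)
    hD Dy mL) => j.
  have := congr1 (fun z : 'rV[R]_n => z 0 j) mU; rewrite [LHS]mxE [RHS]mxE => h.
  by rewrite -[RHS]h; apply: eq_bigr => k _; rewrite [normals _ _]mxE.
have v0 : v = 0.
  case: hD => _ [M bM] _ _ _; apply: (polytope_unbounded_dir Dy _ bM) => i.
  have := congr1 (fun z : 'rV[R]_d => z 0 i) vU; rewrite m0 mul0mx [LHS]mxE [RHS]mxE.
  move=> h; have -> : normal_dot i v = 0; last by [].
  by rewrite -[RHS]h; apply: eq_bigr => k _;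
    rewrite [normals^T _ _]mxE [normals _ _]mxE mulrC.
by rewrite m0 v0 row_mx0.
Qed.

(** The square is nonnegative everywhere, as measurability of the inverse through [powR] requires,
    and positive on the polytope whatever the sign of the determinant. *)
Definition disc y : R := (\det (saddle y)) ^+ 2.

(** Where the determinant is nonzero this is an entry of the inverse of [saddle y], by Cramer's
    rule, expanded so that [disc] is the only denominator. The block read here is [V = H^-1];
    [fieldM] reads the multipliers [M = diag(ell)^-1 U V]. *)
Definition fieldV l j y : R :=
  \det (saddle y) * \adj (saddle y) (lshift d l) (lshift d j) * (disc y)^-1.
Definition fieldM i j y : R :=
  \det (saddle y) * \adj (saddle y) (rshift n i) (lshift d j) * (disc y)^-1.

Lemma disc_gt0 y : delzant R u c -> Delta y -> 0 < disc y.
Proof.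
by move=> hD Dy; rewrite exprn_even_gt0 //=; have := saddle_unit hD Dy;
  rewrite unitmxE unitfE.
Qed.

Lemma saddle_fields y j : delzant R u c -> Delta y ->
  saddle y *m col_mx (\col_l fieldV l j y) (\col_i fieldM i j y) = delta_mx (lshift d
    j) 0.
Proof.
move=> hD Dy.
have := saddle_unit hD Dy; rewrite unitmxE unitfE => det0.
have -> : col_mx (\col_l fieldV l j y) (\col_i fieldM i j y) =
   (\det (saddle y))^-1 *: col (lshift d j) (\adj (saddle y)).
  apply/colP => k; case: (split_ordP k) => l ->.
    by rewrite col_mxEu [LHS]mxE [RHS]mxE [col _ _ _ _]mxE /fieldV /disc; field.
  by rewrite col_mxEd [LHS]mxE [RHS]mxE [col _ _ _ _]mxE /fieldM /disc; field.
by rewrite -scalemxAr colE mulmxA mul_mx_adj mul_scalar_mx scalerA mulVf // scale1r.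
Qed.

(** The lower block row of the saddle system. On facet [i] the right-hand side vanishes, so the
    column [V_j] is parallel to that facet. *)
Lemma fieldV_tangent y i j : delzant R u c -> Delta y ->
  \sum_l (u i 0 l)%:~R * fieldV l j y = ell i y * fieldM i j y.
Proof.
move=> hD Dy; have := saddle_fields j hD Dy.
rewrite mul_block_col mulNmx mul_diag_mx => /(congr1 dsubmx); rewrite col_mxKd.
move=> /colP /(_ i); rewrite !mxE eq_rlshift /= => /eqP; rewrite subr_eq0 => /eqP <-.
by apply: eq_bigr => l _; rewrite !mxE.
Qed.

(** The upper block row of the saddle system; in the divergence it turns the combination of the
    [ell i x - ell i y] into the single difference [y_j - x_j]. *)
Lemma fieldM_sum y l j : delzant R u c -> Delta y ->
  \sum_i (u i 0 l)%:~R * fieldM i j y = (l == j)%:R.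
Proof.
move=> hD Dy; have := saddle_fields j hD Dy.
rewrite mul_block_col => /(congr1 usubmx); rewrite col_mxKu mul0mx add0r.
move=> /colP /(_ l); rewrite !mxE eq_lshift andbT => <-.
by apply: eq_bigr => i _; rewrite !mxE.
Qed.

Lemma polyfun_saddle a b : polyfun (fun y => saddle y a b).
Proof.
rewrite /saddle; case: (split_ordP a) => i ->; case: (split_ordP b) => j ->.
- rewrite (_ : (fun y => _) = (fun=> 0)); first exact: polyfunC.
  by apply/funext => y; rewrite block_mxEul mxE.
- rewrite (_ : (fun y => _) = (fun=> normals^T i j)); first exact: polyfunC.
  by apply/funext => y; rewrite block_mxEur.
- rewrite (_ : (fun y => _) = (fun=> normals i j)); first exact: polyfunC.
  by apply/funext => y; rewrite block_mxEdl.
rewrite (_ : (fun y => _) = (fun y => - (i == j)%:R * ell i y)).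
  by apply: polyfunM; [exact: polyfunC|exact: polyfun_ell].
apply/funext => y; rewrite block_mxEdr !mxE; case: eqP => [->|_]; ring.
Qed.

Lemma polyfun_disc : polyfun disc.
Proof.
by rewrite /disc; apply: polyfunM; apply: polyfun_det; exact: polyfun_saddle.
Qed.

End PolytopeAlgebra.

(** * Rational functions of two points and the filtration by order on the diagonal *)

Section RationalFunctions.
Variables (R : realType) (n : nat).
Implicit Types (x y z : 'rV[R]_n) (p : 'rV[R]_n -> R) (g h : 'rV[R]_n -> 'rV[R]_n -> R).

Lemma is_derive_eqfun (f g : 'rV[R]_n -> R) y v df dg :
  is_derive y v f df -> f =1 g -> df = dg -> is_derive y v g dg.
Proof. by move=> h /funext <- <-. Qed.

Lemma is_derive_coord j k (y : 'rV[R]_n) :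
  is_derive y (ei R k) (fun z : 'rV[R]_n => z 0 j) (j == k)%:R.
Proof.
have dj := @differentiable_coord R 1 n y 0 j.
apply: DeriveDef; first exact: diff_derivable.
have lf : linear (fun z : 'rV[R]_n => z 0 j : R^o) by move=> a z w; rewrite !mxE.
pose F : {linear 'rV[R]_n -> R^o} := HB.pack (fun z : 'rV[R]_n => z 0 j : R^o)
  (GRing.isLinear.Build _ _ _ _ _ lf).
rewrite deriveE // (_ : (fun z : 'rV[R]_n => z 0 j) = F) // diff_lin;
  last exact: coord_continuous.
by rewrite /F /= /ei mxE eqxx.
Qed.

Lemma polyfun_differentiable p y : polyfun p -> differentiable p y.
Proof.
elim=> [a|j|f g _ df _ dg|f g _ df _ dg].
- exact: differentiable_cst.
- exact: differentiable_coord.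
- exact: (differentiableD df dg).
- exact: (differentiableM df dg).
Qed.

Lemma polyfun_derive p k : polyfun p ->
  exists2 p', polyfun p' & forall y, is_derive y (ei R k) p (p' y).
Proof.
elim=> [a|j|f g pf [f' pf' df] pg [g' pg' dg]|f g pf [f' pf' df] pg [g' pg' dg]].
- exists (fun=> 0); first exact: polyfunC.
  by move=> y; exact: is_derive_cst.
- exists (fun=> (j == k)%:R); first exact: polyfunC.
  by move=> y; exact: is_derive_coord.
- exists (fun y => f' y + g' y); first exact: polyfunD.
  by move=> y; exact: is_deriveD.
- exists (fun y => f y * g' y + g y * f' y); first by apply: polyfunD; apply: polyfunM.
  by move=> y; exact: is_deriveM.
Qed.

Variable Q : 'rV[R]_n -> R.

Inductive ratfun : ('rV[R]_n -> 'rV[R]_n -> R) -> Prop :=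
| ratfunX p : polyfun p -> ratfun (fun x _ => p x)
| ratfunY p : polyfun p -> ratfun (fun _ y => p y)
| ratfunIX : ratfun (fun x _ => (Q x)^-1)
| ratfunIY : ratfun (fun _ y => (Q y)^-1)
| ratfunD g h : ratfun g -> ratfun h -> ratfun (fun x y => g x y + h x y)
| ratfunM g h : ratfun g -> ratfun h -> ratfun (fun x y => g x y * h x y).

Lemma ratfunC a : ratfun (fun _ _ => a).
Proof. exact: (ratfunX (polyfunC _ a)). Qed.

Lemma ratfun_sum (I : Type) (r : seq I) (P : pred I) (F : I -> 'rV[R]_n -> 'rV[R]_n ->
  R) :
  (forall i, P i -> ratfun (F i)) -> ratfun (fun x y => \sum_(i <- r | P i) F i x y).
Proof.
move=> pF; elim: r => [|i r IH].
  rewrite (_ : (fun x y => _) = (fun _ _ => 0)); first exact: ratfunC.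
  by apply/funext => x; apply/funext => y; rewrite big_nil.
rewrite (_ : (fun x y => _) = (fun x y => (if P i then F i x y else 0) + \sum_(j <- r |
  P j) F j x y)); last first.
  by apply/funext => x; apply/funext => y; rewrite big_cons; case: ifP => // _;
    rewrite add0r.
apply: ratfunD => //; case: (boolP (P i)) => Pi; [exact: pF|exact: ratfunC].
Qed.

Lemma ratfun_diff j : ratfun (fun x y => y 0 j - x 0 j).
Proof.
rewrite (_ : (fun x y => _) = (fun x y => y 0 j + (-1) * x 0 j)).
  apply: ratfunD; first exact: (ratfunY (polyfunX _ j)).
  by apply: ratfunM; [exact: ratfunC|exact: (ratfunX (polyfunX _ j))].
by apply/funext => x; apply/funext => y; rewrite mulN1r.
Qed.

Hypothesis pQ : polyfun Q.

Lemma ratfun_derive g k : ratfun g ->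
  exists2 g', ratfun g' & forall x y, Q y != 0 -> is_derive y (ei R k) (g x) (g' x y).
Proof.
elim=> [p pp|p pp|||g1 g2 _ [g1' r1 d1] _ [g2' r2 d2]|g1 g2 rg1 [g1' r1 d1]
  rg2 [g2' r2 d2]].
- exists (fun _ _ => 0); first exact: ratfunC.
  by move=> x y _; exact: is_derive_cst.
- have [p' pp' dp] := polyfun_derive k pp; exists (fun _ y => p' y);
  first exact: ratfunY.
  by move=> x y _; exact: dp.
- exists (fun _ _ => 0); first exact: ratfunC.
  by move=> x y _; exact: is_derive_cst.
- have [p' pp' dp] := polyfun_derive k pQ.
  exists (fun _ y => (-1) * ((Q y)^-1 * (Q y)^-1) * p' y).
    by apply: ratfunM; [apply: ratfunM; [exact: ratfunC|apply: ratfunM;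
      exact: ratfunIY]|exact: ratfunY].
  move=> x y Qy; have dQ := dp y; apply: DeriveDef; first exact: derivableV.
  by rewrite deriveV // derive_val -exprVn expr2 mulN1r scaleNr mulNr.
- exists (fun x y => g1' x y + g2' x y); first exact: ratfunD.
  by move=> x y Qy; apply: is_deriveD; [exact: d1|exact: d2].
- exists (fun x y => g1 x y * g2' x y + g2 x y * g1' x y); first by apply: ratfunD;
  apply: ratfunM.
  by move=> x y Qy; apply: is_deriveM; [exact: d1|exact: d2].
Qed.

Definition diff_comb (h : 'I_n -> 'rV[R]_n -> 'rV[R]_n -> R) x y : R :=
  \sum_j (y 0 j - x 0 j) * h j x y.

Lemma diff_combD (f g : 'I_n -> 'rV[R]_n -> 'rV[R]_n -> R) x y :
  diff_comb (fun j x y => f j x y + g j x y) x y = diff_comb f x y + diff_comb g x y.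
Proof. by rewrite /diff_comb -big_split /=; apply: eq_bigr => j _; rewrite mulrDr. Qed.

Lemma ratfun_diff_comb (h : 'I_n -> 'rV[R]_n -> 'rV[R]_n -> R) : (forall j,
  ratfun (h j)) -> ratfun (diff_comb h).
Proof. by move=> rh; apply: ratfun_sum => j _; apply: ratfunM => //;
  exact: ratfun_diff. Qed.

Lemma ratfun_diag g : ratfun g -> ratfun (fun x y => g x x).
Proof.
elim=> [p pp|p pp|||g1 g2 _ d1 _ d2|g1 g2 _ d1 _ d2].
- exact: ratfunX.
- exact: ratfunX.
- exact: ratfunIX.
- exact: ratfunIX.
- exact: ratfunD d1 d2.
- exact: ratfunM d1 d2.
Qed.

Lemma polyfun_hadamard p : polyfun p ->
  exists2 h : 'I_n -> _, (forall j, ratfun (h j)) &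
    forall x y, p y = p x + diff_comb h x y.
Proof.
elim=> [a|j|f g pf [f' rf df] pg [g' rg dg]|f g pf [f' rf df] pg [g' rg dg]].
- exists (fun _ _ _ => 0); first by move=> j; exact: ratfunC.
  by move=> x y; rewrite /diff_comb big1 ?addr0 // => j _; rewrite mulr0.
- exists (fun k _ _ => (k == j)%:R); first by move=> k; exact: ratfunC.
  move=> x y; rewrite /diff_comb (bigD1 j) //= eqxx mulr1 big1 ?addr0; first by ring.
  by move=> k /negbTE ->; rewrite mulr0.
- exists (fun j x y => f' j x y + g' j x y); first by move=> j; exact: ratfunD.
  move=> x y; rewrite (df x y) (dg x y) diff_combD; ring.
- exists (fun j x y => f' j x y * g y + f x * g' j x y).
    by move=> j; apply: ratfunD; apply: ratfunM => //; [exact: ratfunY|exact: ratfunX].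
  move=> x y; rewrite /diff_comb (eq_bigr (fun j => (y 0 j - x 0 j) * f' j x y * g y +
    f x * ((y 0 j - x 0 j) * g' j x y))).
    rewrite big_split /= -mulr_suml -mulr_sumr -!/(diff_comb _ x y).
    by rewrite (df x y) (dg x y); ring.
  by move=> j _; ring.
Qed.

(** Products split as [f g - f(x,x) g(x,x) = (f - f(x,x)) g + f(x,x) (g - g(x,x))], and the inverse
    of [Q] as [1/Q(y) - 1/Q(x) = - (Q(y) - Q(x)) / (Q(x) Q(y))]. The quotients are therefore
    explicit and stay in the class. *)
Lemma ratfun_hadamard g0 : ratfun g0 ->
  exists2 h : 'I_n -> _, (forall j, ratfun (h j)) &
    forall x y, Q x != 0 -> Q y != 0 -> g0 x y = g0 x x + diff_comb h x y.
Proof.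
elim=> [p pp|p pp|||f g rf [f' rf' df] rg [g' rg' dg]|f g rf [f' rf' df]
  rg [g' rg' dg]].
- exists (fun _ _ _ => 0); first by move=> j; exact: ratfunC.
  by move=> x y _ _; rewrite /diff_comb big1 ?addr0 // => j _; rewrite mulr0.
- have [h rh hE] := polyfun_hadamard pp; exists h => // x y _ _; exact: hE.
- exists (fun _ _ _ => 0); first by move=> j; exact: ratfunC.
  by move=> x y _ _; rewrite /diff_comb big1 ?addr0 // => j _; rewrite mulr0.
- have [h rh hE] := polyfun_hadamard pQ.
  exists (fun j x y => (-1) * ((Q x)^-1 * (Q y)^-1) * h j x y).
    move=> j; apply: ratfunM => //; apply: ratfunM; first exact: ratfunC.
    by apply: ratfunM; [exact: ratfunIX|exact: ratfunIY].
  move=> x y Qx Qy; rewrite /diff_comb (eq_bigr (fun j => - ((Q x)^-1 * (Q y)^-1)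
    * ((y 0 j - x 0 j) * h j x y))).
    rewrite -mulr_sumr -/(diff_comb h x y).
    have -> : diff_comb h x y = Q y - Q x by rewrite (hE x y); ring.
    by field; apply/andP.
  by move=> j _; ring.
- exists (fun j x y => f' j x y + g' j x y); first by move=> j; exact: ratfunD.
  move=> x y Qx Qy; rewrite (df x y) // (dg x y) // diff_combD; ring.
- exists (fun j x y => f' j x y * g x y + f x x * g' j x y).
    by move=> j; apply: ratfunD; apply: ratfunM => //; exact: ratfun_diag.
  move=> x y Qx Qy; rewrite /diff_comb (eq_bigr (fun j => (y 0 j - x 0 j)
    * f' j x y * g x y + f x x * ((y 0 j - x 0 j) * g' j x y))).
    rewrite big_split /= -mulr_suml -mulr_sumr -!/(diff_comb _ x y).
    by rewrite (df x y) // (dg x y) //; ring.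
  by move=> j _; ring.
Qed.

Lemma polyfun_bounded (D : set 'rV[R]_n) M p :
  (forall y, D y -> forall j, `|y 0 j| <= M) -> polyfun p ->
  exists C, forall y, D y -> `|p y| <= C.
Proof.
move=> DM; elim=> [a|j|f g _ [a ha] _ [b hb]|f g _ [a ha] _ [b hb]].
- by exists `|a|.
- by exists M => y Dy; exact: DM.
- exists (a + b) => y Dy; apply: le_trans (ler_normD _ _) _.
  by rewrite lerD // ?ha ?hb.
- by exists (a * b) => y Dy; rewrite normrM ler_pM // ?ha ?hb.
Qed.

Lemma ratfun_bounded (D : set 'rV[R]_n) M e g :
  (forall y, D y -> forall j, `|y 0 j| <= M) -> 0 < e -> (forall y, D y -> e <= Q y) ->
  ratfun g -> exists C, forall x y, D x -> D y -> `|g x y| <= C.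
Proof.
move=> DM e0 De; have iQ y : D y -> `|(Q y)^-1| <= e^-1.
  move=> Dy; have Qy := lt_le_trans e0 (De y Dy).
  by rewrite ger0_norm ?invr_ge0 ?(ltW Qy) // lef_pV2 ?posrE // De.
elim=> [p pp|p pp|||f g' _ [a ha] _ [b hb]|f g' _ [a ha] _ [b hb]].
- by have [C hC] := polyfun_bounded DM pp; exists C => x y Dx _; exact: hC.
- by have [C hC] := polyfun_bounded DM pp; exists C => x y _; exact: hC.
- by exists e^-1 => x y Dx _; exact: iQ.
- by exists e^-1 => x y _; exact: iQ.
- exists (a + b) => x y Dx Dy; apply: le_trans (ler_normD _ _) _.
  by rewrite lerD // ?ha ?hb.
- by exists (a * b) => x y Dx Dy; rewrite normrM ler_pM // ?ha ?hb.
Qed.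

Lemma jmeas_polyfun d (X : measurableType d) p : polyfun p ->
  jmeas n (fun (_ : X) v => p (\row_(j < n) v (nat_of_ord j))).
Proof.
elim=> [a|j|f g _ mf _ mg|f g _ mf _ mg].
- exact: jmeas_cst.
- rewrite (_ : (fun _ v => _) = (fun (_ : X) v => v (nat_of_ord j)));
  first exact: jmeas_coord.
  by apply/funext => x; apply/funext => v; rewrite mxE.
- exact: jmeasD.
- exact: jmeasM.
Qed.

Lemma jmeas_ratfun d (X : measurableType d) g x : (forall y, 0 <= Q y) -> ratfun g ->
  jmeas n (fun (_ : X) v => g x (\row_(j < n) v (nat_of_ord j))).
Proof.
move=> Q0; elim=> [p pp|p pp|||f g' _ mf _ mg|f g' _ mf _ mg].
- exact: jmeas_cst.
- exact: jmeas_polyfun.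
- exact: jmeas_cst.
- rewrite (_ : (fun _ v => _) = (fun (_ : X) v => Q (\row_(j < n) v (nat_of_ord j))
  `^ (-1))).
    by apply: (jmeas_comp (h := fun a => a `^ (-1)));
      [exact: measurable_powR|exact: jmeas_polyfun].
  by apply/funext => z; apply/funext => v; rewrite powR_inv1.
- exact: jmeasD.
- exact: jmeasM.
Qed.

(* [g] lies in the [k]-th power of the ideal of the diagonal [y = x]. *)
Fixpoint vanish k g : Prop :=
  if k is k'.+1 then exists2 h : 'I_n -> _, (forall j, vanish k' (h j)) & g = diff_comb
    h
  else ratfun g.

Lemma vanish_ratfun k g : vanish k g -> ratfun g.
Proof.
elim: k g => [//|k IH] g [h vh ->]; apply: ratfun_diff_comb => j; exact: (IH _ (vh j)).
Qed.

Lemma vanishD k g h : vanish k g -> vanish k h -> vanish k (fun x y => g x y + h x y).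
Proof.
elim: k g h => [|k IH] g h; first exact: ratfunD.
move=> [a va ->] [b vb ->]; exists (fun j x y => a j x y + b j x y); first by move=> j;
  exact: (IH _ _ (va j) (vb j)).
by apply/funext => x; apply/funext => y; rewrite diff_combD.
Qed.

Lemma vanishMr k g h : vanish k g -> ratfun h -> vanish k (fun x y => g x y * h x y).
Proof.
elim: k g => [|k IH] g; first exact: ratfunM.
move=> [a va ->] rh; exists (fun j x y => a j x y * h x y); first by move=> j;
  exact: (IH _ (va j) rh).
apply/funext => x; apply/funext => y; rewrite /diff_comb mulr_suml.
by apply: eq_bigr => j _; rewrite mulrA.
Qed.

Lemma vanish0 k : vanish k (fun _ _ => 0).
Proof.
elim: k => [|k IH]; first exact: ratfunC.
exists (fun _ _ _ => 0) => //.
by apply/funext => x; apply/funext => y; rewrite /diff_comb big1 // => j _;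
  rewrite mulr0.
Qed.

Lemma vanish_sum k (I : Type) (r : seq I) (F : I -> 'rV[R]_n -> 'rV[R]_n -> R) :
  (forall i, vanish k (F i)) -> vanish k (fun x y => \sum_(i <- r) F i x y).
Proof.
move=> pF; elim: r => [|i r IH].
  rewrite (_ : (fun x y => _) = (fun _ _ => 0)); first exact: vanish0.
  by apply/funext => x; apply/funext => y; rewrite big_nil.
rewrite (_ : (fun x y => _) = (fun x y => F i x y + \sum_(j <- r) F j x y));
  first exact: vanishD.
by apply/funext => x; apply/funext => y; rewrite big_cons.
Qed.

Lemma vanish_diffM k j g : vanish k g -> vanish k.+1 (fun x y => (y 0 j - x 0 j)
  * g x y).
Proof.
move=> vg; exists (fun i x y => (i == j)%:R * g x y).
  move=> i; rewrite (_ : (fun x y => _) = (fun x y => g x y * (i == j)%:R)).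
    by apply: vanishMr => //; exact: ratfunC.
  by apply/funext => x; apply/funext => y; rewrite mulrC.
apply/funext => x; apply/funext => y; rewrite /diff_comb (bigD1 j) //= eqxx mul1r big1
  ?addr0 //.
by move=> i /negbTE ->; rewrite mul0r mulr0.
Qed.

(** In the Leibniz rule for [(y_j - x_j) h_j], differentiating the linear factor leaves [h_l], of
    order one less, while differentiating [h_j] loses an order that the linear factor gives back. *)
Lemma vanish_derive k g l : vanish k g ->
  exists2 g', vanish k.-1 g' & forall x y, Q y != 0 -> is_derive y (ei R l) (g x)
    (g' x y).
Proof.
elim: k g => [|k IH] g; first exact: ratfun_derive.
move=> [h vh ->].
have ex j : exists hj, vanish k.-1 hj /\
    forall x y, Q y != 0 -> is_derive y (ei R l) (h j x) (hj x y).
  by have [g' ? ?] := IH _ (vh j); exists g'.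
have [h' h'P] := choice ex.
exists (fun x y => h l x y + diff_comb h' x y).
  apply: vanishD; first exact: vh.
  (* When [h] has order 0 its derivative cannot drop further: truncated subtraction keeps the order
     at 0, and being rational is all that is asked. *)
  case: k {IH ex} vh h'P => [|k] vh h'P /=; last by exists h' => // j; case: (h'P j).
  by apply: ratfun_diff_comb => j; case: (h'P j).
move=> x y Qy.
have E : is_derive y (ei R l) (\sum_j (fun z => (z 0 j - x 0 j) * h j x z))
   (\sum_j ((y 0 j - x 0 j) * h' j x y + h j x y * (j == l)%:R)).
  apply: is_derive_sum => j; apply: is_deriveM; last by apply: (h'P j).2.
  apply: is_derive_eqfun (is_deriveD (is_derive_coord j l y) (is_derive_cst (- x 0 j)
    y (ei R l))) _ _ => //.
  by rewrite addr0.
apply: is_derive_eqfun E _ _.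
  by move=> z; rewrite fct_sumE.
rewrite big_split /= addrC; congr (_ + _).
by rewrite (bigD1 l) //= eqxx mulr1 big1 ?addr0 // => j /negbTE ->; rewrite mulr0.
Qed.

End RationalFunctions.

(** * The flat function [exp(-1/t)] *)

Section FlatFunction.
Variable R : realType.

Lemma is_derive_cvg (V W : normedModType R) (f : V -> W) (a v : V) (df : W) :
  h^-1 *: (f (h *: v + a) - f a) @[h --> (0:R)^'] --> df -> is_derive a v f df.
Proof.
move=> cf; apply: DeriveDef; first by apply/cvg_ex; exists df.
exact: cvg_lim.
Qed.

(** The powers of [1/t] make the family stable under differentiation: the derivative of [psi k] is a
    combination of [psi k.+1] and [psi k.+2], so smoothness of [psi 0] becomes an induction over the
    whole family. *)
Definition psi (k : nat) (t : R) : R := if 0 < t then t ^- k * expR (- t^-1) else 0.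

Lemma psi_ge0 k t : 0 <= psi k t.
Proof.
rewrite /psi; case: ifP => // t0; rewrite mulr_ge0 ?expR_ge0 // invr_ge0 exprn_ge0 //.
exact: ltW.
Qed.

Lemma psi_gt0 k t : 0 < t -> 0 < psi k t.
Proof. by move=> t0; rewrite /psi t0 mulr_gt0 ?expR_gt0 // invr_gt0 exprn_gt0. Qed.

Lemma psi_le0 k t : t <= 0 -> psi k t = 0.
Proof. by rewrite /psi leNgt => /negbTE ->. Qed.

(** The exponential of [1/t] dominates the term of degree [k + 1] of its series, which leaves one
    factor [t] after the powers cancel. This gives differentiability at 0. *)
Lemma psi_le_linear k t : 0 < t -> psi k t <= (k.+1)`!%:R * t.
Proof.
move=> t0; rewrite /psi t0.
have s0 : 0 <= t^-1 by rewrite invr_ge0 ltW.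
have := le_trans _ (expR_ge1Dxn k s0).
move=> /(_ (t^-1 ^+ k.+1 / k.+1`!%:R)); rewrite lerDr ler01 => /(_ isT).
have f0 : (0 : R) < k.+1`!%:R by rewrite ltr0n fact_gt0.
rewrite ler_pdivrMr // => h.
rewrite expRN ler_pdivrMr ?expR_gt0 //.
have -> : t ^- k = t^-1 ^+ k.+1 * t.
  by rewrite exprSr -mulrA mulVf ?gt_eqF // mulr1 exprVn.
apply: le_trans (ler_wpM2r (ltW t0) h) _.
by rewrite [X in _ <= X]mulrC mulrA.
Qed.

Lemma is_derive_psi k (t : R) : is_derive t 1 (psi k) (psi k.+2 t - k%:R * psi k.+1 t).
Proof.
have [t0|t0|->] := ltrgt0P t.
- have d1 : is_derive t 1 (fun s : R => s ^+ k) ((k%:R * t ^+ k.-1) *: 1).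
    rewrite (_ : (fun s : R => s ^+ k) = id ^+ k).
      exact: (@is_deriveX R R id k t 1 1 (is_derive_id _ _)).
    by apply/funext => s; rewrite exprfctE.
  have tk : t ^+ k != 0 by rewrite expf_neq0 // gt_eqF.
  have d2 := @is_deriveV _ (fun s : R => s ^+ k) t _ 1 tk d1.
  have tn : t != 0 by rewrite gt_eqF.
  have d3 := @is_deriveV _ id t 1 1 tn (is_derive_id _ _).
  have d4 := is_deriveN d3.
  have d5 := @is_derive1_comp _ expR _ t _ _ (is_derive_expR _) d4.
  have d6 := is_deriveM d2 d5.
  apply: (@near_eq_is_derive R R R (fun s : R => s ^- k * expR (- s^-1)) (psi k) t 1).
    near=> s; rewrite /psi ifT //; near: s; exact: lt_nbhsr.
  apply: (is_derive_eq d6).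
  rewrite /psi t0 /= /GRing.scale /= !mulr1 opprK -[(- _) t]/(- t^-1).
  case: k {d1 d2 d6} tk => [|k] tk; first by rewrite !expr0 /=; field.
  rewrite !exprS; field.
  by rewrite tn expf_neq0.
- rewrite !psi_le0 ?ltW // mulr0 subr0.
  apply: (@near_eq_is_derive R R R (cst 0) (psi k) t 1 0 _ (is_derive_cst _ _ _)).
  near=> s; rewrite psi_le0 // ltW //; near: s; exact: lt_nbhsl.
- rewrite !psi_le0 // mulr0 subr0.
  apply: is_derive_cvg; apply/cvgrPdist_le => e e0.
  near=> h.
  have hn : h != 0 by near: h; exact: nbhs_dnbhs_neq.
  rewrite sub0r normrN addr0 [psi k 0]psi_le0 // subr0 [h *: _]mulr1.
  rewrite /GRing.scale /= normrM normfV (ger0_norm (psi_ge0 _ _)).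
  have [h0|h0] := leP h 0; first by rewrite psi_le0 // mulr0 ltW.
  rewrite gtr0_norm //.
  (* The division in the difference quotient is absorbed by raising the index, so the linear bound
     applies again. *)
  have -> : h^-1 * psi k h = psi k.+1 h by rewrite /psi h0 exprS invfM mulrA.
  apply: le_trans (psi_le_linear _ h0) _.
  rewrite -ler_pdivlMl; last by rewrite ltr0n fact_gt0.
  apply: le_trans (ler_norm h) _; near: h.
  apply: dnbhs0_le; rewrite mulr_gt0 // invr_gt0 ltr0n fact_gt0 //.
Unshelve. all: by end_near. Qed.

End FlatFunction.

(** * Smooth functions and smooth extension of rational functions *)

Section SmoothFunctions.
Variables (R : realType) (n : nat).
Implicit Types (f g q : 'rV[R]_n -> R) (k : nat).

(** [dw] adds derivatives on the outside, [Ck] peels them off from the inside. The rules for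
    products, inverses and compositions are then applied to [f] itself, and the induction runs on
    the order. *)
Fixpoint Ck k f : Prop :=
  if k is k'.+1 then (forall x, differentiable f x) /\
    forall j, Ck k' (fun x => 'D_(ei R j) f x)
  else True.

Lemma dw_rcons w j f : dw (rcons w j) f = dw w (fun x => 'D_(ei R j) f x).
Proof. by elim: w => [//|i w IH] /=; rewrite IH. Qed.

Lemma smooth_Ck f : smooth f <-> forall k, Ck k f.
Proof.
split=> [sf k|cf w].
  elim: k f sf => [//|k IH] f sf; split; first exact: (sf [::]).
  by move=> j; apply: IH => w x; rewrite -dw_rcons; exact: sf.
have : Ck (size w).+1 f by exact: cf.
elim/last_ind: w f {cf} => [|w j IH] f; first by case.
by rewrite size_rcons => -[_ /(_ j) h] x; rewrite dw_rcons; exact: IH.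
Qed.

Lemma CkS k f : Ck k.+1 f <->
  (forall x, differentiable f x) /\ forall j, Ck k (fun x => 'D_(ei R j) f x).
Proof. by []. Qed.

Lemma Ck_le k f : Ck k.+1 f -> Ck k f.
Proof.
elim: k f => [//|k IH] f /CkS[df h]; split => // j; exact: (IH _ (h j)).
Qed.

Lemma Ck_cst k a : Ck k (fun=> a).
Proof.
elim: k a => [//|k IH] a; split; first by move=> x; exact: differentiable_cst.
move=> j; rewrite (_ : (fun x => 'D_(ei R j) (fun=> a) x) = (fun=> 0)); first exact: IH.
by apply/funext => x; rewrite derive_cst.
Qed.

Lemma Ck_coord k i : Ck k (fun x : 'rV[R]_n => x 0 i).
Proof.
case: k => [//|k]; split; first by move=> x; exact: differentiable_coord.
move=> j; rewrite (_ : (fun x => _) = (fun=> (i == j)%:R)); first exact: Ck_cst.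
by apply/funext => x; have h := is_derive_coord i j x; rewrite derive_val.
Qed.

Lemma CkD k f g : Ck k f -> Ck k g -> Ck k (fun x => f x + g x).
Proof.
elim: k f g => [//|k IH] f g /CkS[df hf] /CkS[dg hg]; split.
  by move=> x; exact: (differentiableD (df x) (dg x)).
move=> j; rewrite (_ : (fun x => _) = (fun x => 'D_(ei R j) f x + 'D_(ei R j) g x)).
  exact: (IH _ _ (hf j) (hg j)).
by apply/funext => x; rewrite -deriveD //; exact: diff_derivable.
Qed.

Lemma CkM k f g : Ck k f -> Ck k g -> Ck k (fun x => f x * g x).
Proof.
elim: k f g => [//|k IH] f g cf cg; have [df hf] := (CkS _ _).1 cf;
  have [dg hg] := (CkS _ _).1 cg; split.
  by move=> x; exact: (differentiableM (df x) (dg x)).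
move=> j; rewrite (_ : (fun x => _) = (fun x => f x * 'D_(ei R j) g x + g x * 'D_(ei R
  j) f x)).
  by apply: CkD; apply: IH; [exact: Ck_le|exact: hg|exact: Ck_le|exact: hf].
by apply/funext => x; rewrite -[LHS]/('D_(ei R j) (f * g) x) deriveM //;
  exact: diff_derivable.
Qed.

Lemma CkV k f : (forall x, f x != 0) -> Ck k f -> Ck k (fun x => (f x)^-1).
Proof.
move=> f0; elim: k => [//|k IH] cf; have [df hf] := (CkS _ _).1 cf; split.
  by move=> x; exact: differentiableV.
move=> j; rewrite (_ : (fun x => _) = (fun x => (-1 * ((f x)^-1 * (f x)^-1))
  * 'D_(ei R j) f x)).
  have h : Ck k (fun x => (f x)^-1) by apply: IH; exact: Ck_le.
  exact: (CkM (CkM (Ck_cst k (-1)) (CkM h h)) (hf j)).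
apply/funext => x; rewrite deriveV //; last exact: diff_derivable.
by rewrite -exprVn expr2 mulN1r scaleNr mulNr.
Qed.

Lemma Ck_psi k i q : Ck k q -> Ck k (fun x => psi i (q x)).
Proof.
elim: k i q => [//|k IH] i q cq; have [dq hq] := (CkS _ _).1 cq.
have dpsi l t : differentiable (@psi R l) t.
  by apply/derivable1_diffP; case: (is_derive_psi l t).
split; first by move=> x; exact: (differentiable_comp (dq x) (dpsi _ _)).
move=> j; rewrite (_ : (fun x => _) = (fun x => (psi i.+2 (q x) + (- i%:R)
  * psi i.+1 (q x)) * 'D_(ei R j) q x)).
  have cp l : Ck k (fun x => psi l (q x)) by apply: IH; exact: Ck_le.
  exact: (CkM (CkD (cp i.+2) (CkM (Ck_cst k (- i%:R)) (cp i.+1))) (hq j)).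
apply/funext => x; rewrite deriveE; last exact: (differentiable_comp (dq x) (dpsi _ _)).
rewrite (_ : (fun x => psi i (q x)) = psi i \o q) // diff_comp // [LHS]/= diff1E //
  -deriveE //.
rewrite derive1E (@derive_val _ _ _ _ _ _ _ (is_derive_psi i (q x))) /GRing.scale /=.
by rewrite mulrC mulNr.
Qed.

Lemma Ck_polyfun k p : polyfun p -> Ck k p.
Proof.
elim=> [a|j|f g _ cf _ cg|f g _ cf _ cg].
- exact: Ck_cst.
- exact: Ck_coord.
- exact: CkD.
- exact: CkM.
Qed.

Lemma Ck_sum k (I : Type) (r : seq I) (F : I -> 'rV[R]_n -> R) :
  (forall i, Ck k (F i)) -> Ck k (fun x => \sum_(i <- r) F i x).
Proof.
move=> pF; elim: r => [|i r IH].
  rewrite (_ : (fun x => _) = (fun _ => 0)); first exact: Ck_cst.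
  by apply/funext => x; rewrite big_nil.
rewrite (_ : (fun x => _) = (fun x => F i x + \sum_(j <- r) F j x)); first exact: CkD.
by apply/funext => x; rewrite big_cons.
Qed.

(* The denominator is positive everywhere: its second summand is positive
   for [q < e], its first one for [q > e / 2]. *)
Lemma smooth_inv_ext q (e : R) : 0 < e -> (forall k, Ck k q) ->
  exists2 s, (forall k, Ck k s) & forall x, e <= q x -> s x = (q x)^-1.
Proof.
move=> e0 cq.
pose den x := q x * psi 0 (q x - e / 2) + psi 0 (e - q x).
have den0 x : 0 < den x.
  rewrite /den; have [h|h] := leP (q x) (e / 2).
    rewrite [psi 0 (q x - _)]psi_le0 ?mulr0 ?add0r; last by lra.
    by apply: psi_gt0; lra.
  rewrite ltr_pwDl ?psi_ge0 // mulr_gt0 ?psi_gt0 //; lra.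
exists (fun x => psi 0 (q x - e / 2) * (den x)^-1) => [k|x ex].
  have c1 : Ck k (fun x => psi 0 (q x - e / 2)).
    by apply: Ck_psi; apply: CkD; [exact: cq|exact: Ck_cst].
  apply: CkM => //; apply: CkV; first by move=> x; rewrite gt_eqF.
  apply: CkD; first by apply: CkM.
  apply: Ck_psi; rewrite (_ : (fun x => _) = (fun x => e + (-1) * q x)).
    by apply: CkD; [exact: Ck_cst|apply: CkM; [exact: Ck_cst|exact: cq]].
  by apply/funext => x; rewrite mulN1r.
rewrite /den [psi 0 (e - _)]psi_le0; last by lra.
have h : psi 0 (q x - e / 2) != 0 by rewrite gt_eqF // psi_gt0 //; lra.
by rewrite addr0 invfM mulrCA mulrV ?mulr1 // unitfE.
Qed.

(** The inverse of [Q] may have poles outside [D], so it is replaced by a globally smooth function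
    equal to it wherever [Q] is at least [e]; the remaining operations preserve smoothness. *)
Lemma ratfun_diag_smooth (D : set 'rV[R]_n) (Q : 'rV[R]_n -> R) (e : R)
    (g : 'rV[R]_n -> 'rV[R]_n -> R) :
  polyfun Q -> 0 < e -> (forall x, D x -> e <= Q x) -> ratfun Q g ->
  exists2 s, (forall k, Ck k s) & forall x, D x -> s x = g x x.
Proof.
move=> pQ e0 De.
have [s cs sE] := smooth_inv_ext e0 (fun k => Ck_polyfun k pQ).
elim=> [p pp|p pp|||g1 g2 _ [a ca ha] _ [b cb hb]|g1 g2 _ [a ca ha] _ [b cb hb]].
- by exists p => // k; exact: Ck_polyfun.
- by exists p => // k; exact: Ck_polyfun.
- by exists s => // x Dx; rewrite sE // De.
- by exists s => // x Dx; rewrite sE // De.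
- by exists (fun x => a x + b x) => [k|x Dx]; [exact: CkD|rewrite ha // hb].
- by exists (fun x => a x * b x) => [k|x Dx]; [exact: CkM|rewrite ha // hb].
Qed.

End SmoothFunctions.

(** * A cutoff near the facets *)

Section Cutoff.
Variable R : realType.
Local Notation mR := (measurableTypeR R).
Implicit Types (e s : R).

Definition pospart s : R := Num.max 0 s.

Lemma pospart_ge0 s : 0 <= pospart s.
Proof. by rewrite /pospart le_max lexx. Qed.

Lemma pospart_le0 s : s <= 0 -> pospart s = 0.
Proof. by move=> s0; rewrite /pospart; apply/max_idPl. Qed.

Lemma pospart_gt0 s : 0 <= s -> pospart s = s.
Proof. by move=> s0; rewrite /pospart; apply/max_idPr. Qed.

Lemma is_derive_pospart2 s : is_derive s 1 (fun t : R => pospart t ^+ 2)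
  (2 * pospart s).
Proof.
have [s0|s0|->] := ltrgt0P s.
- have d1 : is_derive s 1 (fun t : R => t ^+ 2) ((2 * s ^+ 1) *: 1).
    rewrite (_ : (fun t : R => t ^+ 2) = id ^+ 2).
      exact: (@is_deriveX R R id 2 s 1 1 (is_derive_id _ _)).
    by apply/funext => t; rewrite exprfctE.
  apply: (@near_eq_is_derive R R R (fun t : R => t ^+ 2) _ s 1).
    near=> t; rewrite pospart_gt0 //; apply: ltW; near: t; exact: lt_nbhsr.
  apply: (is_derive_eq d1); rewrite pospart_gt0; last exact: ltW.
  by rewrite expr1 /GRing.scale /= mulr1.
- rewrite [pospart s]pospart_le0 ?ltW // mulr0.
  apply: (@near_eq_is_derive R R R (cst 0) _ s 1 0 _ (is_derive_cst _ _ _)).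
  near=> t; rewrite pospart_le0 ?expr0n //; apply: ltW; near: t; exact: lt_nbhsl.
- rewrite [pospart 0]pospart_le0 // mulr0.
  apply: is_derive_cvg; apply/cvgrPdist_le => e e0.
  near=> h.
  have hn : h != 0 by near: h; exact: nbhs_dnbhs_neq.
  rewrite sub0r normrN addr0 [pospart 0]pospart_le0 // expr0n subr0 [h *: _]mulr1.
  rewrite /GRing.scale /= normrM normfV normrX (ger0_norm (pospart_ge0 _)).
  have [h0|h0] := leP h 0; first by rewrite pospart_le0 // expr0n mulr0 ltW.
  rewrite pospart_gt0 ?ltW // gtr0_norm // expr2 mulrA mulVf // mul1r.
  rewrite (le_lt_trans (ler_norm h)) //; near: h; exact: dnbhs0_lt.
Unshelve. all: by end_near. Qed.

(* A [C^1] cutoff chosen so that [s * dcutoff e s] stays bounded as [e] tends to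
   [0], which is what a vector field tangent to the facets can absorb. *)
Definition cutoff e s : R := pospart (s - e) ^+ 2 * (pospart (s - e) ^+ 2 + e ^+ 2)^-1.

Definition dcutoff e s : R := 2 * pospart (s - e) * e ^+ 2 *
  ((pospart (s - e) ^+ 2 + e ^+ 2)^-1 * (pospart (s - e) ^+ 2 + e ^+ 2)^-1).

Lemma cut_den_gt0 e s : 0 < e -> 0 < pospart (s - e) ^+ 2 + e ^+ 2.
Proof. by move=> e0; rewrite ltr_wpDl ?sqr_ge0 // exprn_gt0. Qed.

Lemma is_derive_cut e s : 0 < e -> is_derive s 1 (cutoff e) (dcutoff e s).
Proof.
move=> e0.
have d1 : is_derive s 1 (fun t : R => pospart (t - e) ^+ 2) (2 * pospart (s - e)).
  have dB : is_derive s 1 (fun t : R => t - e) (1 - 0).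
    exact: (is_deriveB (is_derive_id _ _) (is_derive_cst _ _ _)).
  have := @is_derive1_comp R (fun t => pospart t ^+ 2) (fun t => t - e)
    s _ _ (is_derive_pospart2 (s - e)) dB.
  by rewrite subr0 mulr1.
have d2 : is_derive s 1 (fun t : R => pospart (t - e) ^+ 2 + e ^+ 2) (2 * pospart (s -
  e) + 0).
  exact: (is_deriveD d1 (is_derive_cst _ _ _)).
have den0 : pospart (s - e) ^+ 2 + e ^+ 2 != 0 by rewrite gt_eqF // cut_den_gt0.
have d3 := @is_deriveV R (fun t => pospart (t - e) ^+ 2 + e ^+ 2) s _ 1 den0 d2.
apply: (is_derive_eq (is_deriveM d1 d3)).
rewrite /dcutoff /GRing.scale /= addr0; field.
exact: den0.
Qed.

Lemma cut_ge0 e s : 0 <= cutoff e s.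
Proof. by rewrite /cutoff mulr_ge0 ?invr_ge0 ?addr_ge0 ?sqr_ge0. Qed.

Lemma cut_le1 e s : 0 < e -> cutoff e s <= 1.
Proof.
move=> e0; rewrite /cutoff ler_pdivrMr ?cut_den_gt0 // mul1r lerDl sqr_ge0 //.
Qed.

Lemma cut_eq0 e s : s <= e -> cutoff e s = 0.
Proof. by move=> se; rewrite /cutoff pospart_le0 ?subr_le0 // expr0n mul0r. Qed.

Lemma dcut_ge0 e s : 0 <= dcutoff e s.
Proof.
have D : 0 <= pospart (s - e) ^+ 2 + e ^+ 2 by rewrite addr_ge0 ?sqr_ge0.
rewrite /dcutoff mulr_ge0 //; last by rewrite mulr_ge0 ?invr_ge0.
by rewrite mulr_ge0 ?sqr_ge0 // mulr_ge0 ?pospart_ge0.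
Qed.

Lemma dcut_eq0 e s : s <= e -> dcutoff e s = 0.
Proof. by move=> se; rewrite /dcutoff pospart_le0 ?subr_le0 // mulr0 !mul0r. Qed.

Lemma dcut_le e s : 0 < e -> dcutoff e s <= e^-1.
Proof.
move=> e0; have D0 := cut_den_gt0 s e0; rewrite /dcutoff; set q := pospart _ in D0 *.
rewrite -invfM ler_pdivrMr ?mulr_gt0 // -[X in X <= _]mul1r -ler_pdivrMl ?invr_gt0 //
  invrK.
have q0 : 0 <= q := pospart_ge0 _.
nra.
Qed.

(** With [q = s - e] the product is [2 (q^2 e^2 + q e^3) / (q^2 + e^2)^2], and each of the two terms
    in the numerator is at most the denominator; hence the bound 2 + 2, independent of [e]. *)
Lemma dcutM_le e s : 0 < e -> 0 <= s -> s * dcutoff e s <= 4.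
Proof.
move=> e0 s0; have D0 := cut_den_gt0 s e0.
have [se|se] := leP s e; first by rewrite dcut_eq0 // mulr0.
rewrite /dcutoff pospart_gt0 in D0 *; last by rewrite subr_ge0 ltW.
set q := s - e in D0 *; have q0 : 0 < q by rewrite subr_gt0.
have -> : s = q + e by rewrite subrK.
rewrite -invfM mulrA ler_pdivrMr ?mulr_gt0 //.
have h1 : 0 < q * e by exact: mulr_gt0.
have h2 : q * e <= q ^+ 2 + e ^+ 2 by nra.
have h3 : 0 <= q ^+ 2 by exact: sqr_ge0.
have h4 : 0 <= e ^+ 2 by exact: sqr_ge0.
have h5 : q ^+ 2 * e ^+ 2 <= (q ^+ 2 + e ^+ 2) * (q ^+ 2 + e ^+ 2) by nra.
have h6 : (q * e) * e ^+ 2 <= (q ^+ 2 + e ^+ 2) * (q ^+ 2 + e ^+ 2) by apply: ler_pM =>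
  //; lra.
have -> : (q + e) * (2 * q * e ^+ 2) = 2 * (q ^+ 2 * e ^+ 2) + 2 * (q * e * e ^+ 2)
  by ring.
lra.
Qed.

Lemma cut_near1 e s : 0 < e -> e <= s / 2 -> `|cutoff e s - 1| <= 4 / s ^+ 2 * e ^+ 2.
Proof.
move=> e0 es; have D0 := cut_den_gt0 s e0.
have s0 : 0 < s by lra.
rewrite /cutoff pospart_gt0 in D0 *; last by lra.
set q := s - e in D0 *; have q0 : s / 2 <= q by rewrite /q; lra.
have -> : q ^+ 2 * (q ^+ 2 + e ^+ 2)^-1 - 1 = - (e ^+ 2 * (q ^+ 2 + e ^+ 2)^-1).
  by field; rewrite gt_eqF.
rewrite normrN ger0_norm; last by rewrite mulr_ge0 ?sqr_ge0 // invr_ge0 ltW.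
rewrite mulrC ler_wpM2r ?sqr_ge0 //.
have -> : 4 / s ^+ 2 = ((s / 2) ^+ 2)^-1 by field; rewrite gt_eqF.
rewrite lef_pV2 ?posrE // ?exprn_gt0 ?divr_gt0 //.
apply: (@le_trans _ _ (q ^+ 2)); last by rewrite lerDl sqr_ge0.
by rewrite lerXn2r // nnegrE; lra.
Qed.

(** For [e] at most [s/2] one has [q] at least [s/2], so with [D = q^2 + e^2] the factor [2 s q / D]
    is at most 4 and [e^2 / D] at most [4 e^2 / s^2]; the constant 16 is their product. *)
Lemma dcutM_near0 e s : 0 < e -> e <= s / 2 -> `|s * dcutoff e s| <= 16 / s ^+ 2 * e ^+
  2.
Proof.
move=> e0 es; have D0 := cut_den_gt0 s e0.
have s0 : 0 < s by lra.
rewrite ger0_norm; last by rewrite mulr_ge0 ?dcut_ge0 // ltW.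
rewrite /dcutoff pospart_gt0 in D0 *; last by lra.
set q := s - e in D0 *; have q0 : s / 2 <= q by rewrite /q; lra.
have qs : q <= s by rewrite /q; lra.
have D1 : s ^+ 2 / 4 <= q ^+ 2 + e ^+ 2.
  have : (s / 2) ^+ 2 <= q ^+ 2 by rewrite lerXn2r // nnegrE; lra.
  rewrite expr_div_n => h; have := sqr_ge0 e; lra.
set D := q ^+ 2 + e ^+ 2 in D0 D1 *.
have h1 : s * (2 * q) * D^-1 <= 4.
  rewrite ler_pdivrMr //; have := sqr_ge0 e; rewrite /D; nra.
have h2 : e ^+ 2 * D^-1 <= e ^+ 2 * (4 / s ^+ 2).
  rewrite ler_wpM2l ?sqr_ge0 // -[4 / _]invrK lef_pV2 ?posrE // ?invr_gt0 ?divr_gt0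
    ?exprn_gt0 //.
  by rewrite invf_div.
have -> : s * (2 * q * e ^+ 2 * (D^-1 * D^-1)) = (s * (2 * q) * D^-1) * (e ^+ 2 * D^-1)
  by ring.
have -> : 16 / s ^+ 2 * e ^+ 2 = 4 * (e ^+ 2 * (4 / s ^+ 2)) by ring.
apply: ler_pM => //; last by rewrite mulr_ge0 ?sqr_ge0 ?invr_ge0 // ltW.
by rewrite mulr_ge0 ?invr_ge0 ?(ltW D0) // !mulr_ge0 //; lra.
Qed.

Lemma measurable_pospart_shift e : measurable_fun setT ((fun s => pospart (s - e))
  : mR -> mR).
Proof.
apply: (@measurable_maxr _ mR R setT (fun=> 0) (fun s => s - e)) => //.
by apply: measurable_funB => //; exact: measurable_cst.
Qed.

Lemma measurable_cut_den e :
  measurable_fun setT ((fun s => (pospart (s - e) ^+ 2 + e ^+ 2)^-1) : mR -> mR).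
Proof.
rewrite (_ : (fun s => _) = (fun s => (pospart (s - e) ^+ 2 + e ^+ 2) `^ (-1)));
  last first.
  by apply/funext => s; rewrite powR_inv1 // addr_ge0 ?sqr_ge0.
apply: (@measurableT_comp _ _ _ _ _ _ (@powR R ^~ (-1))); first exact: measurable_powR.
apply: measurable_funD; last exact: measurable_cst.
apply: measurable_funX; exact: measurable_pospart_shift.
Qed.

Lemma measurable_cut e : measurable_fun setT (cutoff e : mR -> mR).
Proof.
apply: measurable_funM; last exact: measurable_cut_den.
apply: measurable_funX; exact: measurable_pospart_shift.
Qed.

Lemma measurable_dcut e : measurable_fun setT (dcutoff e : mR -> mR).
Proof.
apply: measurable_funM; last by apply: measurable_funM; exact: measurable_cut_den.
apply: measurable_funM; last exact: measurable_cst.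
apply: measurable_funM; first exact: measurable_cst.
exact: measurable_pospart_shift.
Qed.

Lemma cvg_of_harmonic_bound (f : nat -> R) (l C : R) (n0 : nat) :
  (forall p, (n0 <= p)%N -> `|f p - l| <= C * (p.+1%:R)^-1 ^+ 2) -> f @ \oo --> l.
Proof.
move=> h; apply/cvgrPdist_le => e e0; near=> p.
rewrite distrC; apply: le_trans (h p _) _; first by near: p; exact: nbhs_infty_ge.
have p0 : (0 : R) < p.+1%:R by rewrite ltr0n.
have p1 : (p.+1%:R)^-1 <= 1 :> R by rewrite invf_le1 // ler1n.
apply: (@le_trans _ _ (`|C| * (p.+1%:R)^-1)).
  apply: (@le_trans _ _ (`|C| * (p.+1%:R)^-1 ^+ 2)).
    by rewrite ler_wpM2r ?sqr_ge0 // ler_norm.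
  by rewrite ler_wpM2l // expr2 ler_piMr // invr_ge0 ltW.
rewrite ler_pdivrMr // -ler_pdivrMl //.
have : e^-1 * `|C| <= (Num.bound (e^-1 * `|C|))%:R.
  by rewrite ltW // archi_boundP // mulr_ge0 // invr_ge0 ltW.
move=> /le_trans; apply; rewrite ler_nat; apply: leqW; near: p; exact: nbhs_infty_ge.
Unshelve. all: by end_near. Qed.

Lemma cvg_cut s : 0 < s -> cutoff p.+1%:R^-1 s @[p --> \oo] --> (1 : R).
Proof.
move=> s0; apply: (@cvg_of_harmonic_bound _ _ (4 / s ^+ 2) (Num.bound (2 / s))) => p hp.
apply: cut_near1; first by rewrite invr_gt0 ltr0n.
have p0 : (0 : R) < p.+1%:R by rewrite ltr0n.
rewrite -[s / 2]invrK lef_pV2 ?posrE ?invr_gt0 ?divr_gt0 // invf_div.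
have : 2 / s <= (Num.bound (2 / s))%:R by rewrite ltW // archi_boundP // divr_ge0 //
  ltW.
by move=> /le_trans; apply; rewrite ler_nat leqW.
Qed.

Lemma cvg_dcut s : 0 < s -> s * dcutoff p.+1%:R^-1 s @[p --> \oo] --> (0 : R).
Proof.
move=> s0; apply: (@cvg_of_harmonic_bound _ _ (16 / s ^+ 2) (Num.bound (2 / s))) => p
  hp.
rewrite subr0; apply: dcutM_near0; first by rewrite invr_gt0 ltr0n.
have p0 : (0 : R) < p.+1%:R by rewrite ltr0n.
rewrite -[s / 2]invrK lef_pV2 ?posrE ?invr_gt0 ?divr_gt0 // invf_div.
have : 2 / s <= (Num.bound (2 / s))%:R by rewrite ltW // archi_boundP // divr_ge0 //
  ltW.
by move=> /le_trans; apply; rewrite ler_nat leqW.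
Qed.

End Cutoff.

(** * Vanishing integrals of partial derivatives *)

Section NiceClosure.
Variable R : realType.
Implicit Types (B M : R) (F G : (nat -> R) -> R).

Lemma niceD m B M M' F G : nice m B M F -> nice m B M' G ->
  nice m B (M + M') (fun v => F v + G v).
Proof.
move=> [h1 h2 h3 h4 h5] [k1 k2 k3 k4 k5]; split => //.
- exact: jmeasD.
- by rewrite addr_ge0.
- by move=> v; apply: le_trans (ler_normD _ _) _; rewrite lerD.
- by move=> v k km Bv; rewrite (h5 v k) // (k5 v k) // addr0.
Qed.

Lemma niceZ m B M a F : nice m B M F -> nice m B (`|a| * M) (fun v => a * F v).
Proof.
move=> [h1 h2 h3 h4 h5]; split => //.
- by apply: (jmeasM (G := fun _ _ => a)) => //; exact: jmeas_cst.
- by rewrite mulr_ge0.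
- by move=> v; rewrite normrM ler_wpM2l.
- by move=> v k km Bv; rewrite (h5 v k) // mulr0.
Qed.

End NiceClosure.

Section PartialIntegral.
Variables (R : realType) (n : nat).
Local Notation mR := (measurableTypeR R).
Implicit Types (F G DF : 'rV[R]_n -> R) (x y : 'rV[R]_n).

Definition rowv (v : nat -> R) : 'rV[R]_n := \row_(j < n) v (nat_of_ord j).

Definition meas_row F : Prop := jmeas n (fun (_ : unit) v => F (rowv v)).

Lemma integral_RnE F : integral_Rn F = iint n (fun v => F (rowv v)).
Proof. by []. Qed.

Lemma jmeas_shift m d (X : measurableType d) (G : X -> (nat -> R) -> R) k s : (k < m)%N
  ->
  jmeas m G -> jmeas m (fun (x : X) v => G x (fun i => v i + (i == k)%:R * s)).
Proof.
elim: m d X G k => [//|m IH] d X G [|k] km /= mG.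
  rewrite (_ : (fun p v => _) = (fun (p : X * mR) v => G p.1 (vcons (p.2 + s) v))).
    apply: (jmeas_reparam (h := fun p : X * mR => (p.1, p.2 + s : mR)) _ mG).
    apply/measurable_fun_pairP; split => /=; first exact: measurable_fst.
    by apply: measurable_funD; [exact: measurable_snd|exact: measurable_cst].
  apply/funext => p; apply/funext => v; congr (G _ _); apply/funext => -[|i] /=.
    by rewrite mul1r.
  by rewrite mul0r addr0.
rewrite (_ : (fun p v => _) = (fun (p : X * mR) v => G p.1 (vcons p.2 (fun i => v i +
  (i == k)%:R * s)))).
  exact: (IH _ _ _ _ _ mG).
apply/funext => p; apply/funext => v; congr (G _ _); apply/funext => -[|i] //=.
by rewrite mul0r addr0.
Qed.

Lemma rowv_shift v (l : 'I_n) s :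
  rowv (fun i => v i + (i == nat_of_ord l)%:R * s) = rowv v + s *: ei R l.
Proof. by apply/rowP => j; rewrite !mxE /= mulrC. Qed.

Lemma nice_row (D : set 'rV[R]_n) (B M : R) F : 0 <= B -> 0 <= M ->
  (forall x, D x -> forall j, `|x 0 j| <= B) -> meas_row F ->
  (forall y, `|F y| <= M) -> (forall y, ~ D y -> F y = 0) ->
  nice n B M (fun v => F (rowv v)).
Proof.
move=> B0 M0 DB mF FM FD; split => // v k kn Bv; apply: FD => Dv.
by have := DB _ Dv (Ordinal kn); rewrite mxE /= leNgt Bv.
Qed.

Lemma is_derive_line F (l : 'I_n) y t df : is_derive (y + t *: ei R l) (ei R l) F df ->
  is_derive t 1 (fun s : R => F (y + s *: ei R l)) df.
Proof.
move=> [dF <-]; apply: is_derive_cvg.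
rewrite (_ : (fun h => _) = (fun h : R => h^-1 *: (F (h *: ei R l + (y + t *: ei R l))
  - F (y + t *: ei R l)))).
  exact: dF.
apply/funext => h; congr (_ *: (F _ - _)).
by rewrite [h *: 1]mulr1 scalerDl addrCA.
Qed.

Lemma lipschitz_dir F DF (l : 'I_n) (C : R) y (s : R) : 0 <= s ->
  (forall y, is_derive y (ei R l) F (DF y)) -> (forall y, `|DF y| <= C) ->
  `|F (y + s *: ei R l) - F y| <= C * s.
Proof.
move=> s0 dF bF.
pose g (t : R) := F (y + t *: ei R l).
have dg (t : R) : is_derive t 1 g (DF (y + t *: ei R l)) by apply: is_derive_line;
  exact: dF.
have cg : {within `[0, s], continuous g}.
  by apply: derivable_within_continuous => t _; case: (dg t).
have [t _] := MVT_segment s0 (fun t _ => dg t) cg.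
rewrite /g scale0r addr0 subr0 => ->.
by rewrite normrM (ger0_norm s0) ler_wpM2r.
Qed.

Lemma cvg_difference_quotient F (l : 'I_n) y df : is_derive y (ei R l) F df ->
  p.+1%:R * (F (y + (p.+1%:R)^-1 *: ei R l) - F y) @[p --> \oo] --> df.
Proof.
move=> [dF <-].
have h : (p.+1%:R)^-1 @[p --> \oo] --> (0 : R)^'.
  move=> A [e /= e0 hA]; suff : \forall p \near \oo, A (p.+1%:R^-1) by [].
  near=> p; have : (p.+1%:R)^-1 != 0 :> R by rewrite invr_eq0 pnatr_eq0.
  apply: hA => /=; near: p; exact: (cvg_ball (@cvg_harmonic R) e0).
have := cvg_comp _ _ h dF; apply: cvg_trans; apply: near_eq_cvg.
by near=> p => /=; rewrite invrK [_ *: ei R l + y]addrC.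
Unshelve. all: by end_near. Qed.

(* By translation invariance the difference quotients of [F] integrate to [0]:
   no exchange of the order of integration is needed. *)
Lemma integral_partial_eq0 (D : set 'rV[R]_n) (l : 'I_n) (B C : R) F DF :
  0 <= B -> 0 <= C -> (forall x, D x -> forall j, `|x 0 j| <= B) ->
  meas_row F -> meas_row DF ->
  (forall y, `|F y| <= C) -> (forall y, `|DF y| <= C) ->
  (forall y, ~ D y -> F y = 0) -> (forall y, ~ D y -> DF y = 0) ->
  (forall y, is_derive y (ei R l) F (DF y)) -> integral_Rn DF = 0.
Proof.
move=> B0 C0 DB mF mDF bF bDF FD DFD dF.
pose s (p : nat) : R := (p.+1%:R)^-1.
have s0 p : 0 < s p by rewrite invr_gt0 ltr0n.
have s1 p : s p <= 1 by rewrite invf_le1 ?ltr0n // ler1n.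
pose Fs p v := F (rowv v + s p *: ei R l).
pose Fp p v := p.+1%:R * (Fs p v + (-1) * F (rowv v)).
have nF := nice_row B0 C0 DB mF bF FD.
(* The translations have length at most 1, so a box enlarged by 1 contains the supports of all
   difference quotients. *)
have B1 : 0 <= B + 1 by rewrite addr_ge0.
have nFs p : nice n (B + 1) C (Fs p).
  split => //.
    rewrite /Fs (_ : (fun _ v => _) = (fun (_ : unit) v => F (rowv (fun i => v i + (i
      == nat_of_ord l)%:R * s p)))).
      exact: (jmeas_shift (G := fun (_ : unit) v => F (rowv v))).
    by apply/funext => z; apply/funext => v; rewrite rowv_shift.
    by move=> v; exact: bF.
  move=> v k kn Bv; rewrite /Fs -rowv_shift; apply: (nice_supp nF kn).
  have : `|(k == nat_of_ord l)%:R * s p| <= 1.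
    by case: eqP => _; rewrite ?mul1r ?mul0r ?normr0 // ger0_norm // ltW.
  have := lerB_normD (v k) ((k == nat_of_ord l)%:R * s p).
  lra.
have nF1 : nice n (B + 1) C (fun v => F (rowv v)).
  by apply: nice_weaken nF => //; rewrite lerDl.
have iFp p : iint n (Fp p) = 0.
  rewrite (iintZ _ (niceD (nFs p) (niceZ (-1) nF1))) (iintD (nFs p) (niceZ (-1) nF1)).
  rewrite (iintZ _ nF1) -(@iint_shift R n (B + 1) C (fun v => F (rowv v)) l (s p)) //.
  rewrite (_ : iint n (fun v => F (rowv (fun i => _))) = iint n (Fs p)); first by ring.
  by apply: eq_iint => v; rewrite rowv_shift.
(* By the mean value theorem the bound on the derivative also bounds the difference quotients,
   uniformly in [p]; it is the dominating constant. *)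
have bFp p v : `|Fp p v| <= C.
  rewrite /Fp mulN1r normrM ger0_norm ?ler0n // -ler_pdivlMl ?ltr0n // mulrC.
  by apply: lipschitz_dir dF bDF; exact: ltW.
have nFp p : nice n (B + 1) C (Fp p).
  have [h1 _ _ _ h5] := niceZ p.+1%:R (niceD (nFs p) (niceZ (-1) nF1)).
  by split.
have nDF : nice n (B + 1) C (fun v => DF (rowv v)).
  by apply: nice_weaken (nice_row B0 C0 DB mDF bDF DFD) => //; rewrite lerDl.
have cv : iint n (Fp p) @[p --> \oo] --> iint n (fun v => DF (rowv v)).
  apply: (iint_cvg nFp nDF) => v.
  have := cvg_difference_quotient (dF (rowv v)); apply: cvg_trans; apply: near_eq_cvg.
  by near=> p; rewrite /Fp mulN1r.
rewrite integral_RnE; apply/esym; apply: cvg_unique cv => //.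
have E : (fun p => iint n (Fp p)) = (fun=> 0) by apply/funext => p; exact: iFp.
by rewrite /= E; exact: cvg_cst.
Unshelve. all: by end_near. Qed.

Lemma is_derive_prod_seq (I : eqType) (r : seq I) (f df : I -> 'rV[R]_n -> R) y v :
  uniq r -> (forall i, is_derive y v (f i) (df i y)) ->
  is_derive y v (fun z => \prod_(i <- r) f i z)
    (\sum_(i <- r) df i y * \prod_(k <- r | k != i) f k y).
Proof.
move=> + hf; elim: r => [_|a r IH] /=.
  rewrite big_nil (_ : (fun z => _) = cst 1); first exact: is_derive_cst.
  by apply/funext => z; rewrite big_nil.
move=> /andP[ar ur].
rewrite (_ : (fun z => _) = (f a) * (fun z => \prod_(i <- r) f i z)); last first.
  by apply/funext => z; rewrite big_cons.
apply: (is_derive_eq (is_deriveM (hf a) (IH ur))).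
rewrite big_cons big_cons eqxx /= /GRing.scale /= addrC mulrC; congr (_ * _ + _).
  rewrite [RHS]big_seq_cond [LHS]big_seq; apply: eq_bigl => k.
  by case: eqVneq => [->|]; rewrite ?(negbTE ar) ?andbT.
rewrite mulr_sumr; apply: eq_big_seq => k kr; rewrite big_cons.
have -> : a != k by apply: contraNneq ar => ->.
by rewrite mulrCA.
Qed.

Lemma is_derive_prod (d : nat) (f df : 'I_d -> 'rV[R]_n -> R) y v :
  (forall i, is_derive y v (f i) (df i y)) ->
  is_derive y v (fun z => \prod_i f i z) (\sum_i df i y * \prod_(k | k != i) f k y).
Proof.
by move=> hf; apply: is_derive_prod_seq => //; exact: index_enum_uniq.
Qed.

End PartialIntegral.

(** * Integrals over the polytope *)

Section Admissible.
Variables (R : realType) (n d : nat) (u : 'I_d -> 'rV[int]_n) (c : 'I_d -> int).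
Hypothesis hD : delzant R u c.
Local Notation mR := (measurableTypeR R).
Local Notation Delta := (polytope (R:=R) u c).
Local Notation ell := (ell (R:=R) u c).
Local Notation IDelta := (integral_Delta (R:=R) u c).
Implicit Types (f g : 'rV[R]_n -> R) (x y : 'rV[R]_n).

Lemma polytope_bounded : exists2 B : R, 0 <= B & forall x, Delta x -> forall j,
  `|x 0 j| <= B.
Proof.
case: hD => _ [M hM] _ _ _; exists `|M| => // x Dx j.
exact: le_trans (hM x Dx j) (ler_norm _).
Qed.

(** Boundedness is asked on the polytope only, since the integrands are cut off by its indicator and
    rational functions may be unbounded elsewhere. *)
Definition admissible f : Prop :=
  meas_row f /\ exists C, forall y, Delta y -> `|f y| <= C.

Lemma admissible_cst a : admissible (fun=> a).
Proof. by split; [exact: jmeas_cst|exists `|a|]. Qed.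

Lemma admissibleD f g : admissible f -> admissible g -> admissible (fun y => f y + g y).
Proof.
move=> [mf [a ha]] [mg [b hb]]; split; first exact: (jmeasD mf mg).
by exists (a + b) => y Dy; apply: le_trans (ler_normD _ _) _; rewrite lerD ?ha ?hb.
Qed.

Lemma admissibleM f g : admissible f -> admissible g -> admissible (fun y => f y * g y).
Proof.
move=> [mf [a ha]] [mg [b hb]]; split; first exact: (jmeasM mf mg).
by exists (a * b) => y Dy; rewrite normrM ler_pM ?ha ?hb.
Qed.

Lemma admissible_sum (I : Type) (r : seq I) (P : pred I) (F : I -> 'rV[R]_n -> R) :
  (forall i, P i -> admissible (F i)) -> admissible (fun y => \sum_(i <- r | P i)
    F i y).
Proof.
move=> aF; elim: r => [|i r IH].
  rewrite (_ : (fun y => _) = (fun=> 0)); first exact: admissible_cst.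
  by apply/funext => y; rewrite big_nil.
rewrite (_ : (fun y => _) = (fun y => (if P i then F i y else 0) + \sum_(j <- r | P j)
  F j y)).
  apply: admissibleD => //; case: (boolP (P i)) => Pi;
    [exact: aF|exact: admissible_cst].
by apply/funext => y; rewrite big_cons; case: ifP => // _; rewrite add0r.
Qed.

Lemma admissible_prod (I : Type) (r : seq I) (P : pred I) (F : I -> 'rV[R]_n -> R) :
  (forall i, P i -> admissible (F i)) -> admissible (fun y => \prod_(i <- r | P i)
    F i y).
Proof.
move=> aF; elim: r => [|i r IH].
  rewrite (_ : (fun y => _) = (fun=> 1)); first exact: admissible_cst.
  by apply/funext => y; rewrite big_nil.
rewrite (_ : (fun y => _) = (fun y => (if P i then F i y else 1) * \prod_(j <- r | P j)
  F j y)).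
  apply: admissibleM => //; case: (boolP (P i)) => Pi;
    [exact: aF|exact: admissible_cst].
by apply/funext => y; rewrite big_cons; case: ifP => // _; rewrite mul1r.
Qed.

Lemma admissible_polyfun p : polyfun p -> admissible p.
Proof.
move=> pp; split; first exact: jmeas_polyfun.
have [B _ hB] := polytope_bounded; exact: polyfun_bounded hB pp.
Qed.

Lemma admissible_ell i : admissible (ell i).
Proof. exact/admissible_polyfun/polyfun_ell. Qed.

Lemma indic_polytopeE y :
  \1_Delta y = \prod_i (\1_(`[0, +oo[%classic : set R) (ell i y)) :> R.
Proof.
rewrite indicE; case: (boolP (y \in Delta)) => [/set_mem Dy|nDy].
  rewrite big1 // => i _; rewrite indicE mem_set //= in_itv /= andbT; exact: Dy.
have [i hi] : exists i, ~ 0 <= ell i y.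
  apply: contrapT => /forallNP h; move/negP: nDy; apply; apply/mem_set => i.
  exact: contrapT (h i).
rewrite (bigD1 i) //= indicE memNset ?mul0r //= in_itv /= andbT; exact: hi.
Qed.

Lemma meas_row_indic : meas_row (\1_Delta : _ -> R).
Proof.
rewrite /meas_row (_ : (fun _ v => _) = (fun (_ : unit) v =>
   \prod_i (\1_(`[0, +oo[%classic : set R) (ell i (rowv n v))))).
  apply: jmeas_prod => i _; apply: (jmeas_comp (h := \1_(`[0, +oo[%classic : set R))).
    exact: measurable_indic.
  apply: jmeas_polyfun; exact: polyfun_ell.
by apply/funext => z; apply/funext => v; exact: indic_polytopeE.
Qed.

Lemma admissible_nice f B : 0 <= B -> (forall x, Delta x -> forall j, `|x 0 j| <= B) ->
  admissible f -> exists M, nice n B M (fun v => \1_Delta (rowv n v) * f (rowv n v)).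
Proof.
move=> B0 hB [mf [C hC]]; exists `|C|.
apply: (@nice_row R n Delta B `|C| (fun y => \1_Delta y * f y)) => //.
- exact: (jmeasM meas_row_indic mf).
- move=> y; rewrite indicE; case: (boolP (y \in Delta)) => [/set_mem Dy|_].
    by rewrite mul1r (le_trans (hC y Dy)) // ler_norm.
  by rewrite mul0r normr0.
- by move=> y nDy; rewrite indicE memNset // mul0r.
Qed.

Lemma IDeltaE f : IDelta f = iint n (fun v => \1_Delta (rowv n v) * f (rowv n v)).
Proof. by []. Qed.

Lemma eq_IDelta f g : (forall y, Delta y -> f y = g y) -> IDelta f = IDelta g.
Proof.
move=> fg; rewrite !IDeltaE; apply: eq_iint => v; rewrite indicE.
by case: (boolP (_ \in Delta)) => [/set_mem /fg ->|_] //; rewrite !mul0r.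
Qed.

Lemma IDeltaD f g : admissible f -> admissible g ->
  IDelta (fun y => f y + g y) = IDelta f + IDelta g.
Proof.
have [B B0 hB] := polytope_bounded.
move=> /(admissible_nice B0 hB)[a na] /(admissible_nice B0 hB)[b nb].
rewrite !IDeltaE -(iintD na nb); apply: eq_iint => v; exact: mulrDr.
Qed.

Lemma IDeltaZ a f : admissible f -> IDelta (fun y => a * f y) = a * IDelta f.
Proof.
have [B B0 hB] := polytope_bounded.
move=> /(admissible_nice B0 hB)[b nb].
rewrite !IDeltaE -(iintZ a nb); apply: eq_iint => v; exact: mulrCA.
Qed.

Lemma IDelta_sum (I : Type) (r : seq I) (F : I -> 'rV[R]_n -> R) :
  (forall i, admissible (F i)) ->
  IDelta (fun y => \sum_(i <- r) F i y) = \sum_(i <- r) IDelta (F i).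
Proof.
move=> aF; elim: r => [|i r IH].
  rewrite big_nil (_ : (fun y => _) = (fun y => 0 * 1)).
    by rewrite IDeltaZ ?mul0r //; exact: admissible_cst.
  by apply/funext => y; rewrite big_nil mul0r.
rewrite big_cons -IH -IDeltaD //; last exact: admissible_sum.
by congr IDelta; apply/funext => y; rewrite big_cons.
Qed.

Lemma IDelta_ge0 f : (forall y, Delta y -> 0 <= f y) -> 0 <= IDelta f.
Proof.
move=> f0; rewrite IDeltaE; apply: iint_ge0 => v; rewrite indicE.
by case: (boolP (_ \in Delta)) => [/set_mem /f0|_]; rewrite ?mul1r ?mul0r.
Qed.

Lemma le_IDelta f g : admissible f -> admissible g ->
  (forall y, Delta y -> f y <= g y) -> IDelta f <= IDelta g.
Proof.
move=> af ag fg; rewrite -subr_ge0.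
have -> : IDelta g - IDelta f = IDelta (fun y => g y + (-1) * f y).
  rewrite IDeltaD ?IDeltaZ ?mulN1r //; apply: admissibleM => //; exact: admissible_cst.
by apply: IDelta_ge0 => y /fg; rewrite mulN1r subr_ge0.
Qed.

Lemma normal_neq0 i : exists k : 'I_n, u i 0 k != 0.
Proof.
case: hD => /(_ i) pi _ _ _ _; apply: contrapT => /forallNP h.
have u0 : u i = 0 by apply/rowP => k; rewrite mxE; apply/eqP/negPn/negP; exact: h.
(* A zero normal would be [2 *: 0], and 2 is neither 1 nor -1. *)
by have := pi 2 0; rewrite u0 scaler0 => /(_ erefl) [].
Qed.

(** A point of the polytope outside the interior lies on one of finitely many hyperplanes, whose
    normals are nonzero because they are primitive; such sets do not affect the nested integral. *)
Lemma eq_IDelta_interior f g : admissible f -> admissible g ->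
  (forall y, (forall i, 0 < ell i y) -> f y = g y) -> IDelta f = IDelta g.
Proof.
have [B B0 hB] := polytope_bounded.
move=> /(admissible_nice B0 hB)[a na] /(admissible_nice B0 hB)[b nb] fg.
rewrite !IDeltaE.
(* The normal of facet [i] as a sequence on all naturals, 0 from index [n] on. *)
pose H i : (nat -> R) * R :=
  ((fun k => if insub k is Some j then - (u i 0 (j : 'I_n))%:~R else 0), (c i)%:~R).
have HE i (v : nat -> R) : \sum_(k < n) (H i).1 k * v k + (H i).2 = ell i (rowv n v).
  rewrite /ell /Defs.ell /H /= addrC -sumrN; congr (_ + _); apply: eq_bigr => k _.
  by rewrite valK mxE mulNr.
apply: (iint_eq_hyperplanes (H := [seq H i | i <- index_enum 'I_d]) na nb).
  move=> h /List.in_map_iff [i [<- _]]; have [k hk] := normal_neq0 i.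
  by exists k => //=; rewrite valK oppr_eq0 intr_eq0.
move=> v hv; rewrite indicE; case: (boolP (_ \in Delta)) => [/set_mem Dv|_];
  last by rewrite !mul0r.
congr (_ * _); apply: fg => i; rewrite lt_neqAle Dv andbT eq_sym -HE.
apply: hv; apply/List.in_map_iff; exists i; split => //.
elim: (index_enum 'I_d) (mem_index_enum i) => //= j r IH.
by rewrite in_cons => /orP[/eqP ->|/IH]; [left|right].
Qed.

End Admissible.

(** * Integration by parts with factors that vanish near the facets *)

Section Divergence.
Variables (R : realType) (n d : nat) (u : 'I_d -> 'rV[int]_n) (c : 'I_d -> int).
Hypothesis hD : delzant R u c.
Local Notation mR := (measurableTypeR R).
Local Notation Delta := (polytope (R:=R) u c).
Local Notation ell := (ell (R:=R) u c).
Local Notation IDelta := (integral_Delta (R:=R) u c).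
Local Notation admissible := (@admissible R n d u c).
Implicit Types (f g : 'rV[R]_n -> R) (x y : 'rV[R]_n).

Lemma normal_dot_ei i (l : 'I_n) : normal_dot u i (ei R l) = (u i 0 l)%:~R.
Proof.
rewrite /normal_dot (bigD1 l) //= big1 ?addr0; first by rewrite /ei mxE !eqxx mulr1.
by move=> j /negbTE jl; rewrite /ei mxE jl andbF mulr0.
Qed.

Lemma is_derive_ell i l y : is_derive y (ei R l) (ell i) (- (u i 0 l)%:~R).
Proof.
apply: is_derive_cvg; apply: (@cvg_trans _ ((fun _ : R => - (u i 0 l)%:~R : R)
  @ (0 : R)^')); last exact: cvg_cst.
apply: near_eq_cvg; near=> h.
have h0 : h != 0 by near: h; exact: nbhs_dnbhs_neq.
rewrite [h *: _ + y]addrC ell_shift normal_dot_ei /GRing.scale /=; field; exact: h0.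
Unshelve. all: by end_near. Qed.

Lemma is_derive_comp_ell i l y (e : R -> R) de : is_derive (ell i y) 1 e de ->
  is_derive y (ei R l) (fun z => e (ell i z)) (- (u i 0 l)%:~R * de).
Proof.
move=> de1; have de2 := is_derive_ell i l y.
have diffe : differentiable (ell i) y by apply: polyfun_differentiable;
  exact: polyfun_ell.
have dif : differentiable e (ell i y) by apply/derivable1_diffP; case: de1.
apply: DeriveDef; first by apply: diff_derivable; exact: differentiable_comp.
rewrite deriveE; last exact: differentiable_comp.
rewrite (_ : (fun z => e (ell i z)) = e \o ell i) // diff_comp // [LHS]/= diff1E //
  -deriveE //.
by rewrite derive1E !derive_val.
Qed.

Lemma near_polytope_exterior i y (eps : R) : ell i y < eps -> \forall z \near y,
  ell i z < eps.
Proof.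
move=> h.
have ce : {for y, continuous (ell i)}.
  apply: differentiable_continuous; apply: polyfun_differentiable; exact: polyfun_ell.
exact: (cvgr_lt _ ce).
Qed.

(** The kernel and its truncation are both products of one-variable functions of the [ell i y], so a
    single Leibniz computation serves them. *)
Definition edge_prod (e : 'I_d -> R -> R) y : R := \prod_i e i (ell i y).

Definition edge_dprod (e e' : 'I_d -> R -> R) i y : R :=
  e' i (ell i y) * \prod_(k | k != i) e k (ell k y).

(** As every factor vanishes for [s < eps], the product with [W] is zero near and beyond the
    boundary. It is thus differentiable on the whole space and its partial derivative has integral
    0. *)
Lemma integral_edge_partial (e e' : 'I_d -> R -> R) (eps : R) (l : 'I_n) W w :
  (forall i (s : R), is_derive s 1 (e i) (e' i s)) ->
  0 < eps -> (forall i s, s < eps -> e i s = 0 /\ e' i s = 0) ->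
  (forall i, admissible (fun y => e i (ell i y))) ->
  (forall i, admissible (fun y => e' i (ell i y))) ->
  admissible W -> admissible w ->
  (forall y, (forall i, 0 < ell i y) -> is_derive y (ei R l) W (w y)) ->
  IDelta (fun y => edge_prod e y * w y +
    W y * \sum_i (- (u i 0 l)%:~R) * edge_dprod e e' i y) = 0.
Proof.
move=> he eps0 hz ae ae' aW aw hW.
have aP : admissible (edge_prod e) by apply: admissible_prod => i _; exact: ae.
have aQ i : admissible (edge_dprod e e' i).
  by apply: admissibleM; [exact: ae'|apply: admissible_prod => k _; exact: ae].
pose F y := edge_prod e y * W y.
pose DF y := edge_prod e y * w y + W y * \sum_i (- (u i 0 l)%:~R) * edge_dprod e e' i y.
have aF : admissible F by exact: admissibleM.
have aDF : admissible DF.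
  apply: admissibleD; first exact: admissibleM.
  apply: admissibleM => //; apply: admissible_sum => i _.
  by apply: admissibleM => //; exact: admissible_cst.
have zP i y : ell i y < eps -> edge_prod e y = 0.
  by move=> h; rewrite /edge_prod (bigD1 i) //= (hz _ _ h).1 mul0r.
have zQ i y k : ell i y < eps -> edge_dprod e e' k y = 0.
  move=> h; rewrite /edge_dprod; have [->|ki] := eqVneq k i;
    first by rewrite (hz _ _ h).2 mul0r.
  by rewrite (bigD1 i) 1?eq_sym //= (hz _ _ h).1 mul0r mulr0.
have zF i y : ell i y < eps -> F y = 0 by move=> /zP; rewrite /F => ->; rewrite mul0r.
have zDF i y : ell i y < eps -> DF y = 0.
  move=> h; rewrite /DF (zP _ _ h) mul0r add0r big1 ?mulr0 // => k _.
  by rewrite (zQ _ _ _ h) mulr0.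
have ext y : ~ Delta y -> exists i, ell i y < eps.
  move=> nDy; apply: contrapT => /forallNP h; apply: nDy => i.
  by rewrite leNgt; apply/negP => hi; apply: (h i); apply: lt_trans eps0.
have bnd f : admissible f -> (forall y, ~ Delta y -> f y = 0) ->
    exists C, forall y, `|f y| <= C.
  move=> [_ [C hC]] f0; exists `|C| => y.
  have [Dy|nDy] := pselect (Delta y); first exact: le_trans (hC y Dy) (ler_norm _).
  by rewrite f0 // normr0.
have F0 y : ~ Delta y -> F y = 0 by move=> /ext[i]; exact: zF.
have DF0 y : ~ Delta y -> DF y = 0 by move=> /ext[i]; exact: zDF.
have [C1 h1] := bnd _ aF F0; have [C2 h2] := bnd _ aDF DF0.
have C10 : 0 <= C1 := le_trans (normr_ge0 _) (h1 0).
have C20 : 0 <= C2 := le_trans (normr_ge0 _) (h2 0).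
have [B B0 hB] := polytope_bounded hD.
have -> : IDelta DF = integral_Rn DF.
  rewrite IDeltaE integral_RnE; apply: eq_iint => v; rewrite indicE.
  case: (boolP (_ \in Delta)) => [_|/negP nDy]; first by rewrite mul1r.
  by rewrite mul0r DF0 // => Dy; apply: nDy; exact/mem_set.
apply: (@integral_partial_eq0 R n Delta l B (C1 + C2) F DF) => //.
- exact: addr_ge0.
- by case: aF.
- by case: aDF.
- by move=> y; apply: le_trans (h1 y) _; rewrite lerDl.
- by move=> y; apply: le_trans (h2 y) _; rewrite lerDr.
move=> y.
(* Where some [ell i y < eps] the function is locally zero; elsewhere all [ell i y] are positive and
   the derivative of [W] is available. *)
have [h|/forallNP h] := pselect (exists i, ell i y < eps).
  case: h => i hi; rewrite (zDF i y hi).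
  apply: (@near_eq_is_derive R _ _ (cst 0) F y (ei R l) 0 _ (is_derive_cst _ _ _)).
  by apply: filterS (near_polytope_exterior hi) => z /zF ->.
have pos i : 0 < ell i y.
  by apply: lt_le_trans eps0 _; rewrite leNgt; apply/negP; exact: h.
have dP : is_derive y (ei R l) (edge_prod e)
    (\sum_i (- (u i 0 l)%:~R * e' i (ell i y)) * \prod_(k | k != i) e k (ell k y)).
  apply: (@is_derive_prod R n d (fun i z => e i (ell i z)) (fun i z => - (u i 0 l)%:~R
    * e' i (ell i z))).
  by move=> i; apply: is_derive_comp_ell.
apply: (is_derive_eq (is_deriveM dP (hW y pos))).
rewrite /DF /GRing.scale /=; congr (_ + W y * _); apply: eq_bigr => i _.
by rewrite /edge_dprod mulrA.
Qed.


Lemma admissible_comp_ell i (h : R -> R) C : measurable_fun setT (h : mR -> mR) ->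
  (forall s, 0 <= s -> `|h s| <= C) -> admissible (fun y => h (ell i y)).
Proof.
move=> mh hC; split; last by exists C => y Dy; apply: hC; exact: Dy.
by apply: (jmeas_comp (h := h)) => //; apply: jmeas_polyfun; exact: polyfun_ell.
Qed.

Section Kernel.
Variables (N : nat) (x : 'rV[R]_n).
Hypothesis Dx : Delta x.

Definition edge_weight i (s : R) : R := s `^ (N%:R * ell i x) * expR (- (N%:R * s)).

Lemma E_N_edge y : E_N u c N x y = edge_prod edge_weight y.
Proof. by []. Qed.

Lemma edge_weight_ge0 i s : 0 <= edge_weight i s.
Proof. by rewrite /edge_weight mulr_ge0 ?powR_ge0 ?expR_ge0. Qed.

Lemma measurable_edge_weight i : measurable_fun setT (edge_weight i : mR -> mR).
Proof.
apply: measurable_funM; first exact: measurable_powR.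
apply: (@measurableT_comp _ _ _ _ _ _ (@expR R)); first exact: measurable_expR.
apply: (@measurable_funN _ mR R setT (fun s : mR => N%:R * s)).
by apply: measurable_funM => //; exact: measurable_cst.
Qed.

Lemma admissible_edge_weight i : admissible (fun y => edge_weight i (ell i y)).
Proof.
have [_ [L hL]] := admissible_ell hD i.
split; first by apply: (jmeas_comp (measurable_edge_weight i)); apply: jmeas_polyfun;
  exact: polyfun_ell.
exists (L `^ (N%:R * ell i x)) => y Dy.
have l0 : 0 <= ell i y := Dy i.
have lL : ell i y <= L by apply: le_trans (hL y Dy); exact: ler_norm.
rewrite ger0_norm ?edge_weight_ge0 // /edge_weight -[X in _ <= X]mulr1.
apply: ler_pM; rewrite ?powR_ge0 ?expR_ge0 //.
  apply: ge0_ler_powR; rewrite ?nnegrE //; last exact: le_trans l0 lL.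
  by rewrite mulr_ge0 //; exact: Dx.
by rewrite -[X in _ <= X](@expR0 R) ler_expR oppr_le0 mulr_ge0.
Qed.

Lemma admissible_E_N : admissible (E_N u c N x).
Proof. by apply: admissible_prod => i _; exact: admissible_edge_weight. Qed.

Definition cut_weight (eps : R) i (s : R) : R := cutoff eps s * edge_weight i s.

(** The factor [s^-1] from differentiating the power is kept next to the cutoff, which makes the
    product bounded; writing [s^(q - 1)] instead would leave a singular factor when the exponent [q]
    is below 1. *)
Definition dcut_weight (eps : R) i (s : R) : R :=
  edge_weight i s * (dcutoff eps s + (N%:R * ell i x * (cutoff eps s * s `^ (-1))
    - N%:R * cutoff eps s)).

Lemma is_derive_cut_weight (eps : R) i (s : R) : 0 < eps ->
  is_derive s 1 (cut_weight eps i) (dcut_weight eps i s).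
Proof.
move=> eps0; have [s0|s0] := ltP 0 s; last first.
  have se : s < eps by apply: le_lt_trans eps0.
  have -> : dcut_weight eps i s = 0.
    by rewrite /dcut_weight dcut_eq0 ?cut_eq0 ?(ltW se) // !(mul0r, mulr0, subr0,
      addr0).
  apply: (@near_eq_is_derive R _ _ (cst 0) (cut_weight eps i) s 1 0 _ (is_derive_cst _
    _ _)).
  near=> t; rewrite /cut_weight cut_eq0 ?mul0r // ltW //; near: t; exact: lt_nbhsl.
pose q := N%:R * ell i x.
have d1 := is_derive1_powR q s0.
have d2 : is_derive s 1 (fun t : R => - (N%:R * t)) (- N%:R).
  have := is_deriveN (is_deriveM (is_derive_cst (N%:R : R) s 1) (is_derive_id s (1 :
    R))).
  by rewrite /GRing.scale /= mulr0 addr0 mulr1.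
have d3 := @is_derive1_comp R expR (fun t => - (N%:R * t)) s _ _ (is_derive_expR _) d2.
have d4 := is_deriveM d1 d3.
apply: (is_derive_eq (is_deriveM (is_derive_cut s eps0) d4)).
rewrite /dcut_weight /edge_weight /GRing.scale /= -/q.
have -> : s `^ (q - 1) = s `^ q * s `^ (-1) by rewrite powRD //; apply/implyP => _;
  rewrite gt_eqF.
rewrite -[((fun a : R => a `^ q) * _) s]/(s `^ q * expR (- (N%:R * s))).
ring.
Unshelve. all: by end_near. Qed.

Lemma cut_weight_eq0 (eps : R) i s : s < eps -> cut_weight eps i s = 0 /\ dcut_weight
  eps i s = 0.
Proof.
move=> se; rewrite /cut_weight /dcut_weight dcut_eq0 ?cut_eq0 ?(ltW se) //.
by rewrite !(mul0r, mulr0, subr0, addr0).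
Qed.

Lemma admissible_cut (eps : R) i : 0 < eps -> admissible (fun y => cutoff eps (ell i
  y)).
Proof.
move=> eps0; apply: (@admissible_comp_ell i (cutoff eps) 1);
  first exact: measurable_cut.
by move=> s _; rewrite ger0_norm ?cut_ge0 // cut_le1.
Qed.

Lemma admissible_dcut (eps : R) i : 0 < eps -> admissible (fun y => dcutoff eps (ell i
  y)).
Proof.
move=> eps0; apply: (@admissible_comp_ell i (dcutoff eps) eps^-1);
  first exact: measurable_dcut.
by move=> s _; rewrite ger0_norm ?dcut_ge0 // dcut_le.
Qed.

Lemma admissible_cut_inv (eps : R) i : 0 < eps ->
  admissible (fun y => cutoff eps (ell i y) * ell i y `^ (-1)).
Proof.
move=> eps0; apply: (@admissible_comp_ell i (fun s => cutoff eps s * s `^ (-1)) eps^-1).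
  by apply: measurable_funM; [exact: measurable_cut|exact: measurable_powR].
move=> s s0; have [se|se] := leP s eps.
  by rewrite cut_eq0 // mul0r normr0 invr_ge0 ltW.
rewrite powR_inv1 // ger0_norm; last by rewrite mulr_ge0 ?cut_ge0 ?invr_ge0.
rewrite -[X in _ <= X]mul1r ler_pM ?cut_ge0 ?cut_le1 ?invr_ge0 //.
by rewrite lef_pV2 ?posrE //; [exact: ltW|exact: lt_trans se].
Qed.

Lemma admissible_cut_weight (eps : R) i : 0 < eps ->
  admissible (fun y => cut_weight eps i (ell i y)).
Proof.
by move=> eps0; apply: admissibleM;
  [exact: admissible_cut|exact: admissible_edge_weight].
Qed.

Lemma admissible_dcut_weight (eps : R) i : 0 < eps ->
  admissible (fun y => dcut_weight eps i (ell i y)).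
Proof.
move=> eps0; apply: admissibleM; first exact: admissible_edge_weight.
apply: admissibleD; first exact: admissible_dcut.
rewrite (_ : (fun y => _) = (fun y => (N%:R * ell i x) * (cutoff eps (ell i y)
  * ell i y `^ (-1)) +
   (- N%:R) * cutoff eps (ell i y))).
  apply: admissibleD; apply: admissibleM; try exact: admissible_cst.
    exact: admissible_cut_inv.
  exact: admissible_cut.
by apply/funext => y; rewrite mulNr.
Qed.

End Kernel.

End Divergence.

(** * Divergence theorem without boundary term for tangential fields *)

Section TangentialDivergence.
Variables (R : realType) (n d : nat) (u : 'I_d -> 'rV[int]_n) (c : 'I_d -> int).
Hypothesis hD : delzant R u c.
Local Notation Delta := (polytope (R:=R) u c).
Local Notation ell := (ell (R:=R) u c).
Local Notation IDelta := (integral_Delta (R:=R) u c).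
Local Notation admissible := (@admissible R n d u c).
Implicit Types (f g : 'rV[R]_n -> R) (y : 'rV[R]_n).

(** The pointwise limit of the cutoffs on [s >= 0]. The half-line is open since every cutoff is 0 at
    [s = 0]. *)
Definition posind (s : R) : R := \1_(`]0, +oo[%classic : set R) s.

Lemma cvg_bigprod (I : Type) (r : seq I) (P : pred I) (f : I -> nat -> R) (l : I -> R) :
  (forall i, f i p @[p --> \oo] --> l i) ->
  \prod_(i <- r | P i) f i p @[p --> \oo] --> \prod_(i <- r | P i) l i.
Proof.
move=> hf; elim: r => [|i r IH].
  rewrite big_nil (_ : (fun p => _) = (fun=> 1)); first exact: cvg_cst.
  by apply/funext => p; rewrite big_nil.
rewrite big_cons (_ : (fun p => _) = (fun p =>
  (if P i then f i p else 1) * \prod_(j <- r | P j) f j p)); last first.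
  by apply/funext => p; rewrite big_cons; case: ifP => // _; rewrite mul1r.
case: (P i); first by apply: cvgM.
by rewrite (_ : (fun p => _) = (fun p => \prod_(j <- r | P j) f j p)) //;
  apply/funext => p; rewrite mul1r.
Qed.

Lemma cvg_bigsum (I : Type) (r : seq I) (f : I -> nat -> R) (l : I -> R) :
  (forall i, f i p @[p --> \oo] --> l i) ->
  \sum_(i <- r) f i p @[p --> \oo] --> \sum_(i <- r) l i.
Proof.
move=> hf; elim: r => [|i r IH].
  rewrite big_nil (_ : (fun p => _) = (fun=> 0)); first exact: cvg_cst.
  by apply/funext => p; rewrite big_nil.
rewrite big_cons (_ : (fun p => _) = (fun p => f i p + \sum_(j <- r) f j p));
  last first.
  by apply/funext => p; rewrite big_cons.
exact: cvgD.
Qed.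

Variables (N : nat) (x : 'rV[R]_n).
Hypothesis Dx : Delta x.
Variables (W w : 'I_n -> 'rV[R]_n -> R) (m : 'I_d -> 'rV[R]_n -> R).
Hypotheses (aW : forall l, admissible (W l)) (aw : forall l, admissible (w l)).
Hypothesis am : forall i, admissible (m i).
Hypothesis dW : forall l y, (forall i, 0 < ell i y) -> is_derive y (ei R l) (W l)
  (w l y).
Hypothesis tangent : forall i y, Delta y -> \sum_l (u i 0 l)%:~R * W l y = ell i y * m
  i y.

Local Notation EN := (E_N u c N x).
Local Notation EW := (edge_weight u c N x).

(** On the polytope [EN * cutG eps] is the divergence of the truncated field. Tangency has replaced
    the pairing of [W] with the normal [u_i] by [ell_i m_i], so the derivative of the cutoff occurs
    only multiplied by [ell_i]. *)
Let cutG (eps : R) y : R :=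
  (\prod_k cutoff eps (ell k y)) * \sum_l w l y -
  \sum_i m i y * (ell i y * dcutoff eps (ell i y) * (\prod_(k | k != i) cutoff eps (ell
    k y)) +
     (\prod_k cutoff eps (ell k y)) * (N%:R * (ell i x - ell i y))).

Lemma edge_prod_cut (eps : R) y :
  edge_prod u c (cut_weight u c N x eps) y = EN y * \prod_k cutoff eps (ell k y).
Proof. by rewrite /edge_prod big_split /= mulrC. Qed.

Lemma edge_dprod_cut (eps : R) i y : 0 < eps -> Delta y ->
  ell i y * edge_dprod u c (cut_weight u c N x eps) (dcut_weight u c N x eps) i y =
  EN y * (ell i y * dcutoff eps (ell i y) * (\prod_(k | k != i) cutoff eps (ell k y)) +
     (\prod_k cutoff eps (ell k y)) * (N%:R * (ell i x - ell i y))).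
Proof.
move=> eps0 Dy; rewrite /edge_dprod big_split /=.
have -> : EN y = EW i (ell i y) * \prod_(k | k != i) EW k (ell k y).
  by rewrite E_N_edge /edge_prod (bigD1 i).
have -> : \prod_k cutoff eps (ell k y) =
    cutoff eps (ell i y) * \prod_(k | k != i) cutoff eps (ell k y) by rewrite (bigD1 i).
rewrite /dcut_weight.
(* The cancellation persists on the facet itself, where the cutoff is 0. *)
have E : ell i y * (cutoff eps (ell i y) * ell i y `^ (-1)) = cutoff eps (ell i y).
  have := Dy i; rewrite le_eqVlt => /orP[/eqP h|h].
    by rewrite -h mul0r cut_eq0 // ltW.
  by rewrite powR_inv1 ?(ltW h) // mulrCA mulfV ?mulr1 // gt_eqF.
set P1 := \prod_(k | k != i) cutoff _ _; set P2 := \prod_(k | k != i) EW k _.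
set a := cutoff eps _ in E *; set b := dcutoff eps _; set e := EW i _.
set l := ell i y in E *; set q := l `^ (-1) in E *.
have -> : l * (e * (b + (N%:R * ell i x * (a * q) - N%:R * a)) * (P1 * P2)) =
  e * P2 * P1 * (l * b + N%:R * ell i x * (l * (a * q)) - N%:R * a * l) by ring.
by rewrite E; ring.
Qed.

Lemma IDelta_cutG (eps : R) : 0 < eps -> IDelta (fun y => EN y * cutG eps y) = 0.
Proof.
move=> eps0.
have ae i : admissible (fun y => cut_weight u c N x eps i (ell i y))
  by exact: admissible_cut_weight.
have ae' i : admissible (fun y => dcut_weight u c N x eps i (ell i y))
  by exact: admissible_dcut_weight.
pose DF l y := edge_prod u c (cut_weight u c N x eps) y * w l y +
    W l y * \sum_i (- (u i 0 l)%:~R) *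
      edge_dprod u c (cut_weight u c N x eps) (dcut_weight u c N x eps) i y.
have aDF l : admissible (DF l).
  apply: admissibleD.
    by apply: admissibleM => //; apply: admissible_prod => i _.
  apply: admissibleM => //; apply: admissible_sum => i _.
  apply: admissibleM; first exact: admissible_cst.
  by apply: admissibleM => //; apply: admissible_prod => k _.
transitivity (IDelta (fun y => \sum_l DF l y)); last first.
  rewrite IDelta_sum // big1 // => l _; apply: (integral_edge_partial hD (eps :=
    eps)) => //.
  - by move=> i s; exact: is_derive_cut_weight.
  - by move=> i s; exact: cut_weight_eq0.
apply: eq_IDelta => y Dy.
rewrite /DF big_split /= -mulr_sumr edge_prod_cut /cutG mulrBr; congr (_ + _).
  by rewrite mulrA.
under [RHS]eq_bigr do rewrite mulr_sumr.
rewrite exchange_big /= mulr_sumr -sumrN; apply: eq_bigr => i _.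
rewrite [LHS](_ : _ = - (m i y * (ell i y * edge_dprod u c (cut_weight u c N x eps)
  (dcut_weight u c N x eps) i y))).
  rewrite mulrA [m i y * _]mulrC -tangent // mulr_suml -sumrN; apply: eq_bigr => l _;
    ring.
by rewrite edge_dprod_cut //; ring.
Qed.

Lemma cvg_cut_ge0 s : 0 <= s ->
  cutoff p.+1%:R^-1 s @[p --> \oo] --> posind s.
Proof.
rewrite /posind indicE le_eqVlt => /orP[/eqP <-|s0].
  rewrite memNset; last by rewrite /= in_itv /= ltxx.
  rewrite (_ : (fun p => _) = (fun=> 0)); first exact: cvg_cst.
  by apply/funext => p; rewrite cut_eq0 // invr_ge0.
by rewrite mem_set /= ?in_itv /= ?s0 //; exact: cvg_cut.
Qed.

Lemma cvg_dcut_ge0 s : 0 <= s -> s * dcutoff p.+1%:R^-1 s @[p --> \oo] --> (0 : R).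
Proof.
rewrite le_eqVlt => /orP[/eqP <-|]; last exact: cvg_dcut.
rewrite (_ : (fun p => _) = (fun=> 0)); first exact: cvg_cst.
by apply/funext => p; rewrite mul0r.
Qed.

Let Tfun y : R := \sum_l w l y - \sum_i m i y * (N%:R * (ell i x - ell i y)).

Let intind y : R := \prod_i posind (ell i y).

Lemma cvg_cutG y : Delta y -> cutG p.+1%:R^-1 y @[p --> \oo] --> intind y * Tfun y.
Proof.
move=> Dy.
have cP (P : pred 'I_d) : \prod_(k | P k) cutoff p.+1%:R^-1 (ell k y) @[p --> \oo] -->
    \prod_(k | P k) posind (ell k y).
  apply: (@cvg_bigprod _ _ P (fun k p => cutoff p.+1%:R^-1 (ell k y))) => k.
  by apply: cvg_cut_ge0; exact: Dy.
rewrite (_ : intind y * Tfun y = intind y * \sum_l w l y -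
  \sum_i m i y * (0 * (\prod_(k | k != i) posind (ell k y)) +
     intind y * (N%:R * (ell i x - ell i y)))); last first.
  rewrite /Tfun mulrBr; congr (_ - _); rewrite mulr_sumr; apply: eq_bigr => i _; ring.
apply: cvgB.
  by apply: cvgM; [exact: cP|exact: cvg_cst].
apply: cvg_bigsum => i; apply: cvgM; first exact: cvg_cst.
apply: cvgD; apply: cvgM; try exact: cP; last exact: cvg_cst.
by apply: cvg_dcut_ge0; exact: Dy.
Qed.

Lemma prod_cut_norm_le1 (eps : R) (P : pred 'I_d) y : 0 < eps ->
  `|\prod_(k | P k) cutoff eps (ell k y)| <= 1.
Proof.
move=> eps0; rewrite normr_prod; apply: prodr_ile1 => k _.
by rewrite normr_ge0 /= ger0_norm ?cut_ge0 // cut_le1.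
Qed.

Lemma admissible_norm f : admissible f -> admissible (fun y => `|f y|).
Proof.
move=> [mf [C hC]]; split; first by apply: (jmeas_comp (h := fun a : R => `|a|)) => //;
  exact: normr_measurable.
by exists C => y Dy; rewrite normr_id; exact: hC.
Qed.

Lemma admissible_ell_diff i : admissible (fun y => N%:R * (ell i x - ell i y)).
Proof.
apply: admissibleM; first exact: admissible_cst.
rewrite (_ : (fun y => _) = (fun y => ell i x + (-1) * ell i y)).
  apply: admissibleD; first exact: admissible_cst.
  by apply: admissibleM; [exact: admissible_cst|exact: admissible_ell].
by apply/funext => y; rewrite mulN1r.
Qed.

(** The bound must not depend on [eps], for dominated convergence. The only dangerous term is
    [ell_i * dcutoff eps (ell_i)], which never exceeds 4. *)
Lemma cutG_bounded : exists C, forall eps y, 0 < eps -> Delta y -> `|cutG eps y| <= C.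
Proof.
have [_ [Cw hw]] : admissible (fun y => \sum_l w l y) by apply: admissible_sum => l _.
have aT := admissible_ell_diff.
have [_ [Cm hm]] : admissible (fun y => \sum_i `|m i y| * (4 + `|N%:R * (ell i x - ell
  i y)|)).
  apply: admissible_sum => i _; apply: admissibleM; first exact: admissible_norm.
  by apply: admissibleD; [exact: admissible_cst|exact: admissible_norm].
exists (Cw + Cm) => eps y eps0 Dy.
apply: le_trans (ler_normB _ _) _; apply: lerD.
  rewrite normrM -[X in _ <= X]mul1r; apply: ler_pM => //;
    [exact: prod_cut_norm_le1|exact: hw].
apply: le_trans (hm y Dy); apply: le_trans (ler_norm_sum _ _ _) _.
rewrite [X in _ <= X]ger0_norm; last by apply: sumr_ge0 => i _;
  rewrite mulr_ge0 // addr_ge0.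
apply: ler_sum => i _; rewrite normrM ler_wpM2l //.
apply: le_trans (ler_normD _ _) _; apply: lerD.
  rewrite normrM -[4]mulr1; apply: ler_pM => //; last exact: prod_cut_norm_le1.
  rewrite ger0_norm; first by apply: dcutM_le => //; exact: Dy.
  by rewrite mulr_ge0 ?dcut_ge0 //; exact: Dy.
rewrite normrM -[X in _ <= X]mul1r; apply: ler_pM => //; exact: prod_cut_norm_le1.
Qed.

Lemma admissible_cutG (eps : R) : 0 < eps -> admissible (cutG eps).
Proof.
move=> eps0.
have aP (P : pred 'I_d) : admissible (fun y => \prod_(k | P k) cutoff eps (ell k y)).
  by apply: admissible_prod => k _; exact: admissible_cut.
rewrite /cutG (_ : (fun y => _) = (fun y => (\prod_k cutoff eps (ell k y))
  * \sum_l w l y +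
  (-1) * \sum_i m i y * (ell i y * dcutoff eps (ell i y) * (\prod_(k | k != i)
    cutoff eps (ell k y)) +
     (\prod_k cutoff eps (ell k y)) * (N%:R * (ell i x - ell i y))))); last first.
  by apply/funext => y; rewrite mulN1r.
apply: admissibleD; first by apply: admissibleM => //; apply: admissible_sum => l _.
apply: admissibleM; first exact: admissible_cst.
apply: admissible_sum => i _; apply: admissibleM => //; apply: admissibleD.
  apply: admissibleM => //; apply: admissibleM; first exact: admissible_ell.
  exact: admissible_dcut.
apply: admissibleM => //; exact: admissible_ell_diff.
Qed.

Lemma admissible_Tfun : admissible Tfun.
Proof.
rewrite /Tfun (_ : (fun y => _) = (fun y => \sum_l w l y +
  (-1) * \sum_i m i y * (N%:R * (ell i x - ell i y)))); last first.
  by apply/funext => y; rewrite mulN1r.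
apply: admissibleD; first by apply: admissible_sum => l _.
apply: admissibleM; first exact: admissible_cst.
by apply: admissible_sum => i _; apply: admissibleM => //; exact: admissible_ell_diff.
Qed.

Lemma admissible_intind : admissible intind.
Proof.
apply: admissible_prod => i _.
apply: (@admissible_comp_ell R n d u c i posind 1).
  exact: measurable_indic.
by move=> s _; rewrite /posind indicE; case: (_ \in _); rewrite ?normr1 ?normr0.
Qed.

(** The truncated identity holds for every [eps]; with [eps = 1/(p+1)] the cutoffs tend to the
    indicator of the interior and the terms with their derivatives tend to 0, all under a common
    bound. *)
Lemma tangential_divergence :
  IDelta (fun y => EN y * (\sum_l w l y - \sum_i m i y * (N%:R * (ell i x - ell i y))))
    = 0.
Proof.
have aE := admissible_E_N hD N Dx.
have aT := admissible_Tfun; have aI := admissible_intind.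
have aL : admissible (fun y => EN y * (intind y * Tfun y)).
  by apply: admissibleM => //; apply: admissibleM.
(* The limit carries the indicator of the interior, which is harmless because the boundary has no
   weight. *)
transitivity (IDelta (fun y => EN y * (intind y * Tfun y))).
  apply: (eq_IDelta_interior hD) => //; first exact: admissibleM.
  move=> y pos; congr (_ * _).
  rewrite (_ : intind y = 1) ?mul1r // /intind big1 // => i _.
  by rewrite /posind indicE mem_set //= in_itv /= pos.
have [B B0 hB] := polytope_bounded hD.
have [_ [CE hE]] := aE; have [CG hG] := cutG_bounded.
have [_ [CL hL]] := aL.
have e0 p : (0 : R) < p.+1%:R^-1 by rewrite invr_gt0 ltr0n.
pose M := `|CE * CG| + `|CL|.
have M0 : 0 <= M by exact: addr_ge0.
have nG p : nice n B M (fun v => \1_Delta (rowv n v) * (EN (rowv n v) * cutG p.+1%:R^-1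
  (rowv n v))).
  apply: (@nice_row R n Delta B M (fun y => \1_Delta y * (EN y * cutG p.+1%:R^-1
    y))) => //.
  - exact: (jmeasM (@meas_row_indic R n d u c) (jmeasM aE.1 (admissible_cutG (e0
    p)).1)).
  - move=> y; rewrite indicE; case: (boolP (_ \in Delta)) => [/set_mem Dy|_];
    last by rewrite mul0r normr0.
    rewrite mul1r normrM; apply: (@le_trans _ _ (CE * CG)).
      by apply: ler_pM => //; [exact: hE|exact: hG].
    by apply: le_trans (ler_norm _) _; rewrite lerDl.
  - by move=> y nDy; rewrite indicE memNset // mul0r.
have nL : nice n B M (fun v => \1_Delta (rowv n v) * (EN (rowv n v) * (intind (rowv n
  v) * Tfun (rowv n v)))).
  apply: (@nice_row R n Delta B M (fun y => \1_Delta y * (EN y * (intind y * Tfun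
    y)))) => //.
  - exact: (jmeasM (@meas_row_indic R n d u c) aL.1).
  - move=> y; rewrite indicE; case: (boolP (_ \in Delta)) => [/set_mem Dy|_];
    last by rewrite mul0r normr0.
    rewrite mul1r; apply: le_trans (hL y Dy) _; apply: le_trans (ler_norm _) _;
      by rewrite lerDr.
  - by move=> y nDy; rewrite indicE memNset // mul0r.
have cv := iint_cvg nG nL.
rewrite IDeltaE; apply/esym; apply: cvg_unique (cv _) => //; last first.
  move=> v; rewrite indicE; case: (boolP (_ \in Delta)) => [/set_mem Dy|_].
    apply: cvgM; first exact: cvg_cst.
    by apply: cvgM; [exact: cvg_cst|exact: cvg_cutG].
  rewrite mul0r (_ : (fun p => _) = (fun=> 0)); first exact: cvg_cst.
  by apply/funext => p; rewrite mul0r.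
rewrite /= (_ : (fun p => _) = (fun=> 0)); first exact: cvg_cst.
by apply/funext => p; rewrite -(IDelta_cutG (e0 p)) IDeltaE.
Qed.

End TangentialDivergence.

(** * The recursion for averages against the kernel *)

Section Expansion.
Variables (R : realType) (n d : nat) (u : 'I_d -> 'rV[int]_n) (c : 'I_d -> int).
Hypothesis hD : delzant R u c.
Local Notation Delta := (polytope (R:=R) u c).
Local Notation ell := (ell (R:=R) u c).
Local Notation IDelta := (integral_Delta (R:=R) u c).
Local Notation admissible := (@admissible R n d u c).
Local Notation Q := (@disc R n d u c).
Implicit Types (f : 'rV[R]_n -> R) (g h : 'rV[R]_n -> 'rV[R]_n -> R) (x y : 'rV[R]_n).

Lemma polytope_compact : compact Delta.
Proof.
have [B _ hB] := polytope_bounded hD.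
apply: (@subclosed_compact _ _ [set y : 'rV[R]_n | forall j, `[(- B),
  B]%classic (y ord0 j)]).
- rewrite (_ : Delta = \bigcap_(i in [set: 'I_d]) (ell i @^-1` [set t | 0 <= t])).
    apply: closed_bigI => i _; apply: preimage_closed; last exact: closed_ge.
    move=> y _; apply: differentiable_continuous; apply: polyfun_differentiable;
      exact: polyfun_ell.
  by apply/seteqP; split => y /= h i; [move=> _; exact: h|exact: (h i I)].
- by apply: (@rV_compact _ n (fun=> `[(- B), B]%classic)) => j; exact: segment_compact.
- by move=> y Dy j; rewrite /= in_itv /= -ler_norml; exact: hB.
Qed.

Lemma continuous_bounded_polytope f : continuous f -> exists C, forall y,
  Delta y -> `|f y| <= C.
Proof.
move=> cf.
have cfD : {within Delta, continuous f} by exact: continuous_subspaceT.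
have [M [_ hM]] := compact_bounded (continuous_compact cfD polytope_compact).
exists (M + 1) => y Dy; apply: (hM (M + 1)); first by rewrite ltrDl.
by exists y.
Qed.

Lemma disc_lower_bound : exists2 e : R, 0 < e & forall y, Delta y -> e <= Q y.
Proof.
have [x0 Dx0] : exists x0, Delta x0.
  by case: hD => _ _ [x0 hx0] _ _; exists x0 => i; exact: ltW.
have cQ : continuous Q.
  by move=> y; apply: differentiable_continuous; apply: polyfun_differentiable;
    exact: polyfun_disc.
have [z /set_mem Dz hz] := @EVT_min_rV R n Q Delta (ex_intro _ x0 Dx0) polytope_compact
  (continuous_subspaceT cQ).
exists (Q z); first exact: disc_gt0.
by move=> y Dy; apply: hz; exact/mem_set.
Qed.

Lemma disc_ge0 y : 0 <= Q y.
Proof. exact: sqr_ge0. Qed.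

Lemma disc_neq0 y : Delta y -> Q y != 0.
Proof. by move=> Dy; rewrite gt_eqF // disc_gt0. Qed.

Lemma admissible_ratfun g x : ratfun Q g -> Delta x -> admissible (g x).
Proof.
move=> rg Dx; split; first by apply: (jmeas_ratfun (polyfun_disc R u c)) => // y;
  exact: disc_ge0.
have [B _ hB] := polytope_bounded hD; have [e e0 he] := disc_lower_bound.
by have [C hC] := ratfun_bounded hB e0 he rg; exists C => y; exact: hC.
Qed.

Lemma ratfun_fieldV l j : ratfun Q (fun _ y => fieldV u c l j y).
Proof.
apply: ratfunM; last exact: ratfunIY.
apply: (ratfunY _ (p := fun y => \det (saddle u c y) * \adj (saddle u c y) (lshift d l)
  (lshift d j))).
by apply: polyfunM; [apply: polyfun_det|apply: polyfun_adj]; exact: polyfun_saddle.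
Qed.

Lemma ratfun_fieldM i j : ratfun Q (fun _ y => fieldM u c i j y).
Proof.
apply: ratfunM; last exact: ratfunIY.
apply: (ratfunY _ (p := fun y => \det (saddle u c y) * \adj (saddle u c y) (rshift n i)
  (lshift d j))).
by apply: polyfunM; [apply: polyfun_det|apply: polyfun_adj]; exact: polyfun_saddle.
Qed.

Lemma interior_polytope y : (forall i, 0 < ell i y) -> Delta y.
Proof. by move=> h i; exact: ltW. Qed.

(** The tangential divergence identity for the field [g V_j], with multipliers [g M_j]. *)
Lemma IDelta_by_parts N x j g (D : 'I_n -> 'rV[R]_n -> 'rV[R]_n -> R) : Delta x ->
  ratfun Q g -> (forall l, ratfun Q (D l)) ->
  (forall l x y, Q y != 0 ->
     is_derive y (ei R l) (fun y => g x y * fieldV u c l j y) (D l x y)) ->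
  N%:R * IDelta (fun y => E_N u c N x y * ((y 0 j - x 0 j) * g x y)) =
  IDelta (fun y => E_N u c N x y * \sum_l D l x y).
Proof.
move=> Dx rg rD dD.
have aE := admissible_E_N hD N Dx.
have ag := admissible_ratfun rg Dx.
have aD l := admissible_ratfun (rD l) Dx.
have aS : admissible (fun y => \sum_l D l x y) by apply: admissible_sum => l _.
have ad : admissible (fun y => (y 0 j - x 0 j) * g x y).
  apply: (admissible_ratfun (g := fun x y => (y 0 j - x 0 j) * g x y)) => //.
  by apply: ratfunM => //; exact: ratfun_diff.
have aW l : admissible (fun y => g x y * fieldV u c l j y).
  apply: (admissible_ratfun (g := fun x y => g x y * fieldV u c l j y)) => //.
  by apply: ratfunM => //; exact: ratfun_fieldV.
have am i : admissible (fun y => g x y * fieldM u c i j y).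
  apply: (admissible_ratfun (g := fun x y => g x y * fieldM u c i j y)) => //.
  by apply: ratfunM => //; exact: ratfun_fieldM.
have td := tangential_divergence hD N Dx aW aD am _ _.
apply/eqP; rewrite eq_sym -subr_eq0 -(IDeltaZ hD); last exact: admissibleM.
rewrite -mulN1r -(IDeltaZ hD); last by apply: admissibleM;
  [exact: admissible_cst|exact: admissibleM].
rewrite -(IDeltaD hD) //; last first.
- apply: admissibleM; first exact: admissible_cst.
  by apply: admissibleM; [exact: admissible_cst|exact: admissibleM].
- exact: admissibleM.
apply/eqP; rewrite -[RHS]td.
- apply: eq_IDelta => y Dy.
  have -> : \sum_i g x y * fieldM u c i j y * (N%:R * (ell i x - ell i y)) =
      N%:R * ((y 0 j - x 0 j) * g x y).
    (* Expanding [ell i x - ell i y] as the pairing of [u_i] with [y - x] and exchanging sums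
       reduces this to [U^T M = 1]. *)
    have S : \sum_i fieldM u c i j y * (ell i x - ell i y) = y 0 j - x 0 j.
      transitivity (\sum_i \sum_l (y 0 l - x 0 l) * ((u i 0 l)%:~R * fieldM u c i j y)).
        apply: eq_bigr => i _; rewrite ellB /normal_dot mulr_sumr;
          apply: eq_bigr => l _.
        by rewrite !mxE; ring.
      rewrite exchange_big /= (eq_bigr (fun l => (y 0 l - x 0 l) * (l == j)%:R)).
        rewrite (bigD1 j) //= eqxx mulr1 big1 ?addr0 // => l /negbTE ->; exact: mulr0.
      by move=> l _; rewrite -mulr_sumr fieldM_sum.
    by rewrite -S mulr_suml mulr_sumr; apply: eq_bigr => i _; ring.
  by rewrite mulN1r; ring.
- by move=> l y /interior_polytope Dy; apply: dD; exact: disc_neq0.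
move=> i y Dy.
rewrite (eq_bigr (fun l => g x y * ((u i 0 l)%:~R * fieldV u c l j y)));
  last by move=> l _; ring.
by rewrite -mulr_sumr fieldV_tangent //; ring.
Qed.

(** In positive order [g] is by definition a combination of the differences, hence zero on the
    diagonal; only order 0 calls for Hadamard division. *)
Lemma vanish_split k g : vanish Q k g ->
  exists2 h : 'I_n -> 'rV[R]_n -> 'rV[R]_n -> R, (forall j, vanish Q k.-1 (h j)) &
    forall x y, Delta x -> Delta y -> g x y = (k == 0)%N%:R * g x x + diff_comb h x y.
Proof.
case: k => [|k] /=.
  move=> rg; have [h rh hE] := ratfun_hadamard (polyfun_disc R u c) rg; exists h => //.
  by move=> x y Dx Dy; rewrite mul1r; apply: hE; exact: disc_neq0.
by move=> [h vh ->]; exists h => // x y _ _; rewrite mul0r add0r.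
Qed.

(** One order is lost in dividing by [y_j - x_j], one in differentiating [h_j V_j]; the truncated
    [k - 2] keeps order 0 at 0. The function [g'] depends neither on [x] nor on [N] as parameters,
    which makes it usable as a coefficient. *)
Lemma expansion_step k g : vanish Q k g ->
  exists2 g', vanish Q (k - 2) g' & forall x N, Delta x -> (0 < N)%N ->
    IDelta (fun y => E_N u c N x y * g x y) =
    (k == 0)%N%:R * g x x * c_N u c N x + N%:R^-1 * IDelta (fun y => E_N u c N x y * g'
      x y).
Proof.
move=> vg; have [h vh hE] := vanish_split vg.
have ex (jl : 'I_n * 'I_n) : exists D, vanish Q (k - 2) D /\ forall x y, Q y != 0 ->
    is_derive y (ei R jl.2) (fun y => h jl.1 x y * fieldV u c jl.2 jl.1 y) (D x y).
  have v1 := vanishMr (vh jl.1) (ratfun_fieldV jl.2 jl.1).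
  have [D vD dD] := vanish_derive (polyfun_disc R u c) jl.2 v1.
  by exists D; split => //; move: vD; rewrite -!subn1 -subnDA.
have [D hDD] := choice ex.
exists (fun x y => \sum_j \sum_l D (j, l) x y).
  by apply: vanish_sum => j; apply: vanish_sum => l; exact: (hDD (j, l)).1.
move=> x N Dx N0.
have aE := admissible_E_N hD N Dx.
have Nn : N%:R != 0 :> R by rewrite pnatr_eq0 -lt0n.
have rh j : ratfun Q (h j) := vanish_ratfun (vh j).
have rD jl : ratfun Q (D jl) := vanish_ratfun (hDD jl).1.
have aj j : admissible (fun y => E_N u c N x y * ((y 0 j - x 0 j) * h j x y)).
  apply: admissibleM => //.
  apply: (admissible_ratfun (g := fun x y => (y 0 j - x 0 j) * h j x y)) => //.
  by apply: ratfunM => //; exact: ratfun_diff.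
have aDj j : admissible (fun y => E_N u c N x y * \sum_l D (j, l) x y).
  apply: admissibleM => //; apply: admissible_sum => l _; exact: admissible_ratfun.
rewrite (eq_IDelta (g := fun y => (k == 0)%N%:R * g x x * E_N u c N x y +
    \sum_j E_N u c N x y * ((y 0 j - x 0 j) * h j x y))); last first.
  by move=> y Dy; rewrite (hE x y) // /diff_comb -mulr_sumr; ring.
rewrite (IDeltaD hD) //; last 2 first.
- by apply: admissibleM => //; exact: admissible_cst.
- by apply: admissible_sum => j _.
rewrite (IDeltaZ hD) // -/(c_N u c N x); congr (_ + _).
rewrite [in RHS](eq_IDelta (g := fun y => \sum_j E_N u c N x y * \sum_l D (j, l) x y));
  last first.
  by move=> y _; rewrite mulr_sumr.
rewrite !(IDelta_sum hD) // mulr_sumr; apply: eq_bigr => j _.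
have bp := IDelta_by_parts N Dx (rh j) (fun l => rD (j, l)) (fun l => (hDD (j, l)).2).
by rewrite -bp mulrA mulVf // mul1r.
Qed.


Lemma edge_weight_lower N x i (a L s : R) : Delta x -> 0 < a -> a <= s -> s <= L ->
  a `^ (N%:R * ell i x) * expR (- (N%:R * L)) <= edge_weight u c N x i s.
Proof.
move=> Dx a0 as_ sL; apply: ler_pM; rewrite ?powR_ge0 ?expR_ge0 //.
  apply: ge0_ler_powR; rewrite ?nnegrE //.
  - by rewrite mulr_ge0 //; exact: Dx.
  - exact: ltW.
  - by rewrite (le_trans _ as_) // ltW.
by rewrite ler_expR lerN2 ler_wpM2l.
Qed.

(** On a small cube around an interior point the kernel is bounded below by a positive constant. *)
Lemma c_N_gt0 N x : Delta x -> 0 < c_N u c N x.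
Proof.
move=> Dx.
have [x0 hx0] : exists x0, forall i, 0 < ell i x0 by case: hD.
(* A positive lower bound for all [ell i x0]; unlike a minimum, the inverse of a sum of inverses
   also makes sense for an empty family, thanks to the summand 1. *)
pose del : R := (1 + \sum_i (ell i x0)^-1)^-1.
have S0 : 0 <= \sum_i (ell i x0)^-1 by apply: sumr_ge0 => i _; rewrite invr_ge0 ltW.
have P1 : 0 < 1 + \sum_i (ell i x0)^-1 := ltr_pwDl ltr01 S0.
have del0 : 0 < del by rewrite invr_gt0.
have delE i : del <= ell i x0.
  rewrite -[ell i x0]invrK lef_pV2 ?posrE ?invr_gt0 //.
  rewrite (bigD1 i) //= addrCA lerDl addr_ge0 // sumr_ge0 // => k _;
    by rewrite invr_ge0 ltW.
(* [S] exceeds the sum of absolute values of each normal, so a displacement of at most [r] in every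
   coordinate changes each [ell i] by at most [r * S = del / 2]. *)
pose S : R := 1 + \sum_i \sum_(j < n) `|(u i 0 j)%:~R|.
have S1 : 0 < S by rewrite ltr_pwDl // sumr_ge0 // => i _; rewrite sumr_ge0.
pose r := del / 2 / S.
have r0 : 0 < r by rewrite !divr_gt0.
have box i y : (forall j, `|y 0 j - x0 0 j| <= r) -> del / 2 <= ell i y.
  move=> hy.
  have h1 : ell i x0 - ell i y <= r * S.
    rewrite ellB /normal_dot; apply: le_trans (ler_norm _) _;
      apply: le_trans (ler_norm_sum _ _ _) _.
    apply: (@le_trans _ _ (r * \sum_(j < n) `|(u i 0 j)%:~R|)).
      rewrite mulr_sumr; apply: ler_sum => j _; rewrite normrM mulrC ler_wpM2r //.
      by rewrite !mxE; exact: hy.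
    rewrite ler_wpM2l ?(ltW r0) // /S (bigD1 i) //= addrCA lerDl addr_ge0 //.
    by rewrite sumr_ge0 // => k _; rewrite sumr_ge0.
  have h2 : r * S = del / 2 by rewrite /r divfK // gt_eqF.
  have := delE i; lra.
have [L hL] : exists L, forall i y, Delta y -> ell i y <= L.
  have [C hC] := choice (fun i => (admissible_ell hD i).2).
  exists (\sum_i `|C i|) => i y Dy; apply: le_trans (ler_norm _) _;
    apply: le_trans (hC i y Dy) _.
  by apply: le_trans (ler_norm _) _; rewrite (bigD1 i) //= lerDl sumr_ge0.
pose lo : R := \prod_i ((del / 2) `^ (N%:R * ell i x) * expR (- (N%:R * L))).
have d20 : 0 < del / 2 by rewrite divr_gt0.
have lo0 : 0 < lo by apply: prodr_gt0 => i _; rewrite mulr_gt0 ?powR_gt0 ?expR_gt0.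
have [B B0 hB] := polytope_bounded hD.
have [M nM] := admissible_nice B0 hB (admissible_E_N hD N Dx).
pose ctr (k : nat) : R := if insub k is Some j then x0 0 (j : 'I_n) else 0.
have ge := @iint_ge_box R n B M _ (fun k => ctr k - r) (fun k => ctr k + r) lo nM.
apply: lt_le_trans (ge _ _ _).
- rewrite mulr_gt0 // prodr_gt0 // => k _; lra.
- move=> v; rewrite mulr_ge0 //.
  by apply: prodr_ge0 => i _; exact: edge_weight_ge0.
- by move=> k _; lra.
move=> v hv.
have hy i : del / 2 <= ell i (rowv n v).
  apply: box => j; have := hv j (ltn_ord j); rewrite /ctr valK !mxE => /andP[h1 h2].
  by rewrite ler_norml; apply/andP; split; lra.
have Dv : Delta (rowv n v) by move=> i; apply: le_trans (hy i); exact: ltW.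
rewrite indicE mem_set // mul1r; apply: ler_prod => i _; apply/andP; split.
  by rewrite mulr_ge0 ?powR_ge0 ?expR_ge0.
by apply: edge_weight_lower => //; exact: hL.
Qed.

Definition average N x (f : 'rV[R]_n -> R) : R :=
  (c_N u c N x)^-1 * IDelta (fun y => E_N u c N x y * f y).

Lemma averageD N x f f' : Delta x -> admissible f -> admissible f' ->
  average N x (fun y => f y + f' y) = average N x f + average N x f'.
Proof.
move=> Dx af ag; have aE := admissible_E_N hD N Dx.
rewrite /average -mulrDr -(IDeltaD hD); try exact: admissibleM.
by congr (_ * _); apply: eq_IDelta => y _; rewrite mulrDr.
Qed.

Lemma averageZ N x a f : Delta x -> admissible f ->
  average N x (fun y => a * f y) = a * average N x f.
Proof.
move=> Dx af; have aE := admissible_E_N hD N Dx.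
rewrite /average [RHS]mulrCA -[X in _ = _ * X](IDeltaZ hD); last exact: admissibleM.
by congr (_ * _); apply: eq_IDelta => y _; rewrite mulrCA.
Qed.

Lemma average_sum N x (I : Type) (r : seq I) (F : I -> 'rV[R]_n -> R) : Delta x ->
  (forall i, admissible (F i)) ->
  average N x (fun y => \sum_(i <- r) F i y) = \sum_(i <- r) average N x (F i).
Proof.
move=> Dx aF; have aE := admissible_E_N hD N Dx.
rewrite /average -mulr_sumr -(IDelta_sum hD); last by move=> i; exact: admissibleM.
by congr (_ * _); apply: eq_IDelta => y _; rewrite mulr_sumr.
Qed.

Lemma eq_average N x f f' : (forall y, Delta y -> f y = f' y) -> average N x f =
  average N x f'.
Proof. by move=> fg; congr (_ * _); apply: eq_IDelta => y /fg ->. Qed.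

Lemma average_le N x f f' : Delta x -> admissible f -> admissible f' ->
  (forall y, Delta y -> `|f y| <= f' y) -> `|average N x f| <= average N x f'.
Proof.
move=> Dx af ag fg; have aE := admissible_E_N hD N Dx.
have E0 y : 0 <= E_N u c N x y by apply: prodr_ge0 => i _; exact: edge_weight_ge0.
rewrite /average normrM ger0_norm ?invr_ge0 ?(ltW (c_N_gt0 N Dx)) //.
rewrite ler_wpM2l ?invr_ge0 ?(ltW (c_N_gt0 N Dx)) // ler_norml -mulN1r -(IDeltaZ hD);
  last exact: admissibleM.
apply/andP; split; apply: (le_IDelta hD) => //; try exact: admissibleM.
- by apply: admissibleM; [exact: admissible_cst|exact: admissibleM].
- move=> y Dy; rewrite mulN1r -mulrN ler_wpM2l // lerNl.
  by apply: le_trans (fg y Dy); rewrite -normrN ler_norm.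
- move=> y Dy; rewrite ler_wpM2l //.
  by apply: le_trans (fg y Dy); rewrite ler_norm.
Qed.

Lemma average_cst N x a : Delta x -> average N x (fun=> a) = a.
Proof.
move=> Dx; rewrite /average (eq_IDelta (g := fun y => a * E_N u c N x y)).
  rewrite (IDeltaZ hD); last exact: admissible_E_N.
  by rewrite -/(c_N u c N x) mulrCA mulVf ?mulr1 // gt_eqF // c_N_gt0.
by move=> y _; rewrite mulrC.
Qed.

(** Choice turns the recursion step into an operator [T] on functions, fixed once for all [x] and
    [N], so that coefficients can be defined by iterating it. *)
Lemma reduction_exists : exists T : nat -> ('rV[R]_n -> 'rV[R]_n -> R)
  -> 'rV[R]_n -> 'rV[R]_n -> R,
  forall k g, vanish Q k g -> vanish Q (k - 2) (T k g) /\
    forall x N, Delta x -> (0 < N)%N ->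
    average N x (g x) = (k == 0)%N%:R * g x x + N%:R^-1 * average N x (T k g x).
Proof.
have ex (p : nat * ('rV[R]_n -> 'rV[R]_n -> R)) : exists g', vanish Q p.1 p.2 ->
    vanish Q (p.1 - 2) g' /\ forall x N, Delta x -> (0 < N)%N ->
    average N x (p.2 x) = (p.1 == 0)%N%:R * p.2 x x + N%:R^-1 * average N x (g' x).
  (* Zero is a dummy value for functions that do not have the stated order. *)
  have [vg|nvg] := pselect (vanish Q p.1 p.2); last by exists (fun _ _ => 0).
  have [g' vg' hg'] := expansion_step vg; exists g' => _; split => // x N Dx N0.
  rewrite /average hg' // mulrDr; congr (_ + _); last by rewrite mulrCA.
  by rewrite mulrC mulfK // gt_eqF // c_N_gt0.
have [T hT] := choice ex; exists (fun k g => T (k, g)) => k g; exact: (hT (k, g)).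
Qed.

End Expansion.

(** * Taylor's formula on the unit interval *)

Section Taylor.
Variable R : realType.

Lemma is_derive_monomial (k : nat) (a s : R) :
  is_derive s 1 (fun t : R => a * (t ^+ k.+1 / (k.+1)`!%:R)) (a * (s ^+ k / k`!%:R)).
Proof.
have d1 : is_derive s 1 (fun t : R => t ^+ k.+1) ((k.+1%:R * s ^+ k) *: 1).
  rewrite (_ : (fun t : R => t ^+ k.+1) = id ^+ k.+1).
    exact: (@is_deriveX R R id k.+1 s 1 1 (is_derive_id _ _)).
  by apply/funext => t; rewrite exprfctE.
rewrite (_ : (fun t : R => _) = (a / (k.+1)`!%:R) \*: (fun t : R => t ^+ k.+1));
  last first.
  by apply/funext => t /=; rewrite /GRing.scale /= mulrA mulrAC.
apply: (is_derive_eq (is_deriveZ (a / (k.+1)`!%:R) d1)).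
rewrite /GRing.scale /= factS natrM; field.
by rewrite pnatr_eq0 -lt0n fact_gt0 /= nat1r pnatr_eq0.
Qed.

(** The derivative of the remainder is the remainder, one order lower, of the shifted family, so the
    mean value theorem on [[0, s]] carries the bound over; a length at most 1 keeps the constant. *)
Lemma taylor_bound (phi : nat -> R -> R) (C : R) (K : nat) :
  (forall l (s : R), is_derive s 1 (phi l) (phi l.+1 s)) ->
  (forall s, 0 <= s <= 1 -> `|phi K s| <= C) ->
  forall s, 0 <= s <= 1 ->
  `|phi 0%N s - \sum_(l < K) phi l 0 * (s ^+ l / l`!%:R)| <= C.
Proof.
elim: K phi => [|K IH] phi dphi bC s s01; first by rewrite big_ord0 subr0; exact: bC.
pose r (t : R) := phi 0%N t - \sum_(l < K.+1) phi l 0 * (t ^+ l / l`!%:R).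
pose r' (t : R) := phi 1%N t - \sum_(l < K) phi l.+1 0 * (t ^+ l / l`!%:R).
have rE : r = (phi 0%N - cst (phi 0%N 0)) - \sum_(l < K) (fun t : R => phi l.+1 0 * (t
  ^+ l.+1 / l.+1`!%:R)).
  apply/funext => t; rewrite /r big_ord_recl /= expr0 divr1 mulr1 opprD addrA.
  by congr (_ - _); rewrite fct_sumE.
have dr (t : R) : is_derive t 1 r (r' t).
  have dA := is_deriveB (dphi 0%N t) (is_derive_cst (phi 0%N 0) t 1).
  have dB : is_derive t 1 (\sum_(l < K) (fun t : R => phi l.+1 0 * (t ^+ l.+1 /
    l.+1`!%:R)))
      (\sum_(l < K) phi l.+1 0 * (t ^+ l / l`!%:R)).
    by apply: is_derive_sum => l; exact: is_derive_monomial.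
  by have := is_deriveB dA dB; rewrite subr0 -rE.
have br t : 0 <= t <= 1 -> `|r' t| <= C.
  move=> t01; exact: (IH (fun l => phi l.+1) (fun l t => dphi l.+1 t) bC t t01).
have C0 : 0 <= C by apply: le_trans (bC 0 _); rewrite ?lexx ?ler01.
case/andP: s01 => s0 s1.
have cr : {within `[0, s], continuous r}.
  by apply: derivable_within_continuous => t _; case: (dr t).
have [t] := MVT_segment s0 (fun t _ => dr t) cr.
rewrite in_itv /= => /andP[t0 ts].
have -> : r 0 = 0.
  rewrite /r big_ord_recl /= expr0 divr1 mulr1 big1 ?addr0 ?subrr // => l _.
  by rewrite expr0n mul0r mulr0.
rewrite !subr0 => h; rewrite -/(r s) h normrM (ger0_norm s0).
rewrite -[X in _ <= X]mulr1; apply: ler_pM => //.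
by apply: br; rewrite t0 (le_trans ts).
Qed.

End Taylor.

(** * Taylor coefficients indexed by words *)

Section Words.
Variables (R : realType) (n : nat).
Implicit Types (f : 'rV[R]_n -> R) (x y v : 'rV[R]_n) (w : seq 'I_n).

Definition word_diff w x y : R := \prod_(j <- w) (y 0 j - x 0 j).

Lemma vanish_word_diff (Q : 'rV[R]_n -> R) w : vanish Q (size w) (word_diff w).
Proof.
elim: w => [|j w IH] /=.
  rewrite (_ : word_diff [::] = (fun _ _ => 1)); first exact: ratfunC.
  by apply/funext => x; apply/funext => y; rewrite /word_diff big_nil.
rewrite (_ : word_diff (j :: w) = (fun x y => (y 0 j - x 0 j) * word_diff w x y)).
  exact: vanish_diffM.
by apply/funext => x; apply/funext => y; rewrite /word_diff big_cons.
Qed.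

Lemma dw_cat w w' f : dw w (dw w' f) = dw (w ++ w') f.
Proof. by elim: w => [//|j w IH] /=; rewrite IH. Qed.

Lemma smooth_dw w f : smooth f -> smooth (dw w f).
Proof. by move=> sf w' x; rewrite dw_cat; exact: sf. Qed.

Lemma smooth_continuous f : smooth f -> continuous f.
Proof. by move=> sf x; apply: differentiable_continuous; exact: (sf [::]). Qed.

Lemma sum_tupleS (l : nat) (F : seq 'I_n -> R) :
  \sum_(t : l.+1.-tuple 'I_n) F t = \sum_(j < n) \sum_(t : l.-tuple 'I_n) F (j :: t).
Proof.
rewrite pair_big /= (reindex (fun p : 'I_n * l.-tuple 'I_n => [tuple of p.1 :: p.2]))
  //=.
exists (fun t : l.+1.-tuple 'I_n => (thead t, [tuple of behead t])).
  by move=> [j t] _ /=; congr (_, _); apply: val_inj.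
by move=> t _ /=; rewrite -tuple_eta.
Qed.

Lemma derive_line f v x (s : R) : smooth f ->
  is_derive s 1 (fun t : R => f (x + t *: v))
    (\sum_j v 0 j * 'D_(ei R j) f (x + s *: v)).
Proof.
move=> sf; have df y : differentiable f y := sf [::] y.
have -> : \sum_j v 0 j * 'D_(ei R j) f (x + s *: v) = 'D_v f (x + s *: v).
  move: (x + s *: v) => z.
  have -> : 'D_v f z = \sum_j v 0 j * 'd f z (ei R j).
    rewrite deriveE // {1}(row_sum_delta v) linear_sum; apply: eq_bigr => j _.
    exact: linearZ.
  by apply: eq_bigr => j _; rewrite deriveE.
apply: is_derive_cvg.
have dc : derivable f (x + s *: v) v := diff_derivable (df _).
rewrite (_ : (fun h => _) = (fun h : R => h^-1 *: (f (h *: v + (x + s *: v))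
  - f (x + s *: v)))); first exact: dc.
by apply/funext => h; congr (_ *: (f _ - _)); rewrite [h *: 1]mulr1 scalerDl addrCA.
Qed.

(** The [l]-th derivative at [s] of [f] along the segment from [x] to [y]. Words rather than
    multi-indices match [diffop] and need no multinomial coefficients. *)
Definition taylor_coef f x y (l : nat) (s : R) : R :=
  \sum_(t : l.-tuple 'I_n) word_diff t x y * dw t f (x + s *: (y - x)).

Lemma is_derive_taylor_coef f x y l (s : R) : smooth f ->
  is_derive s 1 (taylor_coef f x y l) (taylor_coef f x y l.+1 s).
Proof.
move=> sf; rewrite /taylor_coef
  (sum_tupleS l (fun w => word_diff w x y * dw w f (x + s *: (y - x)))) exchange_big /=.
have E : is_derive s 1 (\sum_(t : l.-tuple 'I_n) (fun a : R => word_diff t x y * dw t f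
  (x + a *: (y - x))))
   (\sum_(t : l.-tuple 'I_n) \sum_(j < n) word_diff (j :: t) x y * dw (j :: t)
     f (x + s *: (y - x))).
  elim/big_ind2: _ => [|f1 d1 f2 d2|t _]; [exact: is_derive_cst|exact: is_deriveD|].
  rewrite (_ : (fun a : R => _) = word_diff t x y \*: (fun a : R => dw t f (x + a *: (y
    - x)))); last by [].
  apply: (is_derive_eq (is_deriveZ _ (derive_line (y - x) x s (smooth_dw t sf)))).
  rewrite /GRing.scale /= mulr_sumr; apply: eq_bigr => j _.
  by rewrite /word_diff big_cons !mxE; ring.
move: E; congr (is_derive s 1 _ _); by apply/funext => a; rewrite fct_sumE.
Qed.

(** Every factor is at most the largest [|y_j - x_j|], whose even power is one of the nonnegative
    summands on the right. The right-hand side is thus a polynomial of order [2 K] on the diagonal,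
    to which the expansion applies. *)
Lemma word_diff_le w x y (K : nat) : size w = K.*2 -> (0 < K)%N ->
  `|word_diff w x y| <= \sum_j word_diff (nseq K.*2 j) x y.
Proof.
move=> sw K0; case: w sw => [|j0 w] sw; first by move: K0; rewrite -double_gt0 -sw.
have := @arg_maxP _ R _ j0 xpredT (fun j => `|y 0 j - x 0 j|) isT.
set jm := [arg max_(_ > _) _]%O => _.
have hm j : `|y 0 j - x 0 j| <= `|y 0 jm - x 0 jm|.
  by rewrite /jm; case: arg_maxP => // i _; apply.
have nE j : word_diff (nseq K.*2 j) x y = (y 0 j - x 0 j) ^+ K.*2.
  by rewrite /word_diff big_nseq -Monoid.iteropE.
have nge j : 0 <= word_diff (nseq K.*2 j) x y by rewrite nE -muln2 exprM sqr_ge0.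
apply: (@le_trans _ _ (word_diff (nseq K.*2 jm) x y)); last first.
  by rewrite (bigD1 jm) //= lerDl sumr_ge0.
rewrite nE -[X in _ <= X]ger0_norm; last by rewrite -nE.
rewrite normrX -sw /word_diff normr_prod.
elim: (j0 :: w) => [|j r IH]; first by rewrite big_nil expr0.
by rewrite big_cons /= exprS ler_pM // prodr_ge0.
Qed.

End Words.

(** * Coefficients of the operators and the final estimate *)

Section Asymptotics.
Variables (R : realType) (n d : nat) (u : 'I_d -> 'rV[int]_n) (c : 'I_d -> int).
Hypothesis hD : delzant R u c.
Local Notation Delta := (polytope (R:=R) u c).
Local Notation admissible := (@admissible R n d u c).
Local Notation avg := (@average R n d u c).
Local Notation Q := (@disc R n d u c).
Implicit Types (f : 'rV[R]_n -> R) (g : 'rV[R]_n -> 'rV[R]_n -> R) (x y : 'rV[R]_n).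

Lemma admissible_continuous f : continuous f -> admissible f.
Proof.
move=> cf; split; first exact: jmeas_continuous_row.
exact: continuous_bounded_polytope.
Qed.

Lemma taylor_polytope f x K : smooth f -> Delta x -> (0 < K)%N ->
  exists2 C, 0 <= C & forall y, Delta y ->
  `|f y - \sum_(l < K.*2) \sum_(t : l.-tuple 'I_n)
       dw t f x / l`!%:R * word_diff t x y|
  <= C * \sum_j word_diff (nseq K.*2 j) x y.
Proof.
move=> sf Dx K0.
have bd (t : K.*2.-tuple 'I_n) : exists C, forall y, Delta y -> `|dw t f y| <= C.
  by apply: (continuous_bounded_polytope hD); apply: smooth_continuous;
    exact: smooth_dw.
have [Cs hCs] := choice bd.
exists (\sum_t `|Cs t|) => [|y Dy]; first exact: sumr_ge0.
have seg (s : R) : 0 <= s <= 1 -> Delta (x + s *: (y - x)).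
  move=> /andP[s0 s1] i.
  have -> : x + s *: (y - x) = s *: y + (1 - s) *: x.
    by rewrite scalerBl scale1r scalerBr addrCA.
  rewrite ell_conv; apply: addr_ge0; apply: mulr_ge0 => //.
  by rewrite subr_ge0.
have W0 : 0 <= \sum_j word_diff (nseq K.*2 j) x y.
  by apply: sumr_ge0 => j _; rewrite /word_diff big_nseq -Monoid.iteropE -/(_ ^+ _)
    -muln2 exprM sqr_ge0.
have bK (s : R) : 0 <= s <= 1 -> `|taylor_coef f x y K.*2 s| <=
    (\sum_t `|Cs t|) * \sum_j word_diff (nseq K.*2 j) x y.
  move=> s01; rewrite /taylor_coef mulr_suml; apply: le_trans (ler_norm_sum _ _ _) _.
  apply: ler_sum => t _; rewrite normrM mulrC; apply: ler_pM => //.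
    by apply: le_trans (hCs t _ (seg s s01)) _; exact: ler_norm.
  by apply: word_diff_le => //; rewrite size_tuple.
have := taylor_bound (fun l s => is_derive_taylor_coef x y l s sf) bK.
move=> /(_ 1); rewrite ler01 lexx => /(_ isT).
have -> : taylor_coef f x y 0 1 = f y.
  rewrite /taylor_coef (big_pred1 [tuple]); last by move=> t /=; rewrite tuple0.
  by rewrite /word_diff big_nil mul1r scale1r addrC subrK.
congr (_ <= _); congr (`|f y - _|); apply: eq_bigr => l _.
rewrite /taylor_coef mulr_suml; apply: eq_bigr => t _.
by rewrite scale0r addr0 expr1n; ring.
Qed.

Section Coefficients.
Variable T : nat -> ('rV[R]_n -> 'rV[R]_n -> R) -> 'rV[R]_n -> 'rV[R]_n -> R.
Hypothesis hT : forall k g, vanish Q k g -> vanish Q (k - 2) (T k g) /\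
    forall x N, Delta x -> (0 < N)%N ->
    avg N x (g x) = (k == 0)%N%:R * g x x + N%:R^-1 * avg N x (T k g x).

(* The coefficient of [N^-i] in the average of a [g] of vanishing order [k]. *)
Fixpoint coef (i k : nat) (g : 'rV[R]_n -> 'rV[R]_n -> R) x : R :=
  if i is i'.+1 then coef i' (k - 2) (T k g) x else (k == 0)%N%:R * g x x.

(** Each application of [T] lowers the order by 2, so from an order above [2 i] it cannot reach 0 in
    [i] steps. This yields both the order [2 i] of [P_i] and the decay of high moments. *)
Lemma coef_eq0 i k g x : (i.*2 < k)%N -> coef i k g x = 0.
Proof.
elim: i k g => [|i IH] k g /= ik; first by rewrite gtn_eqF // mul0r.
by apply: IH; rewrite ltn_subRL; move: ik; rewrite doubleS.
Qed.

Lemma coef_smooth i k g : vanish Q k g ->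
  exists2 s, (forall q, Ck q s) & forall x, Delta x -> s x = coef i k g x.
Proof.
elim: i k g => [|i IH] k g vg /=; last by apply: IH; exact: (hT vg).1.
have [e e0 he] := disc_lower_bound hD.
have [s cs sE] := ratfun_diag_smooth (polyfun_disc R u c) e0 he (vanish_ratfun vg).
exists (fun x => (k == 0)%N%:R * s x); first by move=> q; apply: CkM => //;
  exact: Ck_cst.
by move=> x Dx; rewrite sE.
Qed.

(** The coefficient of index 0 is the diagonal term split off by [T], and the later ones are those
    of [T k g] delayed by a factor [1/N]. The base case is boundedness of [g], averages being
    normalised. *)
Lemma expansion m k g x : vanish Q k g -> Delta x ->
  exists C, forall N, (0 < N)%N ->
  `|avg N x (g x) - \sum_(i < m) coef i k g x * N%:R ^- i| <= C * N%:R ^- m.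
Proof.
elim: m k g => [|m IH] k g vg Dx.
  have ag := admissible_ratfun hD (vanish_ratfun vg) Dx.
  have [_ [C hC]] := ag; exists C => N N0.
  rewrite big_ord0 subr0 expr0 invr1 mulr1 -[C](average_cst hD N C Dx).
  by apply: average_le => //; exact: admissible_cst.
have [vT TE] := hT vg; have [C hC] := IH _ _ vT Dx.
exists C => N N0; rewrite TE // big_ord_recl /= expr0 invr1 mulr1.
have N1 : 0 < N%:R :> R by rewrite ltr0n.
rewrite opprD addrACA subrr add0r.
rewrite (eq_bigr (fun i : 'I_m => N%:R^-1 * (coef i (k - 2) (T k g) x * N%:R ^- i)));
  last first.
  by move=> i _; rewrite mulrCA -invfM -exprS.
rewrite -mulr_sumr -mulrBr normrM ger0_norm ?invr_ge0 ?(ltW N1) //.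
rewrite exprS invfM mulrCA ler_wpM2l ?invr_ge0 ?(ltW N1) //.
exact: hC.
Qed.

(* The factorial accounts for the words that spell the same monomial. *)
Definition opcoef (i : nat) (w : seq 'I_n) x : R :=
  (size w)`!%:R^-1 * coef i (size w) (word_diff w) x.

Lemma opcoef_eq0 i w x : (i.*2 < size w)%N -> opcoef i w x = 0.
Proof. by move=> h; rewrite /opcoef coef_eq0 // mulr0. Qed.

Lemma diffop0 f x : diffop 0 (opcoef 0) f x = f x.
Proof.
rewrite /diffop big_ord_recl big_ord0 addr0 (big_pred1 [tuple]); last by move=> t /=;
  rewrite tuple0.
by rewrite /opcoef /= /word_diff big_nil invr1 !mul1r.
Qed.

Lemma diffop_smooth i f : smooth f ->
  exists g0 : 'rV[R]_n -> R, smooth g0 /\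
    forall x, Delta x -> g0 x = diffop (2 * i) (opcoef i) f x.
Proof.
move=> sf.
have ex w : exists s : 'rV[R]_n -> R, (forall q, Ck q s) /\ forall x, Delta x -> s x =
  opcoef i w x.
  have [s cs sE] := coef_smooth i (vanish_word_diff Q w).
  exists (fun x => (size w)`!%:R^-1 * s x); split; first by move=> q; apply: CkM => //;
    exact: Ck_cst.
  by move=> x Dx; rewrite sE.
have [S hS] := choice ex.
exists (fun x => \sum_(l < (2 * i).+1) \sum_(t : l.-tuple 'I_n) S t x * dw t f x);
  split.
  apply/smooth_Ck => q; apply: Ck_sum => l; apply: Ck_sum => t; apply: CkM;
    first exact: (hS t).1.
  by move: q; apply/smooth_Ck; exact: smooth_dw.
move=> x Dx; apply: eq_bigr => l _; apply: eq_bigr => t _; by rewrite (hS t).2.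
Qed.

Lemma diffop_widen i K f x : (i < K)%N ->
  diffop (2 * i) (opcoef i) f x =
  \sum_(l < K.*2) \sum_(t : l.-tuple 'I_n) opcoef i t x * dw t f x.
Proof.
move=> iK; rewrite /diffop.
have le : ((2 * i).+1 <= K.*2)%N by rewrite mul2n ltn_double.
rewrite (big_ord_widen _ (fun l => \sum_(t : l.-tuple 'I_n) opcoef i t x * dw t f x)
  le) big_mkcond /=.
apply: eq_bigr => l _; case: ifPn => // ; rewrite -leqNgt => h.
by rewrite big1 // => t _; rewrite opcoef_eq0 ?mul0r // size_tuple -mul2n.
Qed.

Lemma admissible_word_diff w x : Delta x -> admissible (word_diff w x).
Proof.
by move=> Dx; apply: (admissible_ratfun hD) => //; apply: vanish_ratfun;
  exact: vanish_word_diff.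
Qed.

Lemma integral_K_N N x f : Delta x -> smooth f ->
  integral_Delta u c (fun y => K_N u c N x y * f y) = avg N x f.
Proof.
move=> Dx sf; rewrite /average -(IDeltaZ hD); last first.
  apply: admissibleM; first exact: admissible_E_N.
  by apply: admissible_continuous; exact: smooth_continuous.
by apply: eq_IDelta => y _; rewrite /K_N mulrA.
Qed.

Lemma asymptotic_expansion f x m : smooth f -> Delta x -> (0 < m)%N ->
  exists (C : R) (N0 : nat), forall N : nat, (N0 <= N)%N ->
   `| integral_Delta u c (fun y => K_N u c N x y * f y)
      - \sum_(i < m) diffop (2 * i) (opcoef i) f x * (N%:R ^- i) | <= C * N%:R ^- m.
Proof.
move=> sf Dx m0.
have [Ct Ct0 hCt] := taylor_polytope sf Dx m0.
(* For a moment of order [2 m] all coefficients of index below [m] vanish, so its expansion reduces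
   to the error term. *)
have exR (j : 'I_n) : exists C, forall N, (0 < N)%N ->
    `|avg N x (word_diff (nseq m.*2 j) x)| <= C * N%:R ^- m.
  have [C hC] := expansion m (vanish_word_diff Q (nseq m.*2 j)) Dx.
  exists C => N N0; have := hC N N0.
  rewrite big1 ?subr0 // => i _; rewrite coef_eq0 ?mul0r // size_nseq ltn_double.
  exact: ltn_ord.
have [CR hCR] := choice exR.
have exT (w : seq 'I_n) : exists C, forall N, (0 < N)%N ->
    `|avg N x (word_diff w x) - \sum_(i < m) coef i (size w) (word_diff w)
      x * N%:R ^- i|
    <= C * N%:R ^- m := expansion m (vanish_word_diff Q w) Dx.
have [CW hCW] := choice exT.
(* The Taylor polynomial of degree [2 m - 1] at [x]: all operators [P_i] with [i < m] have order at
   most [2 m - 2], and the remainder is controlled by moments of order [2 m]. *)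
pose S y := \sum_(l < m.*2) \sum_(t : l.-tuple 'I_n) dw t f x / l`!%:R * word_diff t x
  y.
exists (\sum_(l < m.*2) \sum_(t : l.-tuple 'I_n) `|dw t f x / l`!%:R| * CW t + Ct *
  \sum_j CR j).
exists 1%N => N N0.
have aw w := admissible_word_diff w Dx.
have at_ (l : nat) (t : l.-tuple 'I_n) : admissible (fun y => dw t f x / l`!%:R *
  word_diff t x y).
  by apply: admissibleM; [exact: admissible_cst|exact: aw].
have aS : admissible S by apply: admissible_sum => l _; apply: admissible_sum => t _.
have af : admissible f by apply: admissible_continuous; exact: smooth_continuous.
have ar : admissible (fun y => f y - S y).
  rewrite (_ : (fun y => _) = (fun y => f y + (-1) * S y)).
    by apply: admissibleD => //; apply: admissibleM => //; exact: admissible_cst.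
  by apply/funext => y; rewrite mulN1r.
rewrite integral_K_N //.
have -> : avg N x f = avg N x S + avg N x (fun y => f y - S y).
  by rewrite -(averageD hD) //; apply: eq_average => y _; rewrite addrC subrK.
have -> : avg N x S = \sum_(l < m.*2) \sum_(t : l.-tuple 'I_n)
    dw t f x / l`!%:R * avg N x (word_diff t x).
  rewrite /S (average_sum hD) //; last by move=> l; apply: admissible_sum => t _.
  apply: eq_bigr => l _; rewrite (average_sum hD) //; apply: eq_bigr => t _.
  by rewrite (averageZ hD).
(* Regrouped by words, the claimed expansion is the Taylor polynomial with each moment replaced by
   its own truncated expansion, so the two sums can be compared term by term. *)
have -> : \sum_(i < m) diffop (2 * i) (opcoef i) f x * N%:R ^- i =
    \sum_(l < m.*2) \sum_(t : l.-tuple 'I_n) dw t f x / l`!%:R *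
      \sum_(i < m) coef i (size t) (word_diff t) x * N%:R ^- i.
  transitivity (\sum_(i < m) \sum_(l < m.*2) \sum_(t : l.-tuple 'I_n)
      dw t f x / l`!%:R * (coef i (size t) (word_diff t) x * N%:R ^- i)).
    apply: eq_bigr => i _; rewrite (@diffop_widen i m) // mulr_suml;
      apply: eq_bigr => l _.
    rewrite mulr_suml; apply: eq_bigr => t _.
    by rewrite /opcoef size_tuple; ring.
  rewrite exchange_big /=; apply: eq_bigr => l _; rewrite exchange_big /=;
    apply: eq_bigr => t _.
  by rewrite mulr_sumr.
rewrite addrAC -sumrB; apply: le_trans (ler_normD _ _) _; rewrite mulrDl; apply: lerD.
  rewrite mulr_suml; apply: le_trans (ler_norm_sum _ _ _) _; apply: ler_sum => l _.
  rewrite -sumrB mulr_suml; apply: le_trans (ler_norm_sum _ _ _) _;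
    apply: ler_sum => t _.
  by rewrite -mulrBr normrM -mulrA ler_wpM2l //; exact: hCW.
have aW : admissible (fun y => \sum_j word_diff (nseq m.*2 j) x y).
  by apply: admissible_sum => j _; exact: aw.
have aCW : admissible (fun y => Ct * \sum_j word_diff (nseq m.*2 j) x y).
  by apply: admissibleM => //; exact: admissible_cst.
apply: le_trans (average_le hD N Dx ar aCW hCt) _.
rewrite (averageZ hD) // -mulrA ler_wpM2l // (average_sum hD) // mulr_suml.
apply: ler_sum => j _; apply: le_trans (ler_norm _) _; exact: hCR.
Qed.

End Coefficients.

End Asymptotics.

Theorem theorem1p1 (R : realType) (n d : nat)
    (u : 'I_d -> 'rV[int]_n) (c : 'I_d -> int) :
  delzant R u c ->
  exists a : nat -> seq 'I_n -> 'rV[R]_n -> R,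
    (* P_0 = I *)
    (forall f x, polytope (R:=R) u c x -> diffop 0 (a 0%N) f x = f x) /\
    (* P_i (of order <= 2i) maps C^oo(Delta) to C^oo(Delta) *)
    (forall (i : nat) (f : 'rV[R]_n -> R), smooth f ->
       exists g : 'rV[R]_n -> R, smooth g /\
         forall x, polytope (R:=R) u c x -> g x = diffop (2 * i) (a i) f x) /\
    (* asymptotic expansion *)
    (forall (f : 'rV[R]_n -> R), smooth f ->
     forall x, polytope (R:=R) u c x ->
     forall m : nat, (0 < m)%N ->
     exists (C : R) (N0 : nat), forall N : nat, (N0 <= N)%N ->
       `| integral_Delta u c (fun y => K_N u c N x y * f y)
          - \sum_(i < m) diffop (2 * i) (a i) f x * (N%:R ^- i) |
       <= C * N%:R ^- m).
Proof.
move=> hD; have [T hT] := reduction_exists hD.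
exists (opcoef T); split; [|split].
- by move=> f x _; exact: diffop0.
- by move=> i f sf; exact: diffop_smooth.
- by move=> f sf x Dx m m0; exact: asymptotic_expansion.
Qed.
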